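(* Let $p\in[1,+\infty)$. Then $\mathcal G^*(\mathbb D_2)$ is a continuous curve $\lambda\mapsto(\alpha_\lambda,\psi_\lambda)$, defined in $[0,\lambda^*(\mathbb D_2,p)]$, such that $$\alpha_\lambda\text{ is strictly decreasing and }E_\lambda\text{ is strictly increasing in }(0,\lambda^*(\mathbb D_2,p)),$$ and $$\alpha_{\lambda^*(\mathbb D_2,p)}=0,\qquad E_{\lambda^*(\mathbb D_2,p)}=\frac{p+1}{16\pi}.$$
   Context: Let $\mathbb D_2\subset\mathbb R^2$ be the disk of unit area (centered at the origin). For $r\in(0,1)$ let $C^{2,r}_{0,+}(\overline{\mathbb D_2})=\{\psi\in C^{2,r}(\overline{\mathbb D_2}):\psi=0\text{ on }\partial\mathbb D_2,\ \psi>0\text{ in }\mathbb D_2\}$. For $\lambda\ge0$, problem $(P_\lambda)$ on $\mathbb D_2$ is: find $\alpha\in\mathbb R$, $\psi\in C^{2,r}_{0,+}(\overline{\mathbb D_2})$ with $$-\Delta\psi=(\alpha+\lambda\psi)^p\text{ in }\mathbb D_2,\quad\int_{\mathbb D_2}(\alpha+\lambda\psi)^p=1,\quad\psi>0\text{ in }\mathbb D_2,\ \psi=0\text{ on }\partial\mathbb D_2,\quad\alpha\ge0.$$ The energy of a solution $(\alpha_\lambda,\psi_\lambda)$ is $E_\lambda=\frac12\int_{\mathbb D_2}(\alpha_\lambda+\lambda\psi_\lambda)^p\psi_\lambda=\frac12\int_{\mathbb D_2}|\nabla\psi_\lambda|^2$. $\lambda^*(\mathbb D_2,p)=\sup\{\lambda>0:\alpha_\mu>0\text{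 for any solution }(\alpha_\mu,\psi_\mu)\text{ of }(P_\mu),\ \forall\mu<\lambda\}$. It is known (earlier work) that solutions of $(P_\lambda)$ on $\mathbb D_2$ are unique; $\mathcal G^*(\mathbb D_2)$ denotes the set of these unique solutions of $(P_\lambda)$. Continuity is understood in $\mathbb R\times C^{2,r}(\overline{\mathbb D_2})$. *)

(* Defs.v *)
From HB Require Import structures.
From mathcomp Require Import all_boot all_order all_algebra.
From mathcomp Require Import all_classical all_reals all_analysis.
Set Implicit Arguments.
Unset Strict Implicit.
Unset Printing Implicit Defensive.
Import Order.TTheory GRing.Theory Num.Theory.
Import numFieldNormedType.Exports.
Local Open Scope classical_set_scope.
Local Open Scope ring_scope.

Section Defs.
Context {R : realType}.

(* The library norm on R * R is the sup norm; the disk and the Hoelder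
   quotients need the Euclidean one. *)
Definition eucl (x : R * R) : R := Num.sqrt (x.1 ^+ 2 + x.2 ^+ 2).

Definition lebesgue2 := ((@lebesgue_measure R) \x (@lebesgue_measure R))%E.

(* The radius 1 / sqrt pi makes the area equal to 1. *)
Definition disk : set (R * R) := [set x | eucl x < (Num.sqrt pi)^-1].

Definition disk_bd : set (R * R) := closure disk `\` disk.

Definition dir (i : 'I_2) : R * R := if i == ord0 then (1, 0) else (0, 1).

Definition pd (i : 'I_2) (f : R * R -> R) : R * R -> R := 'D_(dir i) f.

Definition laplacian (f : R * R -> R) (x : R * R) : R :=
  \sum_(i < 2) pd i (pd i f) x.

Definition extends_cont (Omega : set (R * R)) (f : R * R -> R) : Prop :=
  exists g : R * R -> R,
    {within closure Omega, continuous g} /\ (forall x, Omega x -> g x = f x).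

Definition sup_norm (Omega : set (R * R)) (f : R * R -> R) : \bar R :=
  ereal_sup [set `|f x|%:E | x in Omega].

Definition holder_seminorm (r : R) (Omega : set (R * R)) (f : R * R -> R)
    : \bar R :=
  ereal_sup [set (`|f z.1 - f z.2| / eucl (z.1 - z.2) `^ r)%:E
            | z in [set z : (R * R) * (R * R) | [/\ Omega z.1, Omega z.2 & z.1 != z.2]]].

Definition C2r_norm (r : R) (Omega : set (R * R)) (f : R * R -> R) : \bar R :=
  (sup_norm Omega f + \sum_(i < 2) sup_norm Omega (pd i f)
   + \sum_(i < 2) \sum_(j < 2)
       (sup_norm Omega (pd i (pd j f)) + holder_seminorm r Omega (pd i (pd j f))))%E.

(* Omega is an open set and f is a total function of which only the values on
   closure Omega matter: f is in C^{2,r}(closure Omega) when it is continuous on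
   closure Omega, its partial derivatives of order 1 and 2 exist in Omega and extend
   continuously to closure Omega, and those of order 2 are r-Hoelder in Omega. *)
Definition C2r (r : R) (Omega : set (R * R)) (f : R * R -> R) : Prop :=
  [/\ {within closure Omega, continuous f},
      (forall i x, Omega x -> derivable f x (dir i)),
      (forall i, extends_cont Omega (pd i f)),
      (forall i j x, Omega x -> derivable (pd j f) x (dir i)) &
      forall i j, extends_cont Omega (pd i (pd j f)) /\
        (holder_seminorm r Omega (pd i (pd j f)) < +oo)%E].

Definition C2r_0_pos (r : R) (f : R * R -> R) : Prop :=
  [/\ C2r r disk f, (forall x, disk_bd x -> f x = 0)
    & forall x, disk x -> 0 < f x].

(* Problem (P_lambda).  The base of the real power is nonnegative on the disk
   for every solution with 0 <= lambda. *)
Definition solution (p r lambda alpha : R) (psi : R * R -> R) : Prop :=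
  [/\ C2r_0_pos r psi,
      (forall x, disk x -> - laplacian psi x = (alpha + lambda * psi x) `^ p),
      \int[lebesgue2]_(x in disk) ((alpha + lambda * psi x) `^ p) = 1
    & 0 <= alpha].

Definition energy (p lambda alpha : R) (psi : R * R -> R) : R :=
  2^-1 * \int[lebesgue2]_(x in disk)
           ((alpha + lambda * psi x) `^ p * psi x).

(* A supremum in \bar R, so that its finiteness is not built in. *)
Definition lambda_star (p r : R) : \bar R :=
  ereal_sup [set lambda%:E | lambda in [set lambda | 0 < lambda /\
    forall mu alpha psi, 0 <= mu < lambda ->
      solution p r mu alpha psi -> 0 < alpha]].

Definition Gstar (p r : R) : set (R * R * (R * R -> R)) :=
  [set s | 0 <= s.1.1 /\ solution p r s.1.1 s.1.2 s.2].

Definition continuous_curve (r : R) (I : set R) (alpha : R -> R)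
    (psi : R -> R * R -> R) : Prop :=
  {within I, continuous alpha} /\
  forall l0, I l0 ->
    C2r_norm r disk (fun x => psi l x - psi l0 x)
      @[l --> within I (nbhs l0)] --> 0%E.

(* Functions on the closed disk are represented by total functions, hence the
   comparison on closure disk only. *)
Definition curve_graph (I : set R) (alpha : R -> R) (psi : R -> R * R -> R)
    : set (R * R * (R * R -> R)) :=
  [set s | [/\ I s.1.1, s.1.2 = alpha s.1.1
             & forall x, closure disk x -> s.2 x = psi s.1.1 x]].

End Defs.

(* Main.v *)
(* Let [q] solve [(t q')' = - q_+^p / 4] with [q 0 = 1], so that [q (kappa |x|^2)] is the
   radial solution of [- Delta u = kappa u^p] with value 1 at the centre, and let [T] be
   the zero of [q].  The method of moving planes, with narrow strips and a linear barrier
   instead of Hopf's lemma, shows that every solution of (P_lambda) is radial; hence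
   [alpha + lambda psi = M q (kappa |x|^2)] by uniqueness for the radial equation, and the
   mass constraint leaves the single parameter [t = kappa / pi] in [[0, T]].  With
   [N t = - 4 t q' t = \int_0^t q^p] and [Q = q^p] one finds
     [lambda = pi t (N / t)^(1 - 1 / p)],  [alpha = q (N / t)^(- 1 / p)],
     [E = (p + 1) / (16 pi) - q (N - t Q) / (2 pi N^2)].
   Here [lambda] increases with [t].  The derivatives of [alpha] and [E] are controlled by
   [Z = t Q - N + p N^2 / (4 q)], which is positive because [Z 0 = 0] and [Z' > 0]; for
   [E] one first writes [E = J / (8 pi N^2)] with [J' = N^2 / t], by means of the Pohozaev
   multiplier, and compares [J] with [N^3 / (2 t Q)]. *)

(* Uniqueness is proved here and not taken as given: the equality for [Gstar] demands that every
   solution with [lambda >= 0] belong to the explicit family. The variable [t = |x|^2] turns the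
   radial Laplacian into [4 (t P')'], so that regularity at the centre reduces to bounds on [P'] and
   [t P'']. If [u = M q (kappa |x|^2)] solves [- Delta u = lambda u^p], then
   [kappa = lambda M^(p - 1)]; the boundary circle corresponds to [t = kappa / pi], and
   [alpha = M q t >= 0] says that [t <= T]. Since [alpha] vanishes at [t = T] only, [lambda^*] is
   the value of [lambda] there. The case [lambda = 0] escapes this scaling and is a Poisson problem
   with constant right-hand side. Moving planes get by with continuity up to the boundary because
   the nonlinearity is nondecreasing: a nonnegative difference is superharmonic and can be compared
   with a linear function. For continuity in [C^{2,r}], the derivatives up to order 2 are Lipschitz
   in [t] for the sup norm, the second ones keep a bounded Lipschitz constant in [x], and
   interpolation with [r < 1] does the rest. *)
From HB Require Import structures.
From mathcomp Require Import all_boot all_order all_algebra.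
From mathcomp Require Import ring lra.
From mathcomp Require Import all_classical all_reals all_analysis.
From mathcomp Require Import measurable_realfun.
Require Import Defs.
Set Implicit Arguments.
Unset Strict Implicit.
Unset Printing Implicit Defensive.
Import Order.TTheory GRing.Theory Num.Theory.
Import numFieldNormedType.Exports.
Local Open Scope classical_set_scope.
Local Open Scope ring_scope.

(** * Derivatives in one variable *)

Section DeriveRules.
Context {R : realType}.
Implicit Types (f g : R -> R) (x v : R).

Lemma isd_eq f x v (df df' : R) : is_derive x v f df -> df = df' ->
  is_derive x v f df'.
Proof. by move=> ? <-. Qed.

Lemma isd_cst (c x v : R) : is_derive x v (fun=> c) 0.
Proof. exact: is_derive_cst. Qed.

Lemma isd_id (x v : R) : is_derive x v (fun y => y) v.
Proof. exact: is_derive_id. Qed.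

Lemma isd_add f g x v (df dg : R) : is_derive x v f df -> is_derive x v g dg ->
  is_derive x v (fun y => f y + g y) (df + dg).
Proof. by move=> ? ?; exact: is_deriveD. Qed.

Lemma isd_opp f x v (df : R) : is_derive x v f df ->
  is_derive x v (fun y => - f y) (- df).
Proof. by move=> ?; exact: is_deriveN. Qed.

Lemma isd_mul f g x v (df dg : R) : is_derive x v f df -> is_derive x v g dg ->
  is_derive x v (fun y => f y * g y) (f x * dg + g x * df).
Proof. by move=> ? ?; exact: is_deriveM. Qed.

Lemma isd_mull (c x v : R) : is_derive x v ( *%R c) (c * v).
Proof.
apply: isd_eq (isd_mul (isd_cst c x v) (isd_id x v)) _; ring.
Qed.

Lemma isd_addl (c x v : R) : is_derive x v ( +%R c) v.
Proof.
apply: isd_eq (isd_add (isd_cst c x v) (isd_id x v)) _; ring.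
Qed.

Lemma isd_sqr f x v (df : R) : is_derive x v f df ->
  is_derive x v (fun y => f y ^+ 2) (2 * f x * df).
Proof.
move=> h; apply: is_derive_eq (isd_mul h h) _; ring.
Qed.

Lemma isd_inv f x v (df : R) : f x != 0 -> is_derive x v f df ->
  is_derive x v (fun y => (f y)^-1) (- (f x) ^- 2 * df).
Proof. by move=> f0 h; exact: is_deriveV. Qed.

Lemma isd_inv_id x v : x != 0 -> is_derive x v GRing.inv (- x ^- 2 * v).
Proof. by move=> x0; exact: (isd_inv x0 (isd_id x v)). Qed.

Lemma isd_opp_id x v : is_derive x v -%R (- v).
Proof. exact: (isd_opp (isd_id x v)). Qed.

Lemma isd_comp f g x (df dg : R) : is_derive x 1 f df -> is_derive (f x) 1 g dg ->
  is_derive x 1 (fun y => g (f y)) (dg * df).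
Proof.
move=> hf hg; have [hf1 hf2] := hf; have [hg1 hg2] := hg.
split.
  apply/derivable1_diffP/(@differentiable_comp _ _ _ _ f g); exact/derivable1_diffP.
have := derive1_comp hf1 hg1; rewrite !derive1E -hf2 -hg2; exact.
Qed.

Lemma isd_expR f x (df : R) : is_derive x 1 f df ->
  is_derive x 1 (fun y => expR (f y)) (expR (f x) * df).
Proof. by move=> h; apply: (isd_comp h); exact: is_derive_expR. Qed.

Lemma isd_continuous f x df : is_derive x 1 f df -> {for x, continuous f}.
Proof.
by move=> [h _]; apply/differentiable_continuous/derivable1_diffP.
Qed.

Lemma isd_within f (A : set R) df :
  (forall x, A x -> is_derive x 1 f (df x)) -> {within A, continuous f}.
Proof.
move=> h; apply: continuous_in_subspaceT => x.
by rewrite inE => /h /isd_continuous.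
Qed.

Lemma increment_bound f (df : R -> R) (a b L : R) : a <= b ->
  (forall x, a < x < b -> is_derive x 1 f (df x)) ->
  {within `[a, b], continuous f} ->
  (forall x, a < x < b -> `|df x| <= L) -> `|f b - f a| <= L * (b - a).
Proof.
move=> ab hd hc hL; move: ab; rewrite le_eqVlt => /orP[/eqP->|ab].
  by rewrite !subrr normr0 mulr0.
have hd' x : x \in `]a, b[ -> is_derive x 1 f (df x).
  by rewrite in_itv /=; exact: hd.
have [c cab ->] := MVT ab hd' hc.
move: cab; rewrite in_itv /= => cab.
by rewrite normrM (gtr0_norm (_ : 0 < b - a)) ?subr_gt0// ler_wpM2r ?subr_ge0 ?hL// ltW.
Qed.

Lemma deriv_ge0_le f (df : R -> R) (a b : R) : a <= b ->
  (forall x, a < x < b -> is_derive x 1 f (df x)) ->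
  {within `[a, b], continuous f} ->
  (forall x, a < x < b -> 0 <= df x) -> f a <= f b.
Proof.
move=> ab hd hc h0; move: ab; rewrite le_eqVlt => /orP[/eqP->//|ab].
have hd' x : x \in `]a, b[ -> is_derive x 1 f (df x).
  by rewrite in_itv /=; exact: hd.
have [c cab e] := MVT ab hd' hc.
move: cab; rewrite in_itv /= => cab.
by rewrite -subr_ge0 e mulr_ge0 ?h0// subr_ge0 ltW.
Qed.

Lemma deriv_gt0_lt f (df : R -> R) (a b : R) : a < b ->
  (forall x, a < x < b -> is_derive x 1 f (df x)) ->
  {within `[a, b], continuous f} ->
  (forall x, a < x < b -> 0 < df x) -> f a < f b.
Proof.
move=> ab hd hc h0.
have hd' x : x \in `]a, b[ -> is_derive x 1 f (df x).
  by rewrite in_itv /=; exact: hd.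
have [c cab e] := MVT ab hd' hc.
move: cab; rewrite in_itv /= => cab.
by rewrite -subr_gt0 e mulr_gt0 ?h0// subr_gt0.
Qed.

(** Both [g + f] and [g - f] are nondecreasing. The variable bound [dg] later carries the
    exponential weights of the Picard iteration and the square in Taylor's formula. *)
Lemma increment_dominated f g (df dg : R -> R) (a b : R) : a <= b ->
  (forall x, a < x < b -> is_derive x 1 f (df x)) ->
  (forall x, a < x < b -> is_derive x 1 g (dg x)) ->
  {within `[a, b], continuous f} -> {within `[a, b], continuous g} ->
  (forall x, a < x < b -> `|df x| <= dg x) -> `|f b - f a| <= g b - g a.
Proof.
move=> ab hf hg cf cg h.
rewrite ler_norml; apply/andP; split; rewrite -subr_ge0.
- have : (f \+ g) a <= (f \+ g) b; last by move=> /=; lra.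
  apply: (@deriv_ge0_le _ (df \+ dg)) => //.
  + by move=> x xab; apply: isd_add; [exact: hf|exact: hg].
  + by move=> x; apply: continuousD; [exact: cf|exact: cg].
  + by move=> x /h /=; rewrite ler_norml => /andP[]; lra.
- have : (g \- f) a <= (g \- f) b; last by move=> /=; lra.
  apply: (@deriv_ge0_le _ (dg \- df)) => //.
  + by move=> x xab; apply: isd_add; [exact: hg|apply: isd_opp; exact: hf].
  + by move=> x; apply: continuousB; [exact: cg|exact: cf].
  + by move=> x /h /=; rewrite ler_norml => /andP[]; lra.
Qed.

Lemma deriv0_cst f (a b : R) : a <= b ->
  (forall x, a < x < b -> is_derive x 1 f 0) ->
  {within `[a, b], continuous f} -> f a = f b.
Proof.
move=> ab hd hc; apply/eqP; rewrite eq_sym -subr_eq0 -normr_le0.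
rewrite (le_trans (@increment_bound f (fun=> 0) a b 0 ab _ hc _)) ?mul0r//.
by move=> x _; rewrite normr0.
Qed.

End DeriveRules.

(* The instances of [is_derive] in the library would be found by type class resolution,
   but in a form which depends on how the function is written. *)
Ltac derive_rec :=
  first [ eassumption
        | match goal with
          | |- is_derive _ _ (fun y => y) _ => notypeclasses refine (isd_id _ _)
          | |- is_derive _ _ (fun _ => ?c) _ => notypeclasses refine (isd_cst c _ _)
          | |- is_derive _ _ (fun y => _ + _) _ =>
              notypeclasses refine (isd_add _ _); derive_rec
          | |- is_derive _ _ ( *%R ?c) _ => notypeclasses refine (isd_mull c _ _)
          | |- is_derive _ _ ( +%R ?c) _ => notypeclasses refine (isd_addl c _ _)
          | |- is_derive _ _ (fun y => - _) _ => notypeclasses refine (isd_opp _); derive_rec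
          | |- is_derive _ _ (fun y => _ * _) _ =>
              notypeclasses refine (isd_mul _ _); derive_rec
          | |- is_derive _ _ (fun y => _ ^+ 2) _ =>
              notypeclasses refine (isd_sqr _); derive_rec
          | |- is_derive _ _ GRing.inv _ => notypeclasses refine (isd_inv_id _ _)
          | |- is_derive _ _ -%R _ => notypeclasses refine (isd_opp_id _ _)
          | |- is_derive _ _ (fun y => expR _) _ =>
              notypeclasses refine (isd_expR _); derive_rec
          | |- is_derive _ _ (fun y => (_)^-1) _ =>
              notypeclasses refine (isd_inv _ _); [|derive_rec]
          end
        | idtac ].
Ltac derive_tac := notypeclasses refine (isd_eq _ _); [derive_rec|..]; cbv beta.

Section ContinuityTools.
Context {R : realType}.
Implicit Types (f : R -> R).

Lemma continuous_at_epsP f (x : R) : {for x, continuous f} <->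
  forall e, 0 < e -> exists2 d, 0 < d & forall y, `|y - x| < d -> `|f y - f x| < e.
Proof.
split=> [h e e0|h].
  move/cvgrPdist_lt : h => /(_ e e0) /nbhs_normP[d /= d0 hd].
  exists d => // y yx; rewrite distrC; apply: hd.
  by rewrite /= distrC.
apply/cvgrPdist_lt => e e0; have [d d0 hd] := h e e0.
apply/nbhs_normP; exists d => //= y /= yx.
by rewrite distrC; apply: hd; rewrite distrC.
Qed.

Lemma lipschitz_continuous f (L : R) :
  (forall x y, `|f x - f y| <= L * `|x - y|) -> continuous f.
Proof.
move=> hL x; apply/continuous_at_epsP => e e0.
exists (e / (`|L| + 1)) => [|y yx]; first by rewrite divr_gt0// ltr_wpDl.
apply: (le_lt_trans (hL y x)); apply: (@le_lt_trans _ _ ((`|L| + 1) * `|y - x|)).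
  by rewrite ler_wpM2r// (le_trans (ler_norm _))// lerDl.
by rewrite mulrC -ltr_pdivlMr// ltr_wpDl.
Qed.

Lemma le_of_geometric (x y c : R) :
  (forall n, x <= y + c * 2^-1 ^+ n) -> x <= y.
Proof.
move=> h; apply/ler_addgt0Pr => e e0.
have : (c * 2^-1 ^+ n) @[n --> \oo] --> c * 0.
  by apply: cvgM; [exact: cvg_cst|apply: cvg_expr; rewrite ger0_norm; lra].
rewrite mulr0 => /cvgrPdist_lt /(_ e e0)[n _ /(_ n (leqnn n))] /=.
rewrite sub0r normrN => /ltW he; apply: le_trans (h n) _.
by rewrite lerD2l (le_trans (ler_norm _)).
Qed.

(** The intervals of centre [x n] and radius [r n] are nested, so the supremum of their left ends
    lies in all of them. The rate of convergence comes with the limit. *)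
Lemma monotone_sandwich_limit (x r : nat -> R) :
  (forall n, 0 <= r n) -> (forall n, `|x n.+1 - x n| <= r n - r n.+1) ->
  exists l, forall n, `|l - x n| <= r n.
Proof.
move=> r0 h.
have up n m : x n - r n <= x (n + m)%N - r (n + m)%N.
  elim: m => [|m ih]; rewrite ?addn0// addnS (le_trans ih)//.
  by have := h (n + m)%N; rewrite ler_norml => /andP[]; lra.
have dn n m : x (n + m)%N + r (n + m)%N <= x n + r n.
  elim: m => [|m ih]; rewrite ?addn0// addnS (le_trans _ ih)//.
  by have := h (n + m)%N; rewrite ler_norml => /andP[]; lra.
have ab n m : x n - r n <= x m + r m.
  have := up n m; have := dn m n; rewrite addnC; have := r0 (n + m)%N; lra.
pose A := range (fun n => x n - r n).
have hA : has_sup A.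
  split; first by exists (x 0%N - r 0%N), 0%N.
  by exists (x 0%N + r 0%N) => _ [n _ <-].
exists (sup A) => n; rewrite ler_norml; apply/andP; split.
  suff : x n - r n <= sup A by lra.
  by apply: ub_le_sup; [case: hA|exists n].
suff : sup A <= x n + r n by lra.
by apply: ge_sup; [case: hA|move=> _ [m _ <-]].
Qed.

End ContinuityTools.

(** * Inversion of the radial Laplacian *)

Section RadialInverse.
Context {R : realType}.
Implicit Types (G w h : R -> R).

Lemma primitive_exists G : continuous G ->
  exists2 N : R -> R, N 0 = 0 & forall s : R, -1 < s -> is_derive s 1 N (G s).
Proof.
move=> cG.
(* Integrating from -1 makes 0 an interior point, where the derivative is then two-sided. *)
pose F x := (\int[@lebesgue_measure R]_(t in [set` `[(-1), x]]) (G t))%R.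
exists (fun x => F x - F 0); first by rewrite subrr.
move=> s s1; suff hF : is_derive s 1 F (G s) by derive_tac; rewrite addr0.
have ig : (@lebesgue_measure R).-integrable `[(-1), s + 1] (EFin \o G).
  apply: continuous_compact_integrable; first exact: segment_compact.
  exact: continuous_subspaceT.
have [|d1 d2] := continuous_FTC1_closed _ ig s1 (cG s); first by lra.
by split; [exact: d1|rewrite -derive1E; exact: d2].
Qed.

(* [h] is the mean value of [G] over [[0, t]] and [w] its primitive: [- w / 4] solves
   the Poisson equation with right-hand side [G] in the variable [t = |x|^2]. *)
Definition radial_inverse G w h := [/\ w 0 = 0,
  forall t : R, -1 < t -> is_derive t 1 w (h t),
  forall t : R, -1 < t -> is_derive t 1 (fun s => s * h s) (G (Num.max t 0))
  & continuous h].

Lemma continuous_max0 G : continuous G -> continuous (fun t : R => G (Num.max t 0)).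
Proof.
move=> cG x; apply: (@continuous_comp _ _ _ (fun t : R => Num.max t 0)); last exact: cG.
by apply: (@continuous_max _ _ (fun t : R => t) (fun=> 0)); [exact: cvg_id|exact: cvg_cst].
Qed.

Lemma radial_inverse_exists G : continuous G -> exists w h, radial_inverse G w h.
Proof.
move=> cG; have cG0 := continuous_max0 cG.
have [N N0 dN] := primitive_exists cG0.
(* To the left of 0 the density [G (max t 0)] is the constant [G 0], and so is its mean value; with
   this extension [h] is continuous and [s * h s = N s] also for negative [s]. *)
pose h (s : R) := if s <= 0 then G 0 else N s / s.
have hN (s : R) : -1 < s -> s * h s = N s.
  move=> s1; rewrite /h; case: ifPn => s0; last first.
    by rewrite mulrC divfK// gt_eqF// ltNge.
  have e : N 0 - G 0 * 0 = N s - G 0 * s.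
    apply/esym/(@deriv0_cst _ (fun y => N y - G 0 * y)) => //.
      move=> x /andP[sx x0].
      have hx := dN x (lt_trans s1 sx); rewrite max_r ?(ltW x0)// in hx.
      by derive_tac; ring.
    apply: (@isd_within _ _ _ (fun x => G (Num.max x 0) - G 0)) => x /=.
    rewrite in_itv /= => /andP[sx _].
    by have hx := dN x (lt_le_trans s1 sx); derive_tac; ring.
  by move: e; rewrite N0; lra.
have ch : continuous h.
  move=> s; have [s0|s0|->] := ltgtP s 0.
  - apply: (@near_cst_continuous _ _ (G 0)).
    near=> z; rewrite /h ifT//; near: z.
    by exists (- s) => /=; [lra|move=> z /=; rewrite ltr_norml => /andP[]; lra].
  - have : {for s, continuous (fun y => N y / y)}.
      have hs := dN s (lt_trans (ltrN10 _) s0).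
      have [d hd] : exists d, is_derive s 1 (fun y => N y / y) d.
        by eexists; derive_rec; rewrite gt_eqF.
      exact: isd_continuous hd.
    move=> c; rewrite /continuous_at {2}/h ifF; last by apply/negbTE; rewrite -ltNge.
    apply: cvg_trans c; apply: near_eq_cvg; near=> z.
    rewrite /h ifF//; apply/negbTE; rewrite -ltNge; near: z.
    by exists s => //= z /=; rewrite ltr_norml => /andP[]; lra.
  - apply/continuous_at_epsP => e e0.
    have /continuous_at_epsP/(_ (e / 2)) := cG0 0.
    rewrite divr_gt0// => /(_ isT)[d d0 hd].
    exists d => // y; rewrite subr0 {2}/h lexx /h => yd; case: ifPn => y0.
      by rewrite subrr normr0.
    have {}y0 : 0 < y by rewrite ltNge.
    have : `|(N y - G 0 * y) - (N 0 - G 0 * 0)| <= e / 2 * (y - 0).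
      apply: (@increment_bound _ (fun y => N y - G 0 * y) (fun x => G (Num.max x 0) - G 0)).
      + exact: ltW.
      + move=> x /andP[x0 xy].
        by have hx := dN x (lt_trans (ltrN10 _) x0); derive_tac; ring.
      + apply: (@isd_within _ _ _ (fun x => G (Num.max x 0) - G 0)) => x /=.
        rewrite in_itv /= => /andP[sx _].
        by have hx := dN x (lt_le_trans (ltrN10 _) sx); derive_tac; ring.
      + move=> x /andP[x0 xy]; have := hd x; rewrite subr0 maxxx => H.
        apply/ltW/H; rewrite gtr0_norm// (lt_trans xy)//.
        by rewrite gtr0_norm in yd.
    rewrite N0 mulr0 !subr0 => hN2.
    have -> : N y / y - G 0 = (N y - G 0 * y) / y by field; rewrite gt_eqF.
    rewrite normrM normfV (gtr0_norm y0) ltr_pdivrMr//.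
    by apply: le_lt_trans hN2 _; rewrite ltr_pM2r//; lra.
have [w w0 dw] := primitive_exists ch.
exists w, h; split => // t t1.
apply: near_eq_is_derive (dN t t1).
near=> z; rewrite hN//; near: z.
by exists (t + 1) => /=; [lra|move=> z /=; rewrite ltr_norml => /andP[]; lra].
Unshelve. all: by end_near. Qed.

Section Estimates.
Variables (G1 G2 w1 w2 h1 h2 : R -> R).
Hypotheses (S1 : radial_inverse G1 w1 h1) (S2 : radial_inverse G2 w2 h2).

Let dwt (t : R) : 0 <= t -> is_derive t 1 (fun s => w1 s - w2 s) (h1 t - h2 t).
Proof.
have [_ d1 _ _] := S1; have [_ d2 _ _] := S2 => t0.
have t1 : -1 < t by lra.
by have := d1 t t1; have := d2 t t1 => ? ?; derive_tac.
Qed.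

Let dht (t : R) : 0 <= t -> is_derive t 1 (fun s => s * h1 s - s * h2 s) (G1 t - G2 t).
Proof.
have [_ _ d1 _] := S1; have [_ _ d2 _] := S2 => t0.
have t1 : -1 < t by lra.
by have := d1 t t1; have := d2 t t1; rewrite !max_l// => ? ?; derive_tac.
Qed.

(** In the norm weighted by [expR (k * t)] taking the mean value costs nothing, since the weight
    increases, and integrating gains [1 / k]. With [k] equal to the Lipschitz constant of the
    nonlinearity, the Picard map contracts on the whole half-line at once. *)
Lemma radial_inverse_dist (k K : R) : 0 < k -> 0 <= K ->
  (forall t : R, 0 <= t -> `|G1 t - G2 t| <= K * expR (k * t)) ->
  forall t : R, 0 <= t -> `|w1 t - w2 t| <= K / k * expR (k * t).
Proof.
move=> k0 K0 hG.
have dexp (c t : R) : is_derive t 1 (fun s => c * expR (k * s)) (c * k * expR (k * t)).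
  by derive_tac; ring.
have hh (t : R) : 0 < t -> `|h1 t - h2 t| <= K * expR (k * t).
  move=> t0.
  have : `|(t * h1 t - t * h2 t) - (0 * h1 0 - 0 * h2 0)|
      <= t * (K * expR (k * t)) - 0 * (K * expR (k * 0)).
    apply: (@increment_dominated _ (fun s => s * h1 s - s * h2 s)
        (fun s => s * (K * expR (k * s))) (fun s => G1 s - G2 s)
        (fun s => s * (K * k * expR (k * s)) + K * expR (k * s) * 1)).
    - exact: ltW.
    - by move=> x /andP[/ltW x0 _]; exact: dht.
    - by move=> x _; have hx := dexp K x; derive_rec.
    - by apply: isd_within => x /=; rewrite in_itv /= => /andP[x0 _]; exact: dht.
    - by apply: (@isd_within _ _ _ (fun s => s * (K * k * expR (k * s)) + K * expR (k * s) * 1)) => x _; have hx := dexp K x; derive_rec.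
    - move=> x /andP[x0 _]; apply: le_trans (hG x (ltW x0)) _.
      have : 0 <= x * (K * k * expR (k * x)).
        by have := ltW k0; have := ltW x0; move=> ? ?; rewrite !mulr_ge0 ?expR_ge0.
      lra.
  rewrite !mul0r !subr0 -mulrBr normrM (gtr0_norm t0).
  by rewrite ler_pM2l.
move=> t t0.
have [e1 _ _ _] := S1; have [e2 _ _ _] := S2.
have : `|(w1 t - w2 t) - (w1 0 - w2 0)| <= K / k * expR (k * t) - K / k * expR (k * 0).
  apply: (@increment_dominated _ (fun s => w1 s - w2 s) (fun s => K / k * expR (k * s))
    (fun s => h1 s - h2 s) (fun s => K / k * k * expR (k * s))) => //.
  - by move=> x /andP[/ltW x0 _]; exact: dwt.
  - by apply: isd_within => x /=; rewrite in_itv /= => /andP[x0 _]; exact: dwt.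
  - by apply: isd_within => x _; exact: dexp.
  - by move=> x /andP[x0 _]; rewrite divfK ?gt_eqF// hh.
rewrite e1 e2 !subr0 => /le_trans; apply.
by rewrite gerBl mulr_ge0 ?expR_ge0// divr_ge0// ltW.
Qed.

End Estimates.

Lemma radial_inverse_mean_bound G w h (K : R) : radial_inverse G w h ->
  (forall t : R, 0 <= t -> `|G t| <= K) -> forall t : R, 0 < t -> `|h t| <= K.
Proof.
move=> [_ _ d _] hG t t0.
have : `|t * h t - 0 * h 0| <= K * (t - 0).
  apply: (@increment_bound _ (fun s => s * h s) G).
  - exact: ltW.
  - by move=> x /andP[/ltW x0 _]; have := d x (lt_le_trans (ltrN10 _) x0); rewrite max_l.
  - apply: isd_within => x /=; rewrite in_itv /= => /andP[x0 _].
    exact: d x (lt_le_trans (ltrN10 _) x0).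
  - by move=> x /andP[/ltW x0 _]; exact: hG.
by rewrite mul0r !subr0 normrM (gtr0_norm t0) mulrC ler_pM2r.
Qed.

End RadialInverse.

Lemma within_continuous_epsP {R : realType} {V : normedModType R} (A : set V) (f : V -> R) :
  {within A, continuous f} <->
  forall x, A x -> forall e, 0 < e -> exists2 d, 0 < d &
    forall y, A y -> `|y - x| < d -> `|f y - f x| < e.
Proof.
split=> [/subspace_continuousP h x Ax e e0|h].
  have /cvgrPdist_lt /(_ e e0) := h x Ax.
  rewrite /prop_near1 /within /= => /nbhs_normP[d /= d0 hd]; exists d => // y Ay yx.
  by rewrite distrC; apply: hd => //=; rewrite distrC.
apply/subspace_continuousP => x Ax; apply/cvgrPdist_lt => e e0.
have [d d0 hd] := h x Ax e e0.
rewrite /prop_near1 /within /=; apply/nbhs_normP; exists d => //= y /= yx Ay.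
by rewrite distrC; apply: hd => //; rewrite distrC.
Qed.

(** * The radial profile *)

Section PositivePower.
Context {R : realType}.
Implicit Types p u v : R.

Definition ppow p u : R := Num.max u 0 `^ p.

Lemma ppow_ge0 p u : 0 <= ppow p u.
Proof. exact: powR_ge0. Qed.

Lemma ppow_pos p u : 0 <= u -> ppow p u = u `^ p.
Proof. by move=> u0; rewrite /ppow max_l. Qed.

Lemma ppow_neg p u : 1 <= p -> u <= 0 -> ppow p u = 0.
Proof. by move=> p1 u0; rewrite /ppow max_r// powR0// gt_eqF// (lt_le_trans ltr01). Qed.

Lemma ppow_gt0 p u : 0 < u -> 0 < ppow p u.
Proof. by move=> u0; rewrite ppow_pos ?ltW// powR_gt0. Qed.

Lemma ppow_le p u v : 1 <= p -> u <= v -> ppow p u <= ppow p v.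
Proof.
move=> p1 uv; apply: ge0_ler_powR.
- exact: le_trans ler01 p1.
- by rewrite nnegrE le_max lexx orbT.
- by rewrite nnegrE le_max lexx orbT.
- by rewrite ge_max !le_max uv lexx orbT.
Qed.

Lemma powR_lipschitz p u v B : 1 <= p -> 0 <= u <= v -> v <= B ->
  v `^ p - u `^ p <= p * B `^ (p - 1) * (v - u).
Proof.
move=> p1 /andP[u0 uv] vB.
have p0 : 0 < p by exact: lt_le_trans ltr01 p1.
have mono (c : R) : 0 <= c -> c <= B -> c `^ (p - 1) <= B `^ (p - 1).
  move=> c0 cB; apply: ge0_ler_powR; rewrite ?nnegrE ?subr_ge0//.
  exact: le_trans c0 cB.
(* The derivative of the power is available at positive points only; for [u = 0] the identity
   [v^p = v v^(p - 1)] replaces the mean value theorem. *)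
move: u0; rewrite le_eqVlt => /orP[/eqP u0|u0].
  rewrite -u0 powR0 ?gt_eqF// !subr0.
  have v0 : 0 <= v by rewrite u0.
  rewrite -(mulr_powRB1 v0 p0) mulrC ler_wpM2r//.
  apply: (le_trans (mono v v0 vB)).
  by rewrite -[leLHS]mul1r ler_wpM2r ?powR_ge0.
have dp (c : R) : 0 < c -> is_derive c 1 (fun x => x `^ p) (p * c `^ (p - 1)).
  exact: is_derive1_powR.
apply: (le_trans (ler_norm _)).
apply: (@increment_bound _ (fun x => x `^ p) (fun c => p * c `^ (p - 1))) => //.
- by move=> x /andP[ux _]; apply: dp; exact: lt_trans ux.
- apply: isd_within => x /=; rewrite in_itv /= => /andP[ux _].
  by apply: dp; exact: lt_le_trans ux.
- move=> x /andP[ux xv]; have x0 := lt_trans u0 ux.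
  rewrite ger0_norm; last by rewrite mulr_ge0 ?powR_ge0// ltW.
  by rewrite ler_pM2l// mono ?(ltW x0)// (le_trans (ltW xv)).
Qed.

Lemma ppow_lipschitz p B u v : 1 <= p -> 0 <= B -> u <= B -> v <= B ->
  `|ppow p u - ppow p v| <= p * B `^ (p - 1) * `|u - v|.
Proof.
move=> p1 B0; wlog uv : u v / u <= v => [H uB vB|].
  have /orP[uv|vu] := le_total u v; first exact: H.
  by rewrite distrC (distrC u); exact: H.
move=> uB vB.
rewrite distrC (distrC u) ger0_norm ?subr_ge0 ?ppow_le// (@ger0_norm _ (v - u)) ?subr_ge0//.
apply: le_trans (@powR_lipschitz p (Num.max u 0) (Num.max v 0) B p1 _ _) _.
- by rewrite le_max lexx orbT /= ge_max !le_max uv lexx orbT.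
- by rewrite ge_max vB.
- rewrite ler_wpM2l ?mulr_ge0 ?powR_ge0//; first exact: le_trans ler01 p1.
  by rewrite /Num.max; case: ltP => ?; case: ltP => ?; lra.
Qed.

Lemma isd_ppow p (f : R -> R) (x df : R) : 0 < f x -> is_derive x 1 f df ->
  is_derive x 1 (fun y => ppow p (f y)) (p * f x `^ (p - 1) * df).
Proof.
move=> f0 hf; apply: (@isd_comp _ f (ppow p)) => //.
apply: near_eq_is_derive (is_derive1_powR p f0).
near=> z; rewrite ppow_pos//; near: z.
by exists (f x) => //= z /=; rewrite ltr_norml => /andP[_]; lra.
Unshelve. all: by end_near. Qed.

Lemma ppow_continuous p : 1 <= p -> continuous (ppow p).
Proof.
move=> p1 x; apply/continuous_at_epsP => e e0.
set B := `|x| + 1; have B0 : 0 <= B by rewrite /B addr_ge0.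
have [d d0 hd] : exists2 d, 0 < d &
    forall y, `|y - x| < d -> `|p * B `^ (p - 1) * (y - x)| < e.
  have : {for x, continuous (fun y => p * B `^ (p - 1) * (y - x))}.
    have [d hd] : exists d, is_derive x 1 (fun y => p * B `^ (p - 1) * (y - x)) d.
      by eexists; derive_rec.
    exact: isd_continuous hd.
  move=> /continuous_at_epsP /(_ e e0)[d d0 hd]; exists d => // y /hd.
  by rewrite subrr mulr0 subr0.
exists (Num.min d 1); first by rewrite lt_min d0 /=.
move=> y; rewrite lt_min => /andP[yd y1].
apply: le_lt_trans (hd y yd).
have xB : x <= B by rewrite /B (le_trans (ler_norm x))// lerDl.
have yB : y <= B.
  have := ler_norm x; move: y1; rewrite /B ltr_norml => /andP[_]; lra.
apply: le_trans (ppow_lipschitz p1 B0 yB xB) _.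
rewrite normrM ger0_norm// mulr_ge0 ?powR_ge0//; exact: le_trans ler01 p1.
Qed.

End PositivePower.

Section Profile.
Context {R : realType}.
Variable p : R.
Hypothesis p1 : 1 <= p.

(* [q (kappa * |x| ^+ 2)] is the radial solution of [- Delta u = kappa * u ^ p] with
   value 1 at the centre. *)
Definition profile (q qd : R -> R) := [/\ q 0 = 1,
  forall t : R, -1 < t -> is_derive t 1 q (qd t),
  forall t : R, -1 < t ->
    is_derive t 1 (fun s => s * qd s) (- (ppow p (q (Num.max t 0)) / 4))
  & continuous qd].

Let p0 : 0 < p. Proof. exact: lt_le_trans ltr01 p1. Qed.

(* Truncation at 1 makes the nonlinearity bounded and globally Lipschitz. *)
Let Fc (u : R) := ppow p (Num.min u 1).

Let Fc_lip u v : `|Fc u - Fc v| <= p * `|u - v|.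
Proof.
apply: le_trans (ppow_lipschitz (B := 1) p1 _ _ _) _; rewrite ?ge_min ?lexx ?orbT//.
rewrite powR1 mulr1 ler_pM2l//.
by rewrite /Num.min; case: ltP => h1; case: ltP => h2; rewrite ler_norml;
  have := ler_norm (u - v); have := ler_norm (v - u); rewrite (distrC v); lra.
Qed.

Let Fc_bound u : `|Fc u| <= 1.
Proof.
rewrite ger0_norm ?ppow_ge0//.
apply: le_trans (ppow_le p1 (v := 1) _) _; first by rewrite ge_min lexx orbT.
by rewrite ppow_pos ?powR1.
Qed.

Let Fc_cont (u : R -> R) : continuous u -> continuous (fun t => Fc (u t)).
Proof.
move=> cu x; apply: (@continuous_comp _ _ _ u Fc); first exact: cu.
exact: (lipschitz_continuous Fc_lip).
Qed.

Lemma max0_lipschitz (x y : R) : `|Num.max x 0 - Num.max y 0| <= `|x - y|.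
Proof.
by rewrite /Num.max; case: ltP => h1; case: ltP => h2; rewrite ler_norml;
  have := ler_norm (x - y); have := ler_norm (y - x); rewrite (distrC y); lra.
Qed.

(** Picard iteration for [q = 1 - w / 4], where [w] is the radial inverse of [Fc q]. Multiplication
    by 1/4 is what is left as contraction ratio in the weighted norm of [radial_inverse_dist] with
    [k = p]. *)
Lemma profile_exists : exists q qd, profile q qd.
Proof.
(* The pair [(G, G)] is a default value for discontinuous [G]; all iterates are continuous. *)
have /choice[S hS] (G : R -> R) : exists wh : (R -> R) * (R -> R),
    continuous G -> radial_inverse G wh.1 wh.2.
  have [cG|ncG] := pselect (continuous G); last by exists (G, G).
  by have [w [h H]] := radial_inverse_exists cG; exists (w, h).
(* Freezing [t] at 0 on the negative half-line makes every [step u] globally Lipschitz, with a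
   constant independent of [u]; the limit inherits it and is therefore continuous. *)
pose step (u : R -> R) (t : R) := 1 - (S (fun s => Fc (u s))).1 (Num.max t 0) / 4.
have step_lip (u : R -> R) : continuous u ->
    forall x y : R, `|step u x - step u y| <= 4^-1 * `|x - y|.
  move=> cu x y; have := hS _ (Fc_cont cu).
  set w := (S _).1; set h := (S _).2 => hw; have [_ dw _ _] := hw.
  rewrite /step -/w.
  have wl (a b : R) : 0 <= a <= b -> `|w b - w a| <= 1 * (b - a).
    move=> /andP[a0 ab]; apply: (@increment_bound _ w h) => //.
    - by move=> z /andP[az _]; apply: dw; lra.
    - by apply: isd_within => z /=; rewrite in_itv /= => /andP[az _]; apply: dw; lra.
    - move=> z /andP[az _]; apply: radial_inverse_mean_bound hw _ _ _; last by lra.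
      by move=> s _; exact: Fc_bound.
  have {}wl (a b : R) : 0 <= a -> 0 <= b -> `|w b - w a| <= `|b - a|.
    move=> a0 b0; have /orP[ab|ab] := le_total a b.
      by rewrite (@ger0_norm _ (b - a)) ?subr_ge0// -[leRHS]mul1r wl// a0.
    rewrite distrC (distrC b) (@ger0_norm _ (a - b)) ?subr_ge0//.
    by rewrite -[leRHS]mul1r wl// b0.
  have -> (A B : R) : 1 - A / 4 - (1 - B / 4) = 4^-1 * (B - A) by field.
  rewrite normrM ger0_norm ?ler_pM2l//; try lra.
  rewrite distrC (distrC x); apply: le_trans (wl _ _ _ _) _.
  - by rewrite le_max lexx orbT.
  - by rewrite le_max lexx orbT.
  - by rewrite (distrC y) max0_lipschitz.
have step_contr (u v : R -> R) (K : R) : continuous u -> continuous v -> 0 <= K ->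
    (forall t : R, 0 <= t -> `|u t - v t| <= K * expR (p * t)) ->
    forall t : R, 0 <= t -> `|step u t - step v t| <= K / 4 * expR (p * t).
  move=> cu cv K0 huv t t0.
  have := radial_inverse_dist (hS _ (Fc_cont cu)) (hS _ (Fc_cont cv)) (k := p)
    (K := p * K) p0 (mulr_ge0 (ltW p0) K0) _ t0.
  rewrite /step max_l// => H.
  have -> (A B : R) : 1 - A / 4 - (1 - B / 4) = 4^-1 * (B - A) by field.
  rewrite normrM ger0_norm; last lra.
  rewrite (mulrC K) -mulrA ler_pM2l; last lra.
  rewrite distrC; apply: le_trans (H _) _; last first.
    by rewrite (mulrC p) mulfK// gt_eqF.
  by move=> s s0; apply: le_trans (Fc_lip _ _) _; rewrite -mulrA ler_pM2l// huv.
pose u n := iter n step (fun=> 1).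
have cu n : continuous (u n).
  elim: n => [|n ih]; first exact: cst_continuous.
  exact: (lipschitz_continuous (step_lip _ ih)).
have u_lip n x y : `|u n x - u n y| <= 4^-1 * `|x - y|.
  case: n => [|n]; last exact: (step_lip _ (cu n)).
  by rewrite /= subrr normr0 mulr_ge0.
(* The ratio 1/4 is weakened to 1/2, so that the bound is exactly [r n - r n.+1] for
   [r n = expR (p * t) * 2^-1 ^+ n], the form which [monotone_sandwich_limit] asks for. *)
have du n (t : R) : 0 <= t -> `|u n.+1 t - u n t| <= 2^-1 ^+ n.+1 * expR (p * t).
  elim: n t => [|n ih] t t0.
    have e0 : step (u 0%N) 0 = 1.
      have [h _ _ _] := hS _ (Fc_cont (cu 0%N)).
      by rewrite /step maxxx h mul0r subr0.
    have := step_lip _ (cu 0%N) t 0; rewrite e0 subr0.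
    rewrite -[step _ t]/(u 1%N t) -[in `|_ - 1|]/(u 0%N t).
    move=> /le_trans; apply; rewrite expr1 ger0_norm//.
    have := expR_ge1Dx (p * t).
    have : t <= p * t by rewrite -[leLHS]mul1r ler_wpM2r.
    lra.
  have := step_contr _ _ (2^-1 ^+ n.+1) (cu n.+1) (cu n) _ ih t t0.
  rewrite exprn_ge0 ?invr_ge0// => /(_ isT) /le_trans; apply.
  rewrite ler_wpM2r ?expR_ge0// [leRHS]exprS mulrC ler_wpM2r ?exprn_ge0 ?invr_ge0//; lra.
have /choice[v hv] (t : R) : exists l,
    0 <= t -> forall n, `|l - u n t| <= expR (p * t) * 2^-1 ^+ n.
  have [t0|/negP t0] := boolP (0 <= t); last by exists 0.
  have [||l hl] := @monotone_sandwich_limit _ (fun n => u n t) (fun n => expR (p * t) * 2^-1 ^+ n).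
  - by move=> n; rewrite mulr_ge0 ?expR_ge0// exprn_ge0// invr_ge0.
  - move=> n; apply: le_trans (du n t t0) _; rewrite exprS.
    by rewrite le_eqVlt; apply/orP; left; apply/eqP; field.
  - by exists l.
pose U t := v (Num.max t 0).
have max0 (t : R) : 0 <= Num.max t 0 by rewrite le_max lexx orbT.
have U_lip x y : `|U x - U y| <= 4^-1 * `|x - y|.
  apply: (@le_of_geometric _ _ _ (expR (p * Num.max x 0) + expR (p * Num.max y 0))) => n.
  have := hv _ (max0 x) n; have := hv _ (max0 y) n.
  have := le_trans (u_lip n (Num.max x 0) (Num.max y 0))
    (ler_wpM2l _ (max0_lipschitz x y)).
  rewrite invr_ge0 ler0n => /(_ isT); rewrite -/(U x) -/(U y) mulrDl.
  by rewrite !ler_norml => /andP[? ?] /andP[? ?] /andP[? ?]; apply/andP; split; lra.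
have cU : continuous U := lipschitz_continuous U_lip.
have stepU (t : R) : 0 <= t -> step U t = U t.
  move=> t0; apply/eqP; rewrite -subr_eq0 -normr_le0.
  apply: (@le_of_geometric _ _ _ (expR (p * t))) => n; rewrite add0r.
  have h1 : `|step U t - u n.+1 t| <= 2^-1 ^+ n / 4 * expR (p * t).
    apply: (step_contr _ _ _ cU (cu n)) => //.
    by move=> s s0; rewrite /U max_l// mulrC hv.
  have h2 := hv t t0 n.+1; rewrite exprS in h2.
  rewrite /U max_l//.
  move: h1 h2; rewrite !ler_norml => /andP[? ?] /andP[? ?].
  have : 0 <= expR (p * t) * 2^-1 ^+ n by rewrite mulr_ge0 ?expR_ge0 ?exprn_ge0 ?invr_ge0.
  by move=> ?; apply/andP; split; lra.
have hw := hS _ (Fc_cont cU); set w := (S _).1 in hw; set h := (S _).2 in hw.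
have [w0 dw dh ch] := hw.
pose q t := 1 - w t / 4; pose qd t := - (h t / 4).
have dq (t : R) : -1 < t -> is_derive t 1 q (qd t).
  by move=> t1; have := dw t t1 => ?; rewrite /q /qd; derive_tac; field.
have qU (t : R) : 0 <= t -> q t = U t.
  by move=> t0; rewrite -stepU// /step max_l.
have q1 (t : R) : 0 <= t -> q t <= 1.
  move=> t0; have <- : q 0 = 1 by rewrite /q w0 mul0r subr0.
  rewrite -lerN2.
  apply: (@deriv_ge0_le _ (fun t => - q t) (fun t => - qd t)); first exact: t0.
  - by move=> x /andP[x0 _]; have := dq x; move=> H; apply: isd_opp; apply: H; lra.
  - apply: (@isd_within _ _ _ (fun t => - qd t)) => x /=; rewrite in_itv /= => /andP[x0 _].
    by apply: isd_opp; apply: dq; lra.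
  - move=> x /andP[x0 _]; rewrite /qd opprK divr_ge0//.
    have : 0 * h 0 <= x * h x.
      apply: (@deriv_ge0_le _ (fun s => s * h s) (fun s => Fc (U (Num.max s 0)))) => //.
      + exact: ltW.
      + by move=> y /andP[y0 _]; apply: dh; lra.
      + by apply: isd_within => y /=; rewrite in_itv /= => /andP[y0 _]; apply: dh; lra.
      + by move=> y _; exact: ppow_ge0.
    by rewrite mul0r pmulr_rge0.
exists q, qd; split => //.
- by rewrite /q w0 mul0r subr0.
- move=> t t1; have := dh t t1 => ?.
  have -> : (fun s => s * qd s) = (fun s => - (s * h s) / 4).
    by apply/funext => s; rewrite /qd; field.
  derive_tac.
  rewrite qU ?max0//; rewrite /Fc (_ : Num.min (U (Num.max t 0)) 1 = U (Num.max t 0)).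
    by field.
  by rewrite min_l// -qU ?max0// q1 ?max0.
- by move=> t; apply: cvgN; apply: cvgM; [exact: ch|exact: cvg_cst].
Qed.

End Profile.

(** * Regularity and first zero of the profile *)

Section ProfileProperties.
Context {R : realType}.
Variables (p : R) (q qd : R -> R).
Hypotheses (p1 : 1 <= p) (hq : profile p q qd).

Let Q (t : R) := ppow p (q t).
Let N (t : R) := - 4 * (t * qd t).
(** This is [t q''], expressed through the equation so that it has a meaning at 0. *)
Let k (t : R) := - (Q t / 4) - qd t.

Let p0 : 0 < p. Proof. exact: lt_le_trans ltr01 p1. Qed.

Lemma profile0 : q 0 = 1. Proof. by case: hq. Qed.

Lemma profile_derive (t : R) : 0 <= t -> is_derive t 1 q (qd t).
Proof. by case: hq => _ h _ _ t0; apply: h; lra. Qed.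

Lemma profile_flux_derive (t : R) : 0 <= t ->
  is_derive t 1 (fun s => s * qd s) (- (Q t / 4)).
Proof. by case: hq => _ _ h _ t0; have := h t; rewrite max_l// => H; apply: H; lra. Qed.

Lemma profile_mass_derive (t : R) : 0 <= t ->
  is_derive t 1 (fun s => - 4 * (s * qd s)) (Q t).
Proof.
move=> t0; have h := profile_flux_derive t0.
by notypeclasses refine (isd_eq (isd_mul (isd_cst (- 4) _ _) h) _); field.
Qed.

Lemma profile_within (a b : R) : 0 <= a -> {within `[a, b], continuous q}.
Proof.
move=> a0; apply: isd_within => x /=; rewrite in_itv /= => /andP[ax _].
by apply: profile_derive; lra.
Qed.

Lemma profile_mass_within (a b : R) : 0 <= a -> {within `[a, b], continuous N}.
Proof.
move=> a0; have h (x : R) : `[a, b]%classic x -> is_derive x 1 N (Q x).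
  by rewrite /= in_itv /= => /andP[ax _]; apply: profile_mass_derive; exact: le_trans ax.
exact: isd_within h.
Qed.

Lemma profile_mass_le (s t : R) : 0 <= s -> s <= t -> N s <= N t.
Proof.
move=> s0 st; have h (x : R) : s < x < t -> is_derive x 1 N (Q x).
  by move=> /andP[sx _]; apply: profile_mass_derive; exact: le_trans (ltW sx).
by apply: (@deriv_ge0_le _ N Q _ _ st h (profile_mass_within s0)) => x _; exact: ppow_ge0.
Qed.

Let N0 : N 0 = 0. Proof. by rewrite /N mul0r mulr0. Qed.

Let N_ge0 (t : R) : 0 <= t -> 0 <= N t.
Proof. by move=> t0; rewrite -N0; exact: profile_mass_le. Qed.

Let qd_le0_pos (t : R) : 0 < t -> qd t <= 0.
Proof.
move=> t0; have := N_ge0 (ltW t0); rewrite /N.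
by rewrite (_ : - 4 * _ = - 4 * qd t * t); [rewrite pmulr_lge0//; lra|ring].
Qed.

Lemma profile_le1 (t : R) : 0 <= t -> q t <= 1.
Proof.
move=> t0; rewrite -profile0 -lerN2.
apply: (@deriv_ge0_le _ (fun t => - q t) (fun t => - qd t)) => //.
- by move=> x /andP[x0 _]; apply: isd_opp; apply: profile_derive; lra.
- apply: (@isd_within _ _ _ (fun t => - qd t)) => x /=; rewrite in_itv /= => /andP[x0 _].
  by apply: isd_opp; exact: profile_derive.
- by move=> x /andP[x0 _]; rewrite oppr_ge0 qd_le0_pos.
Qed.

Let Q_le1 (t : R) : 0 <= t -> Q t <= 1.
Proof.
move=> t0; apply: le_trans (ppow_le p1 (profile_le1 t0)) _.
by rewrite ppow_pos// powR1.
Qed.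

Let qd_lb (t : R) : 0 < t -> `|qd t| <= 4^-1.
Proof.
move=> t0.
have h (x : R) : 0 < x < t -> is_derive x 1 N (Q x).
  by move=> /andP[x0 _]; apply: profile_mass_derive; exact: ltW.
have : `|N t - N 0| <= 1 * (t - 0).
  apply: (@increment_bound _ N Q _ _ _ (ltW t0) h (profile_mass_within (lexx 0))).
  by move=> x /andP[/ltW x0 _]; rewrite ger0_norm ?ppow_ge0// Q_le1.
rewrite N0 !subr0 mul1r /N normrM normrM (gtr0_norm t0) normrN (@ger0_norm _ 4)// mulrCA.
rewrite mulrC -ler_pdivlMr// mulfV ?gt_eqF//; lra.
Qed.

Let q_lip (s t : R) : 0 <= s -> s <= t -> `|q t - q s| <= 4^-1 * (t - s).
Proof.
move=> s0 st; apply: (@increment_bound _ q qd) => //.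
- by move=> x /andP[sx _]; apply: profile_derive; lra.
- exact: profile_within.
- by move=> x /andP[sx _]; apply: qd_lb; lra.
Qed.

Let Q_lip (s t : R) : 0 <= s -> s <= t -> `|Q t - Q s| <= p / 4 * (t - s).
Proof.
move=> s0 st; have t0 := le_trans s0 st.
apply: le_trans (ppow_lipschitz p1 ler01 (profile_le1 t0) (profile_le1 s0)) _.
rewrite powR1 mulr1 -mulrA ler_pM2l//; exact: q_lip.
Qed.

Lemma profile_mass_gt0 (t : R) : 0 < t -> 0 < N t.
Proof.
have h (s : R) : 0 < s <= 1 -> 0 < N s.
  move=> /andP[s0 s1]; have h (x : R) : 0 < x < s -> is_derive x 1 N (Q x).
    by move=> /andP[x0 _]; apply: profile_mass_derive; exact: ltW.
  rewrite -N0; apply: (@deriv_gt0_lt _ N Q _ _ s0 h (profile_mass_within (lexx 0))).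
  move=> x /andP[x0 xs]; apply: ppow_gt0.
  have := q_lip (lexx 0) (ltW x0); rewrite profile0 ler_norml => /andP[]; lra.
move=> t0; have [t1|t1] := lerP t 1; first by rewrite h ?t0.
by apply: lt_le_trans (h 1 _) (profile_mass_le _ (ltW t1)); rewrite ?ltr01 ?lexx.
Qed.

(** The quantity [4 t k t = N t - t Q t] is the integral of [Q s - Q t] over [[0, t]], of order
    [t^2] because [Q] is Lipschitz. Hence [q'' = k / t] stays bounded near 0. *)
Let k_bound (t : R) : 0 < t -> `|k t| <= p / 16 * t.
Proof.
move=> t0.
have hb : `|(N t - Q t * t) - (N 0 - Q t * 0)| <= p / 4 * t * (t - 0).
  apply: (@increment_bound _ (fun s => N s - Q t * s) (fun s => Q s - Q t)).
  - exact: ltW.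
  - by move=> x /andP[x0 _]; have h := profile_mass_derive (ltW x0); derive_tac; ring.
  - apply: (@isd_within _ _ _ (fun s => Q s - Q t)) => x /=; rewrite in_itv /= => /andP[x0 _].
    by have h := profile_mass_derive x0; derive_tac; ring.
  - move=> x /andP[x0 xt]; rewrite distrC; apply: le_trans (Q_lip (ltW x0) (ltW xt)) _.
    by rewrite ler_pM2l ?divr_gt0//; lra.
rewrite N0 mulr0 !subr0 in hb.
have e : N t - Q t * t = 4 * t * k t by rewrite /N /k; field.
rewrite e normrM gtr0_norm ?mulr_gt0// in hb.
have -> : p / 16 * t = (p / 4 * t * t) / (4 * t) by field; rewrite gt_eqF.
by rewrite ler_pdivlMr ?mulr_gt0// mulrC.
Qed.

(** This is the limit of [k_bound] at 0, by continuity of [qd] and [Q]; with [q 0 = 1] it fixes the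
    initial slope. *)
Lemma profile_second_at0 : k 0 = 0.
Proof.
have [_ _ _ cqd] := hq.
apply/eqP; rewrite -normr_le0; apply/ler_addgt0Pr => e e0; rewrite add0r.
have /continuous_at_epsP/(_ (e / 4)) := cqd 0.
rewrite divr_gt0// => /(_ isT)[d d0 hd].
pose t := Num.min (d / 2) (e / (p + 1)).
have pp : 0 < p + 1 by rewrite addr_gt0.
have t0 : 0 < t by rewrite lt_min !divr_gt0.
have td : t <= d / 2 by rewrite ge_min lexx.
have te : t * (p + 1) <= e by rewrite -ler_pdivlMr// ge_min lexx orbT.
have h1 : `|qd t - qd 0| < e / 4.
  by apply: hd; rewrite subr0 gtr0_norm//; lra.
have h2 := k_bound t0; have h3 := Q_lip (lexx 0) (ltW t0).
have h4 : p * t <= e by move: te; rewrite mulrDr mulr1 [t * p]mulrC; lra.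
move: h1 h2 h3; rewrite ltr_norml !ler_norml /k subr0 => /andP[? ?] /andP[? ?] /andP[? ?].
by apply/andP; split; lra.
Qed.

Lemma profile_slope0 : qd 0 = - 4^-1.
Proof.
have := profile_second_at0; rewrite /k /Q profile0 ppow_pos// powR1; lra.
Qed.

Lemma profile_slope_lt0 (t : R) : 0 <= t -> qd t < 0.
Proof.
rewrite le_eqVlt => /orP[/eqP<-|t0]; first by rewrite profile_slope0; lra.
have := profile_mass_gt0 t0; rewrite /N.
by rewrite (_ : - 4 * _ = - 4 * qd t * t); [rewrite pmulr_lgt0//; lra|ring].
Qed.

Lemma profile_slope_ge (t : R) : 0 <= t -> - 4^-1 <= qd t.
Proof.
rewrite le_eqVlt => /orP[/eqP<-|/qd_lb]; first by rewrite profile_slope0; lra.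
by rewrite ler_norml => /andP[].
Qed.

Lemma profile_decr (s t : R) : 0 <= s -> s < t -> q t < q s.
Proof.
move=> s0 st; rewrite -ltrN2.
apply: (@deriv_gt0_lt _ (fun t => - q t) (fun t => - qd t)) => //.
- by move=> x /andP[sx _]; apply: isd_opp; apply: profile_derive; lra.
- apply: (@isd_within _ _ _ (fun t => - qd t)) => x /=; rewrite in_itv /= => /andP[x0 _].
  by apply: isd_opp; apply: profile_derive; lra.
- by move=> x /andP[x0 _]; rewrite oppr_gt0 profile_slope_lt0//; lra.
Qed.

(** The flux [N] increases, so [q' <= - c / t] for [t >= 1] with [c = N 1 / 4], and [q + c ln t] is
    nonincreasing there. At [T = exp (1 / c)] this gives [q T <= q 1 - 1 <= 0]. The divergence of
    the logarithm, peculiar to dimension two, produces a zero for every [p]. *)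
Lemma profile_zero : exists2 T : R, 0 < T & q T = 0.
Proof.
pose c := N 1 / 4.
have c0 : 0 < c by rewrite divr_gt0// profile_mass_gt0.
pose T := expR c^-1.
have T1 : 1 < T by rewrite expR_gt1 invr_gt0.
have qT : q T <= 0.
  have : - (q 1 + c * ln 1) <= - (q T + c * ln T).
    apply: (@deriv_ge0_le _ (fun t => - (q t + c * ln t)) (fun t => - (qd t + c * t^-1))).
    - exact: ltW.
    - move=> x /andP[x1 _]; have x0 : 0 < x by lra.
      have h1 := profile_derive (ltW x0).
      have h2 : is_derive x 1 (@ln R) x^-1 := is_derive1_ln x0.
      by derive_tac; ring.
    - apply: (@isd_within _ _ _ (fun t => - (qd t + c * t^-1))) => x /=.
      rewrite in_itv /= => /andP[x1 _]; have x0 : 0 < x by lra.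
      have h1 := profile_derive (ltW x0).
      have h2 : is_derive x 1 (@ln R) x^-1 := is_derive1_ln x0.
      by derive_tac; ring.
    - move=> x /andP[x1 _]; have x0 : 0 < x by lra.
      have := profile_mass_le ler01 (ltW x1); rewrite -/(N 1) /c => h.
      have -> : - (qd x + N 1 / 4 / x) = (N x - N 1) / (4 * x).
        have -> : N x = - 4 * (x * qd x) by [].
        by field; rewrite gt_eqF.
      by rewrite divr_ge0 ?subr_ge0// mulr_ge0// ltW.
  rewrite ln1 mulr0 addr0 /T expRK mulfV ?gt_eqF// -/T.
  by have := profile_le1 ler01; lra.
have [t] : exists2 t, t \in `[0, T] & q t = 0.
  apply: IVT; first by rewrite ltW// (lt_trans ltr01).
    exact: profile_within.
  by rewrite profile0 min_r ?max_l ?qT ?ler01// (le_trans qT).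
rewrite in_itv /= => /andP[t0 _] qt; exists t => //.
rewrite lt_neqAle t0 andbT; apply/eqP => e0; move: qt.
by rewrite -e0 profile0 => /eqP; rewrite oner_eq0.
Qed.

Lemma profile_slope_derive (t : R) : 0 < t -> is_derive t 1 qd (k t / t).
Proof.
move=> t0.
have h := profile_flux_derive (ltW t0).
have hd : is_derive t 1 (fun s => (s * qd s) / s) (k t / t).
  derive_tac; first by rewrite gt_eqF.
  by rewrite /k; field; rewrite gt_eqF.
apply: near_eq_is_derive hd; near=> s.
rewrite mulrAC mulfV ?mul1r// gt_eqF//; near: s.
by exists t => //= z /=; rewrite ltr_norml => /andP[_]; lra.
Unshelve. all: by end_near. Qed.

Lemma profile_slope_lipschitz (s t : R) : 0 <= s -> 0 <= t ->
  `|qd t - qd s| <= p / 16 * `|t - s|.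
Proof.
have [_ _ _ cqd] := hq.
wlog st : s t / s <= t => [H s0 t0|].
  have /orP[st|ts] := le_total s t; first exact: H.
  by rewrite distrC (distrC t); exact: H.
move=> s0 t0; rewrite (@ger0_norm _ (t - s)) ?subr_ge0//.
apply: (@increment_bound _ qd (fun t => k t / t)) => //.
- by move=> x /andP[sx _]; apply: profile_slope_derive; lra.
- exact: continuous_subspaceT.
- move=> x /andP[sx _]; have x0 : 0 < x by lra.
  by rewrite normrM normfV (gtr0_norm x0) ler_pdivrMr// k_bound.
Qed.

Lemma profile_second_lipschitz (s t : R) : 0 <= s -> 0 <= t ->
  `|k t - k s| <= p / 8 * `|t - s|.
Proof.
wlog st : s t / s <= t => [H s0 t0|].
  have /orP[st|ts] := le_total s t; first exact: H.
  by rewrite distrC (distrC t); exact: H.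
move=> s0 t0; have := profile_slope_lipschitz s0 t0; have := Q_lip s0 st.
rewrite (@ger0_norm _ (t - s)) ?subr_ge0// /k !ler_norml.
by move=> /andP[? ?] /andP[? ?]; apply/andP; split; lra.
Qed.

End ProfileProperties.

(** * Monotone quantities along the profile *)

Section ProfileMonotonicity.
Context {R : realType}.
Variables (p T : R) (q qd : R -> R).
Hypotheses (p1 : 1 <= p) (hq : profile p q qd) (T0 : 0 < T) (qT : q T = 0).

Let Q (t : R) := ppow p (q t).
Let N (t : R) := - 4 * (t * qd t).

Let p0 : 0 < p. Proof. exact: lt_le_trans ltr01 p1. Qed.

Lemma profile_gt0 (t : R) : 0 <= t < T -> 0 < q t.
Proof. by move=> /andP[t0 tT]; rewrite -qT (profile_decr p1 hq). Qed.

Lemma profile_power_derive (t : R) : 0 <= t < T ->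
  is_derive t 1 (fun s => ppow p (q s)) (p * Q t / q t * qd t).
Proof.
move=> tT; have q0 := profile_gt0 tT; move: tT => /andP[t0 tT].
have h := profile_derive hq t0.
notypeclasses refine (isd_eq (isd_ppow p q0 h) _).
by rewrite /Q ppow_pos ?ltW// -(@mulr_powRB1 _ (q t) p) ?ltW//; field; rewrite gt_eqF.
Qed.

(* The inequality behind the monotonicity of both [alpha] and the energy. *)
Lemma profile_defect_gt0 (t : R) : 0 < t < T ->
  0 < t * Q t - N t + p * N t ^+ 2 / (4 * q t).
Proof.
move=> /andP[t0 tT].
pose Z (t : R) := t * Q t - N t + p * N t ^+ 2 / (4 * q t).
pose dZ (t : R) := p * Q t * N t / (4 * q t) - p * N t ^+ 2 * qd t / (4 * q t ^+ 2).
have dZP (s : R) : 0 <= s < T -> is_derive s 1 Z (dZ s).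
  move=> sT; have q0 := profile_gt0 sT.
  have h1 := profile_power_derive sT; move: sT => /andP[s0 _].
  have h2 := profile_derive hq s0; have h3 := profile_mass_derive hq s0.
  rewrite /Z; derive_tac; first by rewrite mulf_neq0// gt_eqF.
  by rewrite /dZ /N /Q; field; rewrite gt_eqF.
suff : Z 0 < Z t.
  have -> // : Z 0 = 0.
  by rewrite /Z /N !mul0r !mulr0 expr0n /= mulr0 mul0r subrr addr0.
apply: (@deriv_gt0_lt _ Z dZ) => //.
- by move=> x /andP[x0 xt]; apply: dZP; lra.
- by apply: isd_within => x /=; rewrite in_itv /= => /andP[x0 xt]; apply: dZP; lra.
- move=> x /andP[x0 xt]; have xT : 0 <= x < T by lra.
  have qx := profile_gt0 xT.
  have Qx : 0 < Q x := ppow_gt0 p qx.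
  have Nx : 0 < N x := profile_mass_gt0 p1 hq x0.
  have hx : 0 < - qd x by rewrite oppr_gt0 (profile_slope_lt0 p1 hq)// ltW.
  have four : 0 < 4 :> R by [].
  apply: addr_gt0.
    exact: divr_gt0 (mulr_gt0 (mulr_gt0 p0 Qx) Nx) (mulr_gt0 four qx).
  rewrite -mulNr -mulrN; apply: divr_gt0.
    exact: mulr_gt0 (mulr_gt0 p0 (exprn_gt0 2 Nx)) hx.
  exact: mulr_gt0 four (exprn_gt0 2 qx).
Qed.

(** The ratio is [alpha^p] as a function of the parameter. By [t q' = - N / 4] its derivative is
    [- Q / N^2] times the positive quantity of [profile_defect_gt0]. *)
Lemma profile_ratio_decr (s t : R) : 0 < s -> s < t -> t < T ->
  t * Q t / N t < s * Q s / N s.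
Proof.
move=> s0 st tT.
pose r (t : R) := - (t * Q t / N t).
pose dr (t : R) := Q t / N t ^+ 2 * (t * Q t - N t + p * N t ^+ 2 / (4 * q t)).
suff : r s < r t by rewrite /r ltrN2.
have drP (x : R) : 0 < x < T -> is_derive x 1 r (dr x).
  move=> /andP[x0 xT]; have xT' : 0 <= x < T by lra.
  have qx := profile_gt0 xT'.
  have h1 := profile_power_derive xT'.
  have h2 := profile_derive hq (ltW x0); have h3 := profile_mass_derive hq (ltW x0).
  have nz : N x != 0 by rewrite gt_eqF// (profile_mass_gt0 p1 hq x0).
  have qz : qd x != 0 by rewrite lt_eqF// (profile_slope_lt0 p1 hq (ltW x0)).
  rewrite /r; derive_tac; first exact: nz.
  rewrite /dr /N /Q; field.
  by rewrite qz !gt_eqF.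
apply: (@deriv_gt0_lt _ r dr) => //.
- by move=> x /andP[sx xt]; apply: drP; lra.
- by apply: isd_within => x /=; rewrite in_itv /= => /andP[sx xt]; apply: drP; lra.
- move=> x /andP[sx xt]; have xT : 0 < x < T by lra.
  apply: mulr_gt0; last exact: profile_defect_gt0.
  rewrite divr_gt0 ?exprn_gt0//; last by apply: (profile_mass_gt0 p1 hq); lra.
  by apply: ppow_gt0; apply: profile_gt0; lra.
Qed.

(* A primitive of [N ^+ 2 / t], found with the Pohozaev multiplier. *)
Let J (t : R) := 4 * (t * q t * Q t) + (p + 1) / 2 * N t ^+ 2 - 4 * (N t * q t).

Let dJ (t : R) : 0 <= t < T -> is_derive t 1 J (- 4 * (N t * qd t)).
Proof.
move=> tT; have q0 := profile_gt0 tT.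
have h1 := profile_power_derive tT; move: tT => /andP[t0 _].
have h2 := profile_derive hq t0; have h3 := profile_mass_derive hq t0.
rewrite /J; derive_tac; rewrite /N /Q; field.
by rewrite gt_eqF.
Qed.

(** Divided by [4 t N^3], this expression is the derivative of [- q (N - t Q) / N^2], the part of
    the energy that varies with [t]. *)
Lemma profile_pohozaev_gt0 (t : R) : 0 < t < T ->
  0 < N t ^+ 3 - (p + 1) * t * Q t * N t ^+ 2 + 8 * t * q t * Q t * (N t - t * Q t).
Proof.
move=> /andP[t0 tT].
(* This is [N^3 / (2 t Q) - J]. Writing [- 4 qd] for [N / t] keeps it continuous at 0, where it
   vanishes. *)
pose D (t : R) := - 2 * (qd t * N t ^+ 2 / Q t) - J t.
pose dD (t : R) := N t ^+ 2 / (2 * t ^+ 2 * Q t)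
  * (t * Q t - N t + p * N t ^+ 2 / (4 * q t)).
have Q0 (x : R) : 0 <= x < T -> 0 < Q x.
  by move=> xT; apply: ppow_gt0; exact: profile_gt0.
have [_ _ _ cqd] := hq.
have DP : 0 < D t.
  have <- : D 0 = 0.
    rewrite /D (_ : J 0 = 0) ?subr0 /N ?mul0r ?mulr0 ?expr0n /= ?mulr0 ?mul0r ?mulr0 //.
    by rewrite /J /N; ring.
  apply: (@deriv_gt0_lt _ D dD); first exact: t0.
  - move=> x /andP[x0 xt]; have xT' : 0 <= x < T by lra.
    have qx := profile_gt0 xT'; have Qx := Q0 _ xT'.
    have h1 := profile_power_derive xT'; have h5 := dJ xT'.
    have h2 := profile_derive hq (ltW x0); have h3 := profile_mass_derive hq (ltW x0).
    have h4 := profile_slope_derive hq x0.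
    rewrite /D; derive_tac; first by rewrite gt_eqF.
    rewrite /dD /N -/(Q x); field.
    by rewrite !gt_eqF.
  - apply: continuous_in_subspaceT => x; rewrite inE /= in_itv /= => /andP[x0 xt].
    have xT' : 0 <= x < T by lra.
    apply: cvgB; last exact: (isd_continuous (dJ xT')).
    apply: cvgM; first exact: cvg_cst.
    apply: cvgM; last first.
      apply: cvgV; first by rewrite gt_eqF// Q0.
      exact: (isd_continuous (profile_power_derive xT')).
    apply: cvgM; first exact: cqd.
    by apply: cvgM; exact: (isd_continuous (profile_mass_derive hq x0)).
  - move=> x /andP[x0 xt]; have xT' : 0 < x < T by lra.
    apply: mulr_gt0; last exact: profile_defect_gt0.
    rewrite divr_gt0 ?exprn_gt0//; first exact: (profile_mass_gt0 p1 hq x0).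
    by rewrite !mulr_gt0 ?exprn_gt0// Q0//; lra.
have tT' : 0 <= t < T by lra.
have Qt := Q0 _ tT'.
have -> : N t ^+ 3 - (p + 1) * t * Q t * N t ^+ 2 + 8 * t * q t * Q t * (N t - t * Q t)
    = 2 * t * Q t * D t.
  by rewrite /D /J /N; field; rewrite gt_eqF.
by rewrite !mulr_gt0.
Qed.

(** Divided by [2 pi], this is by [psiT_energy] what the energy lacks to reach
    [(p + 1) / (16 pi)]. *)
Lemma profile_energy_decr (s t : R) : 0 < s -> s < t -> t < T ->
  q t * (N t - t * Q t) / N t ^+ 2 < q s * (N s - s * Q s) / N s ^+ 2.
Proof.
move=> s0 st tT.
pose H (t : R) := - (q t * (N t - t * Q t) / N t ^+ 2).
pose dH (t : R) := (N t ^+ 3 - (p + 1) * t * Q t * N t ^+ 2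
   + 8 * t * q t * Q t * (N t - t * Q t)) / (4 * t * N t ^+ 3).
suff : H s < H t by rewrite /H ltrN2.
have dHP (x : R) : 0 < x < T -> is_derive x 1 H (dH x).
  move=> /andP[x0 xT]; have xT' : 0 <= x < T by lra.
  have qx := profile_gt0 xT'.
  have h1 := profile_power_derive xT'.
  have h2 := profile_derive hq (ltW x0); have h3 := profile_mass_derive hq (ltW x0).
  have nz : N x != 0 by rewrite gt_eqF// (profile_mass_gt0 p1 hq x0).
  have qz : qd x != 0 by rewrite lt_eqF// (profile_slope_lt0 p1 hq (ltW x0)).
  rewrite /H; derive_tac; first by rewrite expf_neq0.
  rewrite /dH /N /Q; field.
  by rewrite qz !gt_eqF.
apply: (@deriv_gt0_lt _ H dH) => //.
- by move=> x /andP[sx xt]; apply: dHP; lra.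
- by apply: isd_within => x /=; rewrite in_itv /= => /andP[sx xt]; apply: dHP; lra.
- move=> x /andP[sx xt]; have xT : 0 < x < T by lra.
  apply: divr_gt0; first exact: profile_pohozaev_gt0.
  have x0 : 0 < x by lra.
  have four : 0 < 4 :> R by [].
  exact: mulr_gt0 (mulr_gt0 four x0) (exprn_gt0 3 (profile_mass_gt0 p1 hq x0)).
Qed.

End ProfileMonotonicity.

(** * Integration over the disk *)

Section RadialIntegral.
Context {R : realType}.

Definition sqn (x : R * R) : R := x.1 ^+ 2 + x.2 ^+ 2.

Definition sqball (t : R) : set (R * R) := [set x | sqn x < t].

Lemma sqn_ge0 (x : R * R) : 0 <= sqn x.
Proof. by rewrite addr_ge0 ?sqr_ge0. Qed.

(** At the two ends the derivative of [asin] is infinite; continuity there is that of the inverse of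
    a continuous function on a segment. *)
Lemma asin_scaled_within (s : R) : 0 < s ->
  {within `[(- s)%R, s], continuous (fun x : R => asin (x / s))}.
Proof.
move=> s0.
have pi2 : - (pi / 2) <= pi / 2 :> R.
  by rewrite -subr_ge0 opprK addr_ge0// divr_ge0// pi_ge0.
have := @segment_can_le_continuous R (- (pi / 2)) (pi / 2) (fun y => s * sin y)
  (fun x : R => asin (x / s)) pi2 _ _.
rewrite sinN sin_pihalf mulr1 mulrN1; apply.
  by apply: continuous_subspaceT => x; apply: cvgM; [exact: cvg_cst|exact: continuous_sin].
by move=> x xpi; rewrite mulrAC mulfV ?gt_eqF// mul1r sinK.
Qed.

Lemma asin1_pihalf : asin (1 : R) = pi / 2 /\ asin (-1 : R) = - (pi / 2).
Proof.
have pi0 : 0 <= pi / 2 :> R by rewrite divr_ge0// pi_ge0.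
have h1 : pi / 2 \in `[- (pi / 2) : R, pi / 2] by rewrite in_itv /= lexx andbT; lra.
have h2 : - (pi / 2) \in `[- (pi / 2) : R, pi / 2] by rewrite in_itv /= lexx /=; lra.
by have := sinK h1; have := sinK h2; rewrite sinN sin_pihalf.
Qed.

Lemma integral_semicircle (s : R) : 0 < s ->
  (\int[@lebesgue_measure R]_(x in `[(- s)%R, s]) (2 * Num.sqrt (s ^+ 2 - x ^+ 2))%:E
   = (pi * s ^+ 2)%:E)%E.
Proof.
move=> s0.
pose F (x : R) := x * Num.sqrt (s ^+ 2 - x ^+ 2) + s ^+ 2 * asin (x / s).
have cs : continuous (fun x : R => Num.sqrt (s ^+ 2 - x ^+ 2)).
  move=> x; apply: (@continuous_comp _ _ _ (fun x : R => s ^+ 2 - x ^+ 2) Num.sqrt).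
    have [d hd] : exists d, is_derive x 1 (fun x : R => s ^+ 2 - x ^+ 2) d.
      by eexists; derive_rec.
    exact: isd_continuous hd.
  exact: sqrt_continuous.
have dF (x : R) : -s < x < s -> is_derive x 1 F (2 * Num.sqrt (s ^+ 2 - x ^+ 2)).
  move=> /andP[sx xs].
  have h0 : 0 < s ^+ 2 - x ^+ 2 by rewrite subr_sqr mulr_gt0//; lra.
  have h1 : is_derive x 1 (fun x : R => Num.sqrt (s ^+ 2 - x ^+ 2))
      ((2 * Num.sqrt (s ^+ 2 - x ^+ 2))^-1 * (- (2 * x))).
    apply: (@isd_comp _ (fun x : R => s ^+ 2 - x ^+ 2) Num.sqrt).
      by derive_tac; ring.
    exact: is_derive1_sqrt.
  have h2 : is_derive x 1 (fun x : R => asin (x / s))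
      ((Num.sqrt (1 - (x / s) ^+ 2))^-1 * s^-1).
    apply: (@isd_comp _ (fun x : R => x / s) asin).
      by derive_tac; ring.
    apply: is_derive1_asin; rewrite ltr_pdivlMr// ltr_pdivrMr//.
    by rewrite mul1r mulN1r sx.
  rewrite /F; derive_tac.
  have -> : Num.sqrt (1 - (x / s) ^+ 2) = Num.sqrt (s ^+ 2 - x ^+ 2) / s.
    have -> : 1 - (x / s) ^+ 2 = (s ^+ 2 - x ^+ 2) * (s^-1) ^+ 2 by field; rewrite gt_eqF.
    by rewrite sqrtrM ?ltW// sqrtr_sqr ger0_norm// invr_ge0 ltW.
  have hq := sqr_sqrtr (ltW h0).
  have q0 : 0 < Num.sqrt (s ^+ 2 - x ^+ 2) by rewrite sqrtr_gt0.
  set w := Num.sqrt _ in hq q0 *.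
  rewrite (_ : x * _ + _ + _ = (w ^+ 2 + (s ^+ 2 - x ^+ 2)) / w); last by field; rewrite !gt_eqF.
  by rewrite -hq; field; rewrite gt_eqF.
have ss : - s < s by lra.
rewrite (@continuous_FTC2 _ _ F)//.
- rewrite -EFinB; congr (_%:E); rewrite /F sqrrN subrr sqrtr0 !mulr0 !add0r mulfV ?gt_eqF//.
  by have [-> e] := asin1_pihalf; rewrite mulNr mulfV ?gt_eqF// e; field.
- apply: continuous_subspaceT => x; apply: cvgM; [exact: cvg_cst|exact: cs].
- have /(continuous_within_itvP _ ss)[_ ca cb] : {within `[(- s)%R, s], continuous F}.
    apply: within_continuousD.
      by apply: continuous_subspaceT => x; apply: cvgM; [exact: cvg_id|exact: cs].
    by move=> z; apply: cvgM; [exact: cvg_cst|exact: asin_scaled_within].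
  split => //.
  by move=> x; rewrite in_itv /= => /dF[].
- by move=> x; rewrite in_itv /= => /dF[_ <-]; rewrite derive1E.
Qed.

End RadialIntegral.

Section DiskIntegral.
Context {R : realType}.
Notation mu := (@lebesgue_measure R).

Lemma measurable_sqn : measurable_fun [set: R * R] (@sqn R).
Proof.
apply: measurable_funD; apply: measurable_funX; [exact: measurable_fst|exact: measurable_snd].
Qed.

Lemma measurable_sqball (t : R) : measurable (sqball t).
Proof.
have -> : sqball t = [set: R * R] `&` (@sqn R) @^-1` `]-oo, t[%classic.
  by rewrite setTI; apply/seteqP; split => x /=; rewrite in_itv.
by apply: measurable_sqn => //; exact: measurable_itv.
Qed.

Lemma sqr_lt_sqrt (a y : R) : (y ^+ 2 < a) = (`|y| < Num.sqrt a).
Proof.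
have [a0|a0] := ltP 0 a; first by rewrite -(@sqrtr_sqr _ y) ltr_sqrt.
rewrite ler0_sqrtr// normr_lt0; apply/negbTE; rewrite -leNgt.
exact: le_trans a0 (sqr_ge0 y).
Qed.

Lemma sqball_area (t : R) : 0 <= t -> lebesgue2 (sqball t) = (pi * t)%:E.
Proof.
move=> t0; rewrite /lebesgue2 /product_measure1 /=.
(* [Num.sqrt] is 0 on negative numbers, so the formula also covers the empty sections, and the
   integral over the line reduces to one over a segment. *)
have xs (x : R) : mu (xsection (sqball t) x) = (2 * Num.sqrt (t - x ^+ 2))%:E.
  have -> : xsection (sqball t) x =
      `](- Num.sqrt (t - x ^+ 2)), (Num.sqrt (t - x ^+ 2))[%classic.
    apply/seteqP; split => y; rewrite /xsection /= inE /sqball /sqn /= in_itv /= -ltr_norml;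
      by rewrite -sqr_lt_sqrt ltrBrDl.
  rewrite lebesgue_measure_itv /= lte_fin.
  have := sqrtr_ge0 (t - x ^+ 2); case: ifPn => [_ _|]; first by rewrite -EFinB; congr EFin; lra.
  by rewrite -leNgt => h1 h2; congr EFin; lra.
under eq_integral do rewrite xs.
move: t0; rewrite le_eqVlt => /orP[/eqP t0|t0].
  rewrite -t0 mulr0; apply: integral0_eq => x _.
  by rewrite sub0r ler0_sqrtr ?mulr0// oppr_le0 sqr_ge0.
have s0 : 0 < Num.sqrt t by rewrite sqrtr_gt0.
have := integral_semicircle s0; rewrite sqr_sqrtr ?ltW// => <-.
rewrite [RHS]integral_mkcond; apply: eq_integral => x _.
rewrite patchE; case: ifPn => //; rewrite notin_setE /= in_itv /= => /negP.
rewrite -ler_norml -ltNge => h; rewrite ler0_sqrtr ?mulr0// subr_le0.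
rewrite -(real_normK (num_real x)) -[leLHS](sqr_sqrtr (ltW t0)).
by rewrite ler_pXn2r ?nnegrE ?sqrtr_ge0// ltW.
Qed.

End DiskIntegral.

Section RadialIntegration.
Context {R : realType}.

Lemma flat_cst (H : R -> R) (a b : R) : a <= b ->
  (forall x, a <= x <= b -> forall e, 0 < e -> exists2 d, 0 < d &
    forall y, a <= y <= b -> `|y - x| < d -> `|H y - H x| <= e * `|y - x|) ->
  H a = H b.
Proof.
move=> ab flat; apply: deriv0_cst => //.
- move=> x /andP[ax xb].
  suff h : (fun h => h^-1 *: (H (h *: 1 + x) - H x)) @ 0^' --> (0 : R).
    by split; [apply/cvg_ex; exists 0|apply/cvg_lim].
  apply/cvgrPdist_le => e e0.
  have [|d d0 hd] := flat x _ e e0; first by rewrite !ltW.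
  near=> h; rewrite sub0r normrN normrM normfV.
  have h0 : h != 0 by near: h; exact: nbhs_dnbhs_neq.
  rewrite ler_pdivrMl ?normr_gt0// mulrC.
  have hs : `|h| < Num.min d (Num.min (x - a) (b - x)).
    near: h; apply: dnbhs0_lt; rewrite !lt_min d0 !subr_gt0 ax xb //.
  move: hs; rewrite !lt_min => /andP[h1 /andP[h3 h4]].
  have := hd (h + x); rewrite addrK; rewrite /GRing.scale /= mulr1.
  apply; last exact: h1.
  by move: h3 h4; rewrite !ltr_norml => /andP[? ?] /andP[? ?]; apply/andP; split; lra.
- apply/within_continuous_epsP => x /=; rewrite in_itv /= => xab e e0.
  have [d d0 hd] := flat x xab 1 ltr01.
  exists (Num.min d e); first by rewrite lt_min d0.
  move=> y; rewrite in_itv /= lt_min => yab /andP[yd ye].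
  by apply: le_lt_trans ye; rewrite -[leRHS]mul1r hd.
Unshelve. all: by end_near. Qed.

(** This replaces polar coordinates. In the variable [|x|^2] the annulus between [s] and [t] has
    area [pi (t - s)], so the integral over it is [g] times this area up to the oscillation of [g].
    Hence [Psi t - pi * P t] has zero derivative, and it suffices to evaluate it at both ends. *)
Lemma radial_integral (g P : R -> R) (rho : R) : 0 < rho -> continuous g ->
  (forall t, 0 < t < rho -> is_derive t 1 P (g t)) ->
  {within `[0, rho], continuous P} ->
  \int[lebesgue2]_(x in sqball rho) g (sqn x) = pi * (P rho - P 0).
Proof.
move=> rho0 cg dP cP.
pose Psi (t : R) := \int[lebesgue2]_(x in sqball t) g (sqn x).
have [K hK] : exists K, forall t, 0 <= t <= rho -> `|g t| <= K.
  have cng : {within `[0, rho], continuous (fun t => `|g t|)}.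
    apply: continuous_subspaceT => t; apply: (@continuous_comp _ _ _ g Num.norm).
      exact: cg.
    exact: norm_continuous.
  have [c _ hc] := EVT_max (ltW rho0) cng.
  by exists (`|g c|) => t ht; apply: hc; rewrite in_itv.
have fin_area (t : R) (D : set (R * R)) : 0 <= t -> measurable D -> D `<=` sqball t ->
    (lebesgue2 D < +oo)%E.
  move=> t0 mD Dt; apply: (@le_lt_trans _ _ (lebesgue2 (sqball t))).
    by rewrite le_measure ?inE//; exact: measurable_sqball.
  by rewrite sqball_area ?ltry.
have mg (D : set (R * R)) : measurable_fun D (fun x => g (sqn x)).
  apply: measurable_funTS; apply: measurableT_comp; last exact: measurable_sqn.
  exact: continuous_measurable_fun.
have ig (t : R) (D : set (R * R)) : 0 <= t <= rho -> measurable D -> D `<=` sqball t ->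
    lebesgue2.-integrable D (EFin \o (fun x => g (sqn x))).
  move=> /andP[t0 tr] mD Dt; apply: measurable_bounded_integrable => //.
  - exact: fin_area Dt.
  - exact: mg.
  exists K; split; first exact: num_real.
  move=> M KM x xD; have xt := Dt x xD; apply: le_trans (ltW KM); apply: hK.
  by rewrite sqn_ge0 ltW// (lt_le_trans xt).
have ic (t c : R) (D : set (R * R)) : 0 <= t -> measurable D -> D `<=` sqball t ->
    lebesgue2.-integrable D (EFin \o (fun=> c)).
  move=> t0 mD Dt; apply: measurable_bounded_integrable => //.
  - exact: fin_area Dt.
  by exists (`|c|); split; [exact: num_real|move=> M KM x /= _; exact: ltW].
have arith (u v c e A : R) :
    (c - e) * A <= v -> v <= (c + e) * A -> `|u + v - u - c * A| <= e * A.
  by move=> ? ?; rewrite ler_norml; apply/andP; split; lra.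
have step (s t c e : R) : 0 <= s -> s <= t -> t <= rho ->
    (forall u, s <= u <= t -> `|g u - c| <= e) ->
    `|Psi t - Psi s - c * (pi * (t - s))| <= e * (pi * (t - s)).
  move=> s0 st tr hce; have t0 := le_trans s0 st.
  pose D := sqball t `\` sqball s.
  have mD : measurable D by apply: measurableD; exact: measurable_sqball.
  have DT : D `<=` sqball t by move=> x [].
  have E : sqball t = sqball s `|` D.
    by rewrite /D setDUK// => x; rewrite /sqball /= => /lt_le_trans; apply.
  have dis : [disjoint sqball s & D] by apply/disj_setPS => x [? []].
  have aD : fine (lebesgue2 D) = pi * (t - s).
    have : lebesgue2 (sqball t) = (lebesgue2 (sqball s) + lebesgue2 D)%E.
      rewrite [in LHS]E; apply: (measureU lebesgue2) => //; first exact: measurable_sqball.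
      exact/disj_set2P.
    rewrite !sqball_area//; case: (lebesgue2 D) => [a||] //= [] h.
    by rewrite mulrBr h; ring.
  have -> : Psi t = Psi s + \int[lebesgue2]_(x in D) g (sqn x).
    rewrite /Psi {1}E Rintegral_setU//; first exact: measurable_sqball.
    by rewrite -E; apply: (ig t) => //; [rewrite t0|exact: measurable_sqball].
  have iD := ig t D _ mD DT; rewrite t0 tr in iD; have {}iD := iD isT.
  have up : \int[lebesgue2]_(x in D) g (sqn x) <= (c + e) * (pi * (t - s)).
    rewrite -aD -Rintegral_cst//; apply: le_Rintegral => //; first exact: ic DT.
    move=> x [xt /negP xs]; have := hce (sqn x).
    by rewrite leNgt xs (ltW xt) ler_norml => /(_ isT) /andP[_]; lra.
  have lo : (c - e) * (pi * (t - s)) <= \int[lebesgue2]_(x in D) g (sqn x).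
    rewrite -aD -Rintegral_cst//; apply: le_Rintegral => //; first exact: ic DT.
    move=> x [xt /negP xs]; have := hce (sqn x).
    by rewrite leNgt xs (ltW xt) ler_norml => /(_ isT) /andP[]; lra.
  exact: arith lo up.
have Psi0 : Psi 0 = 0.
  rewrite /Psi (_ : sqball 0 = set0) ?Rintegral_set0//.
  by apply/seteqP; split => x //=; rewrite /sqball /= ltNge sqn_ge0.
suff : Psi 0 - pi * P 0 = Psi rho - pi * P rho.
  by rewrite Psi0 -/(Psi rho) mulrBr => h; rewrite -(subrK (pi * P rho) (Psi rho)) -h; ring.
have pi0 : 0 < pi :> R := pi_gt0 R.
have piN : pi != 0 :> R by rewrite gt_eqF.
apply: (@flat_cst (fun t => Psi t - pi * P t)); first exact: ltW.
move=> x xr e e0.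
have /continuous_at_epsP/(_ (e / (2 * pi))) := cg x.
rewrite divr_gt0 ?mulr_gt0// => /(_ isT)[d d0 hd].
exists d => // y yr yx.
have key (s t : R) : 0 <= s -> s <= t -> t <= rho ->
    (forall u, s <= u <= t -> `|g u - g x| <= e / (2 * pi)) ->
    `|(Psi t - pi * P t) - (Psi s - pi * P s)| <= e * (t - s).
  move=> s0 st tr hu.
  have h1 := step s t (g x) (e / (2 * pi)) s0 st tr hu.
  have h2 : `|(P t - g x * t) - (P s - g x * s)| <= e / (2 * pi) * (t - s).
    apply: (@increment_bound _ (fun t => P t - g x * t) (fun t => g t - g x)) => //.
    - move=> u /andP[su ut]; have hu' : is_derive u 1 P (g u) by apply: dP; lra.
      by derive_tac; ring.
    - have sub : `[s, t] `<=` `[0, rho].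
        by move=> u /=; rewrite !in_itv /= => /andP[? ?]; apply/andP; split; lra.
      move=> u; apply: continuousB; first exact: (continuous_subspaceW sub cP).
      by apply: continuous_subspaceT => v; apply: cvgM; [exact: cvg_cst|exact: cvg_id].
    - by move=> u /andP[su ut]; apply: hu; rewrite !ltW.
  have h3 : `|pi * ((P t - g x * t) - (P s - g x * s))| <= pi * (e / (2 * pi) * (t - s)).
    by rewrite normrM gtr0_norm// ler_pM2l.
  have e1 (c : R) : c != 0 -> e / (2 * c) * (c * (t - s)) = e / 2 * (t - s).
    by move=> c0; field.
  have e2 (c : R) : c != 0 -> c * (e / (2 * c) * (t - s)) = e / 2 * (t - s).
    by move=> c0; field.
  rewrite e1// in h1; rewrite e2// in h3; move: h1 h3.
  by rewrite !ler_norml => /andP[? ?] /andP[? ?]; apply/andP; split; lra.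
move: xr yr => /andP[x0 xr] /andP[y0 yr].
have [xy|yx'] := leP x y.
  rewrite (@ger0_norm _ (y - x)) ?subr_ge0//; apply: key => //.
  move=> u /andP[xu uy]; apply/ltW/hd; apply: le_lt_trans yx.
  by rewrite !ger0_norm ?subr_ge0//; lra.
rewrite distrC (distrC y) (@gtr0_norm _ (x - y)) ?subr_gt0//; apply: key => //.
  exact: ltW.
move=> u /andP[xu uy]; apply/ltW/hd; apply: le_lt_trans yx.
by rewrite (distrC y) (distrC u) !ger0_norm ?subr_ge0//; lra.
Qed.

End RadialIntegration.

(** * Maximum principle in narrow strips *)

Section PartialDerivatives.
Context {R : realType}.
Implicit Types (f : R * R -> R).

Lemma is_derive_dir0 f (a y d : R) :
  is_derive (a, y) (dir ord0) f d <-> is_derive a 1 (fun s => f (s, y)) d.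
Proof.
have E : (fun h : R => h^-1 *: ((f \o shift (a, y)) (h *: dir ord0) - f (a, y)))
   = (fun h : R => h^-1 *: (((fun s => f (s, y)) \o shift a) (h *: 1) - f (a, y))).
  apply/funext => h /=; congr (_ *: (f _ - _)).
  by rewrite /dir eqxx [LHS]surjective_pairing /= scaler0 add0r.
by split => -[h1 h2]; split; move: h1 h2; rewrite /derivable /derive E.
Qed.

Lemma is_derive_dir1 f (a y d : R) :
  is_derive (a, y) (dir (lift ord0 ord0)) f d <-> is_derive y 1 (fun s => f (a, s)) d.
Proof.
have E : (fun h : R => h^-1 *: ((f \o shift (a, y)) (h *: dir (lift ord0 ord0)) - f (a, y)))
   = (fun h : R => h^-1 *: (((fun s => f (a, s)) \o shift y) (h *: 1) - f (a, y))).
  apply/funext => h /=; congr (_ *: (f _ - _)).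
  by rewrite /dir [LHS]surjective_pairing /= scaler0 add0r.
by split => -[h1 h2]; split; move: h1 h2; rewrite /derivable /derive E.
Qed.

Lemma sum_ord2 (F : 'I_2 -> R) : \sum_(i < 2) F i = F ord0 + F (lift ord0 ord0).
Proof. by rewrite big_ord_recl big_ord1. Qed.

Lemma laplacianE f (x : R * R) : laplacian f x =
  pd ord0 (pd ord0 f) x + pd (lift ord0 ord0) (pd (lift ord0 ord0) f) x.
Proof. exact: (sum_ord2 (fun i => pd i (pd i f) x)). Qed.

Let taylor2_pos (g g1 g2 : R -> R) (H e s : R) : 0 <= s ->
  (forall u, 0 <= u <= s -> is_derive u 1 g (g1 u)) ->
  (forall u, 0 <= u <= s -> is_derive u 1 g1 (g2 u)) ->
  (forall u, 0 <= u <= s -> `|g2 u - H| <= e) ->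
  `|g s - g 0 - s * g1 0 - s ^+ 2 / 2 * H| <= e / 2 * s ^+ 2.
Proof.
move=> s0 d1 d2 hb.
have b1 (u : R) : 0 <= u <= s -> `|g1 u - g1 0 - u * H| <= e * u.
  move=> /andP[u0 us].
  have : `|(g1 u - H * u) - (g1 0 - H * 0)| <= e * (u - 0).
    apply: (@increment_bound _ (fun u => g1 u - H * u) (fun u => g2 u - H)) => //.
    - move=> x /andP[x0 xu]; have hx : is_derive x 1 g1 (g2 x) by apply: d2; lra.
      by derive_tac; ring.
    - apply: (@isd_within _ _ _ (fun u => g2 u - H)) => x /=; rewrite in_itv /= => /andP[x0 xu].
      have hx : is_derive x 1 g1 (g2 x) by apply: d2; lra.
      by derive_tac; ring.
    - by move=> x /andP[x0 xu]; apply: hb; lra.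
  by rewrite mulr0 !subr0 (_ : g1 u - H * u - g1 0 = g1 u - g1 0 - u * H)//; ring.
have : `|(g s - s * g1 0 - s ^+ 2 / 2 * H) - (g 0 - 0 * g1 0 - 0 ^+ 2 / 2 * H)|
    <= e / 2 * s ^+ 2 - e / 2 * 0 ^+ 2.
  apply: (@increment_dominated _ (fun s => g s - s * g1 0 - s ^+ 2 / 2 * H)
     (fun s => e / 2 * s ^+ 2) (fun u => g1 u - g1 0 - u * H) (fun u => e * u)) => //.
  - move=> x /andP[x0 xs]; have hx : is_derive x 1 g (g1 x) by apply: d1; lra.
    by derive_tac; field.
  - by move=> x _; derive_tac; field.
  - apply: (@isd_within _ _ _ (fun u => g1 u - g1 0 - u * H)) => x /=.
    rewrite in_itv /= => /andP[x0 xs]; have hx : is_derive x 1 g (g1 x) by apply: d1; lra.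
    by derive_tac; field.
  - by apply: (@isd_within _ _ _ (fun u => e * u)) => x _; derive_tac; field.
  - by move=> x /andP[x0 xs]; apply: b1; lra.
rewrite expr0n /= !mulr0 !mul0r !subr0.
by rewrite (_ : g s - s * g1 0 - s ^+ 2 / 2 * H - g 0 = g s - g 0 - s * g1 0 - s ^+ 2 / 2 * H)//; ring.
Qed.

Lemma taylor2 (g g1 g2 : R -> R) (H e s : R) :
  (forall u : R, `|u| <= `|s| -> is_derive u 1 g (g1 u)) ->
  (forall u : R, `|u| <= `|s| -> is_derive u 1 g1 (g2 u)) ->
  (forall u : R, `|u| <= `|s| -> `|g2 u - H| <= e) ->
  `|g s - g 0 - s * g1 0 - s ^+ 2 / 2 * H| <= e / 2 * s ^+ 2.
Proof.
move=> d1 d2 hb; have [s0|s0] := leP 0 s.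
  have hu (u : R) : 0 <= u <= s -> `|u| <= `|s|.
    by move=> /andP[u0 us]; rewrite !ger0_norm.
  by apply: (@taylor2_pos g g1 g2) => // u /hu; [exact: d1|exact: d2|exact: hb].
have hu (u : R) : 0 <= u <= - s -> `|- u| <= `|s|.
  by move=> /andP[u0 us]; rewrite normrN ger0_norm// ltr0_norm.
have := @taylor2_pos (fun u => g (- u)) (fun u => - g1 (- u)) (fun u => g2 (- u)) H e (- s).
rewrite opprK oppr0 sqrrN mulrNN; apply.
- lra.
- move=> u /hu h; have := d1 _ h => hd.
  notypeclasses refine (isd_eq (@isd_comp _ (fun u => - u) g u _ _ _ hd) _).
    exact: isd_opp_id.
  by ring.
- move=> u /hu h; have := d2 _ h => hd.
  notypeclasses refine (isd_eq (isd_opp (@isd_comp _ (fun u => - u) g1 u _ _ _ hd)) _).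
    exact: isd_opp_id.
  by ring.
- by move=> u /hu; exact: hb.
Qed.

Lemma normM_le_sqr (a b : R) : `|a| * `|b| <= a ^+ 2 / 2 + b ^+ 2 / 2.
Proof.
rewrite -(real_normK (num_real a)) -(real_normK (num_real b)).
have := sqr_ge0 (`|a| - `|b|); lra.
Qed.

Let taylor_assemble (fab fa f00 p r ra H00 H01 H11 a b e : R) :
  `|fa - f00 - a * p - a ^+ 2 / 2 * H00| <= e / 2 * a ^+ 2 ->
  `|fab - fa - b * ra - b ^+ 2 / 2 * H11| <= e / 2 * b ^+ 2 ->
  `|b * (ra - r - a * H01)| <= e * (`|a| * `|b|) ->
  e * (`|a| * `|b|) <= e * (a ^+ 2 / 2 + b ^+ 2 / 2) ->
  `|fab - f00 - a * p - b * r - (a ^+ 2 / 2 * H00 + a * b * H01 + b ^+ 2 / 2 * H11)|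
    <= e * (a ^+ 2 + b ^+ 2).
Proof.
rewrite !ler_norml => /andP[? ?] /andP[? ?] /andP[? ?] ?; apply/andP; split; lra.
Qed.

Section PlaneTaylor.
Variables (f : R * R -> R) (x : R * R) (e d : R).
Let f0 := pd ord0 f.
Let f1 := pd (lift ord0 ord0) f.
Let near_x (y : R * R) := `|y.1 - x.1| < d /\ `|y.2 - x.2| < d.
Hypothesis d1 : forall i y, near_x y -> derivable f y (dir i).
Hypothesis d2 : forall i j y, near_x y -> derivable (pd j f) y (dir i).
Hypothesis hb : forall i j y, near_x y ->
  `|pd i (pd j f) y - pd i (pd j f) x| <= e.

(** Moving from [x] first horizontally and then vertically brings in a single mixed derivative,
    [pd ord0 f1], through the change of [f1] along the horizontal segment. *)
Lemma plane_taylor2 (a b : R) : `|a| < d -> `|b| < d ->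
  `|f (x.1 + a, x.2 + b) - f x - a * f0 x - b * f1 x
    - (a ^+ 2 / 2 * pd ord0 f0 x + a * b * pd ord0 f1 x
       + b ^+ 2 / 2 * pd (lift ord0 ord0) f1 x)| <= e * (a ^+ 2 + b ^+ 2).
Proof.
move=> ad bd.
have d0 : 0 < d by exact: le_lt_trans ad.
have xx : (x.1, x.2) = x by case: x.
have shift_derive (g : R -> R) (c u dg : R) : is_derive (c + u) 1 g dg ->
    is_derive u 1 (fun s => g (c + s)) dg.
  move=> h; notypeclasses refine (isd_eq (@isd_comp _ (fun s => c + s) g u _ _ _ h) _).
    exact: isd_addl.
  by rewrite mulr1.
have P1 : `|f (x.1 + a, x.2) - f x - a * f0 x - a ^+ 2 / 2 * pd ord0 f0 x| <= e / 2 * a ^+ 2.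
  have := @taylor2 (fun s => f (x.1 + s, x.2)) (fun s => f0 (x.1 + s, x.2))
    (fun s => pd ord0 f0 (x.1 + s, x.2)) (pd ord0 f0 x) e a.
  rewrite !addr0 xx; apply.
  - move=> u ua; apply: (shift_derive (fun s => f (s, x.2))).
    apply/is_derive_dir0/derivableP; apply: d1; split => /=; last by rewrite subrr normr0.
    by rewrite addrAC subrr add0r (le_lt_trans ua).
  - move=> u ua; apply: (shift_derive (fun s => f0 (s, x.2))).
    apply/is_derive_dir0/derivableP; apply: d2; split => /=; last by rewrite subrr normr0.
    by rewrite addrAC subrr add0r (le_lt_trans ua).
  - move=> u ua; apply: hb; split => /=; last by rewrite subrr normr0.
    by rewrite addrAC subrr add0r (le_lt_trans ua).
have P2 : `|f (x.1 + a, x.2 + b) - f (x.1 + a, x.2) - b * f1 (x.1 + a, x.2)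
     - b ^+ 2 / 2 * pd (lift ord0 ord0) f1 x| <= e / 2 * b ^+ 2.
  have := @taylor2 (fun s => f (x.1 + a, x.2 + s)) (fun s => f1 (x.1 + a, x.2 + s))
    (fun s => pd (lift ord0 ord0) f1 (x.1 + a, x.2 + s)) (pd (lift ord0 ord0) f1 x) e b.
  rewrite !addr0; apply.
  - move=> u ub; apply: (shift_derive (fun s => f (x.1 + a, s))).
    apply/is_derive_dir1/derivableP; apply: d1.
    by split => /=; rewrite addrAC subrr add0r// (le_lt_trans ub).
  - move=> u ub; apply: (shift_derive (fun s => f1 (x.1 + a, s))).
    apply/is_derive_dir1/derivableP; apply: d2.
    by split => /=; rewrite addrAC subrr add0r// (le_lt_trans ub).
  - move=> u ub; apply: hb.
    by split => /=; rewrite addrAC subrr add0r// (le_lt_trans ub).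
have P3 : `|f1 (x.1 + a, x.2) - f1 x - a * pd ord0 f1 x| <= e * `|a|.
  have D (u : R) : `|u| <= `|a| ->
      is_derive u 1 (fun s => f1 (x.1 + s, x.2) - pd ord0 f1 x * s)
        (pd ord0 f1 (x.1 + u, x.2) - pd ord0 f1 x).
    move=> ua.
    have h : is_derive u 1 (fun s => f1 (x.1 + s, x.2)) (pd ord0 f1 (x.1 + u, x.2)).
      apply: (shift_derive (fun s => f1 (s, x.2))).
      apply/is_derive_dir0/derivableP; apply: d2; split => /=; last by rewrite subrr normr0.
      by rewrite addrAC subrr add0r (le_lt_trans ua).
    notypeclasses refine (isd_eq (isd_add h (isd_opp (isd_mull _ _ _))) _).
    by rewrite mulr1.
  have B (u : R) : `|u| <= `|a| -> `|pd ord0 f1 (x.1 + u, x.2) - pd ord0 f1 x| <= e.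
    move=> ua; apply: hb; split => /=; last by rewrite subrr normr0.
    by rewrite addrAC subrr add0r (le_lt_trans ua).
  have gen (s t : R) : s <= t -> (forall u, s <= u <= t -> `|u| <= `|a|) ->
     `|(f1 (x.1 + t, x.2) - pd ord0 f1 x * t) - (f1 (x.1 + s, x.2) - pd ord0 f1 x * s)|
       <= e * (t - s).
    move=> st hu; apply: (@increment_bound _ (fun s => f1 (x.1 + s, x.2) - pd ord0 f1 x * s)
      (fun u => pd ord0 f1 (x.1 + u, x.2) - pd ord0 f1 x)) => //.
    - by move=> u /andP[su ut]; apply/D/hu; rewrite !ltW.
    - by apply: isd_within => u /=; rewrite in_itv /= => sut; exact/D/hu.
    - by move=> u /andP[su ut]; apply/B/hu; rewrite !ltW.
  have [a0|a0] := leP 0 a.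
    have := gen 0 a a0; rewrite addr0 xx mulr0 !subr0.
    rewrite (_ : _ - _ * a - f1 x = f1 (x.1 + a, x.2) - f1 x - a * pd ord0 f1 x); last by ring.
    rewrite [in X in _ -> X](ger0_norm a0); apply => u /andP[u0 ua].
    by rewrite !ger0_norm.
  have := gen a 0 (ltW a0); rewrite addr0 xx mulr0 !subr0 distrC.
  rewrite (_ : _ - _ * a - f1 x = f1 (x.1 + a, x.2) - f1 x - a * pd ord0 f1 x); last by ring.
  rewrite sub0r [in X in _ -> X](ltr0_norm a0); apply => u /andP[u0 ua].
  by rewrite (ltr0_norm a0) ler0_norm// lerN2.
have P4 : `|b * (f1 (x.1 + a, x.2) - f1 x - a * pd ord0 f1 x)| <= e * (`|a| * `|b|).
  by rewrite normrM mulrA [leRHS]mulrC ler_wpM2l.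
have e0 : 0 <= e by apply: le_trans (hb ord0 ord0 (y := x) _) => //; split; rewrite subrr normr0.
have P5 : e * (`|a| * `|b|) <= e * (a ^+ 2 / 2 + b ^+ 2 / 2).
  by rewrite ler_wpM2l// normM_le_sqr.
exact: taylor_assemble P1 P2 P4 P5.
Qed.

End PlaneTaylor.

End PartialDerivatives.

Section MaximumPrinciple.
Context {R : realType}.
Implicit Types (f g : R * R -> R) (e x : R * R).

Definition dotp e x : R := e.1 * x.1 + e.2 * x.2.

Definition unitv e : Prop := e.1 ^+ 2 + e.2 ^+ 2 = 1.

Definition fivepoint e f x (h : R) : R :=
  f (x.1 + h * e.1, x.2 + h * e.2) + f (x.1 - h * e.1, x.2 - h * e.2)
  + f (x.1 - h * e.2, x.2 + h * e.1) + f (x.1 + h * e.2, x.2 - h * e.1) - 4 * f x.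

(* The Laplacian seen in the orthonormal frame of the unit vector [e]; unlike a
   combination of partial derivatives it is obviously invariant under the reflection
   in a line orthogonal to [e]. *)
Definition has_lapl e f x (l : R) := forall eps : R, 0 < eps -> exists2 d, 0 < d &
  forall h, 0 < h < d -> `|fivepoint e f x h - h ^+ 2 * l| <= eps * h ^+ 2.

Lemma has_lapl_add e f g x l m : has_lapl e f x l -> has_lapl e g x m ->
  has_lapl e (fun y => f y + g y) x (l + m).
Proof.
move=> hf hg eps eps0; have e20 : 0 < eps / 2 by rewrite divr_gt0.
have [d1 d10 h1] := hf _ e20; have [d2 d20 h2] := hg _ e20.
exists (Num.min d1 d2); first by rewrite lt_min d10.
move=> h; rewrite lt_min => /andP[h0 /andP[hd1 hd2]].
have := h1 h; rewrite h0 hd1 => /(_ isT) H1.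
have := h2 h; rewrite h0 hd2 => /(_ isT) H2.
rewrite (_ : fivepoint _ _ _ _ - _ = (fivepoint e f x h - h ^+ 2 * l)
  + (fivepoint e g x h - h ^+ 2 * m)); last by rewrite /fivepoint; ring.
apply: le_trans (ler_normD _ _) _; apply: le_trans (lerD H1 H2) _; lra.
Qed.

Lemma has_lapl_scale e f x l (c : R) : has_lapl e f x l ->
  has_lapl e (fun y => c * f y) x (c * l).
Proof.
move=> hf eps eps0.
have c0 : 0 < `|c| + 1 by rewrite ltr_wpDl.
have [d d0 hd] := hf (eps / (`|c| + 1)) (divr_gt0 eps0 c0).
exists d => // h hh; have {}hd := hd h hh.
rewrite (_ : fivepoint _ _ _ _ - _ = c * (fivepoint e f x h - h ^+ 2 * l)); last first.
  by rewrite /fivepoint; ring.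
rewrite normrM; apply: (@le_trans _ _ (`|c| * (eps / (`|c| + 1) * h ^+ 2))).
  by rewrite ler_wpM2l.
rewrite mulrA ler_wpM2r ?sqr_ge0// mulrCA -[leRHS]mulr1 ler_pM2l// ler_pdivrMr// mul1r.
by rewrite lerDl.
Qed.

Lemma has_lapl_cst e x (c : R) : has_lapl e (fun=> c) x 0.
Proof.
move=> eps eps0; exists 1 => // h _.
rewrite (_ : fivepoint _ _ _ _ - _ = 0); first by rewrite normr0 mulr_ge0 ?sqr_ge0 ?(ltW eps0).
by rewrite /fivepoint; ring.
Qed.

Lemma has_lapl_dotp e x : has_lapl e (dotp e) x 0.
Proof.
move=> eps eps0; exists 1 => // h _.
rewrite (_ : fivepoint _ _ _ _ - _ = 0); first by rewrite normr0 mulr_ge0 ?sqr_ge0 ?(ltW eps0).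
by rewrite /fivepoint /dotp /=; ring.
Qed.

Lemma has_lapl_dotp_sqr e x (a : R) : unitv e ->
  has_lapl e (fun y => (dotp e y - a) ^+ 2) x 2.
Proof.
move=> eu eps eps0; exists 1 => // h _.
rewrite (_ : fivepoint _ _ _ _ - _ = 0); first by rewrite normr0 mulr_ge0 ?sqr_ge0 ?(ltW eps0).
rewrite /fivepoint /dotp /=.
transitivity (2 * h ^+ 2 * ((e.1 ^+ 2 + e.2 ^+ 2) ^+ 2 - 1)); first by ring.
by rewrite eu; ring.
Qed.

Lemma has_lapl_min e f x l : has_lapl e f x l ->
  (exists2 d, 0 < d & forall h, 0 < h < d -> 0 <= fivepoint e f x h) -> 0 <= l.
Proof.
move=> hf [d d0 hd]; apply/ler_addgt0Pr => eps eps0.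
have [d' d'0 hd'] := hf _ eps0.
pose h := Num.min d d' / 2.
have m0 : 0 < Num.min d d' by rewrite lt_min d0.
have h0 : 0 < h by rewrite divr_gt0.
have hm : h < Num.min d d' by rewrite /h; lra.
move: hm; rewrite lt_min => /andP[h1 h2].
have := hd h; rewrite h0 h1 => /(_ isT) H1.
have := hd' h; rewrite h0 h2 => /(_ isT).
rewrite ler_norml => /andP[_ H2].
have : 0 <= h ^+ 2 * (l + eps) by lra.
by rewrite pmulr_rge0 ?exprn_gt0.
Qed.

(** The four points are plus and minus [h e] and plus and minus [h] times the normal to [e]. Over
    them the linear terms cancel in opposite pairs, the mixed terms cancel between the two axes, and
    [c^2 + s^2 = 1] leaves [h^2] times the trace of the Hessian. *)
Let fivepoint_assemble (fA fB fC fD f0 p r H00 H01 H11 h c s eps : R) :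
  let Q a b := a ^+ 2 / 2 * H00 + a * b * H01 + b ^+ 2 / 2 * H11 in
  c ^+ 2 + s ^+ 2 = 1 ->
  `|fA - f0 - (h * c) * p - (h * s) * r - Q (h * c) (h * s)|
    <= eps / 4 * ((h * c) ^+ 2 + (h * s) ^+ 2) ->
  `|fB - f0 - (- (h * c)) * p - (- (h * s)) * r - Q (- (h * c)) (- (h * s))|
    <= eps / 4 * ((- (h * c)) ^+ 2 + (- (h * s)) ^+ 2) ->
  `|fC - f0 - (- (h * s)) * p - (h * c) * r - Q (- (h * s)) (h * c)|
    <= eps / 4 * ((- (h * s)) ^+ 2 + (h * c) ^+ 2) ->
  `|fD - f0 - (h * s) * p - (- (h * c)) * r - Q (h * s) (- (h * c))|
    <= eps / 4 * ((h * s) ^+ 2 + (- (h * c)) ^+ 2) ->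
  `|fA + fB + fC + fD - 4 * f0 - h ^+ 2 * (H00 + H11)| <= eps * h ^+ 2.
Proof.
move=> Q cs; rewrite /Q.
have arith (A B C D a b a1 k : R) : `|A| <= a -> `|B| <= b -> `|C| <= a1 -> `|D| <= k ->
    `|A + B + C + D| <= a + b + a1 + k.
  by move=> ? ? ? ?; do 3!(apply: le_trans (ler_normD _ _) _; apply: lerD => //).
move=> T1 T2 T3 T4; have := arith _ _ _ _ _ _ _ _ T1 T2 T3 T4.
rewrite (_ : eps / 4 * _ + _ + _ + _ = eps * h ^+ 2 * (c ^+ 2 + s ^+ 2)); last by field.
rewrite cs mulr1; congr (`|_| <= _).
rewrite (_ : fA + fB + fC + fD - 4 * f0 - h ^+ 2 * (H00 + H11)
  = fA + fB + fC + fD - 4 * f0 - h ^+ 2 * (c ^+ 2 + s ^+ 2) * (H00 + H11)).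
  by field.
by rewrite cs mulr1.
Qed.

Lemma has_lapl_C2 e f x (r : R) : unitv e -> 0 < r ->
  (forall i y, `|y.1 - x.1| < r /\ `|y.2 - x.2| < r -> derivable f y (dir i)) ->
  (forall i j y, `|y.1 - x.1| < r /\ `|y.2 - x.2| < r -> derivable (pd j f) y (dir i)) ->
  (forall i j, {for x, continuous (pd i (pd j f))}) ->
  has_lapl e f x (laplacian f x).
Proof.
move=> eu r0 d1 d2 cf eps eps0.
have [d d0 hd] : exists2 d, 0 < d & forall i j (y : R * R),
    `|y.1 - x.1| < d /\ `|y.2 - x.2| < d ->
    `|pd i (pd j f) y - pd i (pd j f) x| <= eps / 4.
  have one i j : exists d, 0 < d /\ forall y : R * R,
      `|y.1 - x.1| < d /\ `|y.2 - x.2| < d ->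
      `|pd i (pd j f) y - pd i (pd j f) x| <= eps / 4.
    have /cvgrPdist_lt /(_ (eps / 4)) := cf i j.
    rewrite divr_gt0// => /(_ isT) /nbhs_normP[d /= d0 h]; exists d; split => // y [y1 y2].
    rewrite distrC; apply/ltW/h => /=.
    by rewrite distrC /Num.norm /= gt_max y1 y2.
  have [a [a0 ha]] := one ord0 ord0; have [b [b0 hb]] := one ord0 (lift ord0 ord0).
  have [c [c0 hc]] := one (lift ord0 ord0) ord0.
  have [k [k0 hk]] := one (lift ord0 ord0) (lift ord0 ord0).
  exists (Num.min (Num.min a b) (Num.min c k)); first by rewrite !lt_min a0 b0 c0.
  move=> i j y; rewrite !lt_min => -[/andP[/andP[? ?] /andP[? ?]] /andP[/andP[? ?] /andP[? ?]]].
  have E (m : 'I_2) : m = ord0 \/ m = lift ord0 ord0.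
    by case: m => -[|[|//]] ?; [left|right]; apply/val_inj.
  by case: (E i) => ->; case: (E j) => ->; [apply: ha|apply: hb|apply: hc|apply: hk].
have e1 : `|e.1| <= 1.
  rewrite -(@ler_pXn2r _ 2) ?nnegrE// real_normK ?num_real// expr1n -eu lerDl; exact: sqr_ge0.
have e2 : `|e.2| <= 1.
  rewrite -(@ler_pXn2r _ 2) ?nnegrE// real_normK ?num_real// expr1n -eu lerDr; exact: sqr_ge0.
exists (Num.min d r); first by rewrite lt_min d0.
move=> h; rewrite lt_min => /andP[h0 /andP[hd1 hr]].
have T (a b : R) : `|a| <= h -> `|b| <= h ->
  `|f (x.1 + a, x.2 + b) - f x - a * pd ord0 f x - b * pd (lift ord0 ord0) f x
    - (a ^+ 2 / 2 * pd ord0 (pd ord0 f) x + a * b * pd ord0 (pd (lift ord0 ord0) f) x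
       + b ^+ 2 / 2 * pd (lift ord0 ord0) (pd (lift ord0 ord0) f) x)|
    <= eps / 4 * (a ^+ 2 + b ^+ 2).
  move=> ah bh; apply: (@plane_taylor2 _ f x (eps / 4) (Num.min d r)).
  - by move=> i y; rewrite !lt_min => -[/andP[_ ?] /andP[_ ?]]; apply: d1.
  - by move=> i j y; rewrite !lt_min => -[/andP[_ ?] /andP[_ ?]]; apply: d2.
  - by move=> i j y; rewrite !lt_min => -[/andP[? _] /andP[? _]]; apply: hd.
  - by rewrite lt_min !(le_lt_trans ah).
  - by rewrite lt_min !(le_lt_trans bh).
have he1 : `|h * e.1| <= h by rewrite normrM gtr0_norm// -[leRHS]mulr1 ler_pM2l.
have he2 : `|h * e.2| <= h by rewrite normrM gtr0_norm// -[leRHS]mulr1 ler_pM2l.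
have T1 := T _ _ he1 he2.
have T2 := T (- (h * e.1)) (- (h * e.2)); rewrite !normrN in T2; have {}T2 := T2 he1 he2.
have T3 := T (- (h * e.2)) (h * e.1); rewrite !normrN in T3; have {}T3 := T3 he2 he1.
have T4 := T (h * e.2) (- (h * e.1)); rewrite !normrN in T4; have {}T4 := T4 he2 he1.
rewrite laplacianE; exact: fivepoint_assemble eu T1 T2 T3 T4.
Qed.

End MaximumPrinciple.

Section StripPrinciple.
Context {R : realType}.
Implicit Types (f g : R * R -> R) (e x : R * R).

Lemma continuous_coord1 : continuous (fun x : R * R => x.1).
Proof. by move=> x; exact: cvg_fst. Qed.

Lemma continuous_coord2 : continuous (fun x : R * R => x.2).
Proof. by move=> x; exact: cvg_snd. Qed.

Lemma continuous_sqn : continuous (@sqn R).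
Proof.
move=> x; apply: cvgD; rewrite /GRing.exp /=.
  by apply: cvgM; exact: continuous_coord1.
by apply: cvgM; exact: continuous_coord2.
Qed.

Lemma continuous_dotp e : continuous (dotp e).
Proof.
move=> x; apply: cvgD; apply: cvgM; try exact: cvg_cst.
  exact: continuous_coord1.
exact: continuous_coord2.
Qed.

Lemma compact_sqn (rho : R) (A : set (R * R)) : closed A ->
  A `<=` [set x | sqn x <= rho] -> compact A.
Proof.
move=> cA Ar.
set s := Num.sqrt rho.
have cB : compact ((`[- s, s]%classic `*` `[- s, s]%classic) : set (R * R)).
  by apply: compact_setX; exact: segment_compact.
apply: (subclosed_compact cA cB).
move=> x /Ar /= xr; split => /=; rewrite in_itv /= -ler_norml.
  rewrite -(@sqrtr_sqr _ x.1) ler_wsqrtr// (le_trans _ xr)// lerDl; exact: sqr_ge0.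
rewrite -(@sqrtr_sqr _ x.2) ler_wsqrtr// (le_trans _ xr)// lerDr; exact: sqr_ge0.
Qed.

Lemma continuous_lt_near f x (c : R) : {for x, continuous f} -> f x < c ->
  exists2 r, 0 < r & forall y : R * R, `|y.1 - x.1| < r -> `|y.2 - x.2| < r -> f y < c.
Proof.
move=> /cvgrPdist_lt /(_ (c - f x)); rewrite subr_gt0 => h fxc.
have /nbhs_normP[r /= r0 hr] := h fxc; exists r => // y y1 y2.
have /= := hr y; rewrite /Num.norm /= gt_max !(distrC _ y.1) !(distrC _ y.2).
rewrite -/(Num.norm (y.1 - x.1)) -/(Num.norm (y.2 - x.2)) y1 y2 => /(_ isT).
by rewrite -/(Num.norm (f x - f y)) ltr_norml => /andP[? _]; lra.
Qed.

Definition strip (rho a b : R) e : set (R * R) :=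
  [set x | sqn x <= rho] `&` [set x | a <= dotp e x] `&` [set x | dotp e x <= b].

Lemma closed_sqn_le (rho : R) : closed [set x : R * R | sqn x <= rho].
Proof.
apply: (@preimage_closed _ _ (@sqn R) [set t | t <= rho]); last exact: closed_le.
by move=> x _; exact: continuous_sqn.
Qed.

Lemma compact_strip (rho a b : R) e : compact (strip rho a b e).
Proof.
apply: (@compact_sqn rho); last by move=> x [[]].
apply: closedI; first (apply: closedI; first exact: closed_sqn_le).
  apply: (@preimage_closed _ _ (dotp e) [set t | a <= t]); last exact: closed_ge.
  by move=> x _; exact: continuous_dotp.
apply: (@preimage_closed _ _ (dotp e) [set t | t <= b]); last exact: closed_le.
by move=> x _; exact: continuous_dotp.
Qed.

(* A function touching zero from above at an interior point, via the supersolution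
   [2 (b - a)^2 - (x.e - a)^2] of the operator [Delta + L] in a narrow strip. *)
Lemma strip_max_principle e (rho a b L : R) (w : R * R -> R) :
  unitv e -> a < b -> 0 <= L -> (b - a) ^+ 2 * L < 1 ->
  {within strip rho a b e, continuous w} ->
  (forall x, sqn x < rho -> a < dotp e x < b -> w x < 0 ->
     exists2 l, has_lapl e w x l & l <= - L * w x) ->
  (forall x, strip rho a b e x -> sqn x = rho \/ dotp e x = a \/ dotp e x = b ->
     0 <= w x) ->
  forall x, strip rho a b e x -> 0 <= w x.
Proof.
move=> eu ab L0 small cw hw hbd x0 Kx0; rewrite leNgt; apply/negP => wx0.
set d := b - a in small; have d0 : 0 < d by rewrite subr_gt0.
pose phi x := 2 * d ^+ 2 - (dotp e x - a) ^+ 2.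
have phi_bd x : strip rho a b e x -> d ^+ 2 <= phi x <= 2 * d ^+ 2.
  move=> [[_ /= xa] xb]; rewrite /phi /d gerBl sqr_ge0 andbT lerBrDl.
  have : (dotp e x - a) ^+ 2 <= (b - a) ^+ 2.
    by rewrite ler_pXn2r ?nnegrE ?subr_ge0// ?lerD2r//; exact: ltW.
  lra.
have d20 : 0 < d ^+ 2 by rewrite exprn_gt0.
have phi0 x : strip rho a b e x -> 0 < phi x.
  by move=> /phi_bd /andP[h _]; exact: lt_le_trans h.
have cphi : continuous phi.
  move=> x; apply: cvgB; first exact: cvg_cst.
  by rewrite /GRing.exp /=; apply: cvgM; (apply: cvgB; [exact: continuous_dotp|exact: cvg_cst]).
have cv : {within strip rho a b e, continuous (fun x => w x / phi x)}.
  apply/subspace_continuousP => x Ax; apply: cvgM.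
    by move/subspace_continuousP : cw; exact.
  apply: cvgV; first by rewrite gt_eqF// phi0.
  by apply: cvg_within_filter; exact: cphi.
have [z Kz zmin] : exists2 z, strip rho a b e z & forall x, strip rho a b e x ->
    w z / phi z <= w x / phi x.
  have [z] := compact_EVT_min (ex_intro _ x0 Kx0) (@compact_strip rho a b e) cv.
  by rewrite inE => Kz h; exists z => // x Kx; apply: h; rewrite inE.
have pz := phi0 _ Kz.
pose tau := - (w z / phi z).
have tau0 : 0 < tau.
  have := zmin _ Kx0; rewrite /tau oppr_gt0 => /le_lt_trans; apply.
  by rewrite pmulr_llt0// invr_gt0 phi0.
have wz : w z = - tau * phi z by rewrite /tau opprK divfK// gt_eqF.
have wz0 : w z < 0 by rewrite wz mulNr oppr_lt0 mulr_gt0.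
have above x : strip rho a b e x -> 0 <= w x + tau * phi x.
  move=> Kx; have := zmin _ Kx; rewrite ler_pdivlMr ?phi0//.
  by rewrite /tau mulNr; lra.
have [zr za zb] : [/\ sqn z < rho, a < dotp e z & dotp e z < b].
  have nb : ~ (sqn z = rho \/ dotp e z = a \/ dotp e z = b).
    by move=> /(hbd _ Kz); rewrite leNgt wz0.
  move: Kz => [[/= z1 z2] z3]; split; rewrite lt_neqAle ?z1 ?z2 ?z3 andbT;
    by apply/eqP => h; apply: nb; rewrite h; tauto.
have [l hl ll] : exists2 l, has_lapl e w z l & l <= - L * w z.
  by apply: hw => //; rewrite za.
have hphi : has_lapl e phi z (0 + (-1) * 2).
  have -> : phi = (fun y => 2 * d ^+ 2 + (-1) * (dotp e y - a) ^+ 2).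
    by apply/funext => y; rewrite /phi; ring.
  by apply: has_lapl_add; [exact: has_lapl_cst|apply: has_lapl_scale; exact: has_lapl_dotp_sqr].
have hsum := has_lapl_add hl (has_lapl_scale tau hphi).
have near_in : exists2 r, 0 < r & forall y : R * R,
    `|y.1 - z.1| < r -> `|y.2 - z.2| < r -> strip rho a b e y.
  have [r1 r10 h1] := continuous_lt_near (@continuous_sqn z) zr.
  have [r2 r20 h2] := continuous_lt_near (@continuous_dotp e z) zb.
  have cn : {for z, continuous (fun x => - dotp e x)}.
    by apply: cvgN; exact: continuous_dotp.
  have za' : - dotp e z < - a by rewrite ltrN2.
  have [r3 r30 h3] := continuous_lt_near cn za'.
  exists (Num.min r1 (Num.min r2 r3)); first by rewrite !lt_min r10 r20.
  move=> y; rewrite !lt_min => /andP[? /andP[? ?]] /andP[? /andP[? ?]].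
  split; first split => /=; apply/ltW; [exact: h1| |exact: h2].
  by rewrite -ltrN2; exact: h3.
have [r r0 hr] := near_in.
have e1 : `|e.1| <= 1.
  rewrite -(@ler_pXn2r _ 2) ?nnegrE// real_normK ?num_real// expr1n -eu lerDl; exact: sqr_ge0.
have e2 : `|e.2| <= 1.
  rewrite -(@ler_pXn2r _ 2) ?nnegrE// real_normK ?num_real// expr1n -eu lerDr; exact: sqr_ge0.
have : 0 <= l + tau * (0 + -1 * 2).
  apply: (has_lapl_min hsum); exists r => // h /andP[h0 hh].
  have he1 : `|h * e.1| < r.
    by apply: le_lt_trans hh; rewrite normrM gtr0_norm// -[leRHS]mulr1 ler_pM2l.
  have he2 : `|h * e.2| < r.
    by apply: le_lt_trans hh; rewrite normrM gtr0_norm// -[leRHS]mulr1 ler_pM2l.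
  have sub (c u : R) : `|u| < r -> `|c + u - c| < r by rewrite addrAC subrr add0r.
  have subN (c u : R) : `|u| < r -> `|c - u - c| < r.
    by move=> ur; rewrite addrAC subrr add0r normrN.
  rewrite /fivepoint (_ : w z + tau * phi z = 0) ?mulr0 ?subr0; last first.
    by rewrite wz; ring.
  have four (A B C D : R) : 0 <= A -> 0 <= B -> 0 <= C -> 0 <= D -> 0 <= A + B + C + D.
    by move=> ? ? ? ?; rewrite !addr_ge0.
  by apply: four; apply: above; apply: hr; rewrite /= ?subN ?sub.
(* The minimum gives [0 <= l - 2 tau], while [l <= - L w z = tau L phi z <= tau L (2 d^2) < 2 tau]:
   this is where the strip has to be narrow. *)
have : L * (2 * d ^+ 2) < 2 by rewrite mulrCA -[ltRHS]mulr1 ltr_pM2l// mulrC.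
have : - L * w z <= tau * (L * (2 * d ^+ 2)).
  rewrite wz (_ : - L * _ = tau * (L * phi z)); last by ring.
  rewrite ler_pM2l// ler_wpM2l//.
  by have /andP[] := phi_bd _ Kz.
move=> h1 h2 h3.
have : tau * (L * (2 * d ^+ 2)) < tau * 2 by rewrite ltr_pM2l.
lra.
Qed.

End StripPrinciple.

(** * Radial symmetry *)

Section MovingPlanes.
Context {R : realType}.
Implicit Types (f g : R * R -> R) (e x : R * R).

Lemma compact_uniform_eps {V : normedModType R} (K : set V) (f : V -> R) :
  compact K -> {within K, continuous f} -> forall eps : R, 0 < eps ->
  exists2 d, 0 < d & forall x y : V, K x -> K y -> `|x - y| < d -> `|f x - f y| < eps.
Proof.
move=> /compact_near_coveringP cK /within_continuous_epsP cf eps eps0.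
have [|d /= d0 hd] := cK R 0^'+ (fun d (x : V) => forall y : V, K x -> K y -> `|x - y| < d ->
    `|f x - f y| < eps) _ _.
  move=> x Kx; have e20 : 0 < eps / 2 by rewrite divr_gt0.
  have [d d0 hd] := cf x Kx _ e20.
  exists ([set y | `|y - x| < d / 2], [set t | t < d / 2]) => /=.
    split; last by apply: nbhs_right_lt; rewrite divr_gt0.
    by apply/nbhs_normP; exists (d / 2) => /=; [rewrite divr_gt0|move=> y /=; rewrite distrC].
  move=> [x' t] [/= hx' ht] y Kx' Ky hxy.
  have h2 : `|f x' - f x| < eps / 2 by apply: hd => //; lra.
  have h3 : `|f y - f x| < eps / 2.
    apply: hd => //; rewrite (_ : y - x = (y - x') + (x' - x)); last by rewrite addrA subrK.
    by apply: le_lt_trans (ler_normD _ _) _; rewrite distrC; lra.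
  rewrite (_ : f x' - f y = (f x' - f x) - (f y - f x)); last by ring.
  by apply: le_lt_trans (ler_normB _ _) _; lra.
exists (d / 2); first by rewrite divr_gt0.
move=> x y Kx Ky xy; apply: (hd (d / 2)) => //=.
- by rewrite sub0r normrN gtr0_norm ?divr_gt0//; lra.
- by rewrite divr_gt0.
Qed.

Definition reflect e (m : R) x : R * R :=
  (x.1 - 2 * (dotp e x - m) * e.1, x.2 - 2 * (dotp e x - m) * e.2).

Lemma sqn_reflect e m x : unitv e ->
  sqn (reflect e m x) = sqn x - 4 * m * (dotp e x - m).
Proof.
rewrite /unitv /sqn /reflect /dotp /= => eu; set s := _ + _ * x.2.
transitivity (x.1 ^+ 2 + x.2 ^+ 2 - 4 * (s - m) * s + 4 * (s - m) ^+ 2 * (e.1 ^+ 2 + e.2 ^+ 2)).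
  by rewrite /s; ring.
by rewrite eu; ring.
Qed.

Lemma reflect_fix e m x : dotp e x = m -> reflect e m x = x.
Proof.
by move=> h; rewrite /reflect h subrr mulr0 !mul0r !subr0; case: x {h}.
Qed.

Lemma has_lapl_reflect e m f x l : unitv e -> has_lapl e f (reflect e m x) l ->
  has_lapl e (fun y => f (reflect e m y)) x l.
Proof.
move=> eu hf eps eps0; have [d d0 hd] := hf _ eps0; exists d => // h hh.
have := hd h hh.
suff -> : fivepoint e (fun y => f (reflect e m y)) x h = fivepoint e f (reflect e m x) h by [].
have D1 (k : R) : dotp e (x.1 + k * e.1, x.2 + k * e.2) = dotp e x + k.
  rewrite /dotp /=; transitivity (e.1 * x.1 + e.2 * x.2 + k * (e.1 ^+ 2 + e.2 ^+ 2)).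
    by ring.
  by rewrite eu mulr1.
have D2 (k : R) : dotp e (x.1 - k * e.2, x.2 + k * e.1) = dotp e x.
  by rewrite /dotp /=; ring.
have D1' := D1 (- h); rewrite !mulNr in D1'.
have D2' := D2 (- h); rewrite !mulNr opprK in D2'.
have EA : reflect e m (x.1 + h * e.1, x.2 + h * e.2) =
    ((reflect e m x).1 - h * e.1, (reflect e m x).2 - h * e.2).
  by rewrite /reflect D1 /=; congr pair; ring.
have EB : reflect e m (x.1 - h * e.1, x.2 - h * e.2) =
    ((reflect e m x).1 + h * e.1, (reflect e m x).2 + h * e.2).
  by rewrite /reflect D1' /=; congr pair; ring.
have EC : reflect e m (x.1 - h * e.2, x.2 + h * e.1) =
    ((reflect e m x).1 - h * e.2, (reflect e m x).2 + h * e.1).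
  by rewrite /reflect D2 /=; congr pair; ring.
have ED : reflect e m (x.1 + h * e.2, x.2 - h * e.1) =
    ((reflect e m x).1 + h * e.2, (reflect e m x).2 - h * e.1).
  by rewrite /reflect D2' /=; congr pair; ring.
by rewrite /fivepoint EA EB EC ED (addrC (f (_ - _, _ - _))).
Qed.

End MovingPlanes.

Section GidasNiNirenberg.
Context {R : realType}.
Variables (rho B L : R) (psi : R * R -> R) (f : R -> R).
Hypotheses (L0 : 0 <= L)
  (cpsi : {within [set x | sqn x <= rho], continuous psi})
  (psi_bd : forall x, sqn x = rho -> psi x = 0)
  (psi_pos : forall x, sqn x < rho -> 0 < psi x)
  (psi_le : forall x, sqn x <= rho -> psi x <= B)
  (psi_lapl : forall e x, unitv e -> sqn x < rho -> has_lapl e psi x (- f (psi x)))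
  (f_mono : forall s t : R, 0 <= s -> s <= t -> f s <= f t)
  (f_lip : forall s t : R, 0 <= s -> s <= t -> t <= B -> f t - f s <= L * (t - s)).
Implicit Types (e x : R * R).

Let psi_ge0 x : sqn x <= rho -> 0 <= psi x.
Proof.
by rewrite le_eqVlt => /orP[/eqP/psi_bd->//|/psi_pos/ltW].
Qed.

Section Direction.
Variable e : R * R.
Hypothesis eu : unitv e.

Let w m x := psi (reflect e m x) - psi x.

Let dotp_sqr_le x : dotp e x ^+ 2 <= sqn x.
Proof.
rewrite -subr_ge0 (_ : _ - _ = (e.1 * x.2 - e.2 * x.1) ^+ 2) ?sqr_ge0//.
rewrite /dotp /sqn.
transitivity ((e.1 ^+ 2 + e.2 ^+ 2) * (x.1 ^+ 2 + x.2 ^+ 2)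
  - (e.1 * x.1 + e.2 * x.2) ^+ 2); first by rewrite eu mul1r.
by ring.
Qed.

Let r := Num.sqrt rho.

Let dotp_le x : sqn x <= rho -> dotp e x <= r.
Proof.
move=> xr; apply: (le_trans (ler_norm _)).
rewrite -(@sqrtr_sqr _ (dotp e x)) ler_wsqrtr//.
exact: le_trans (dotp_sqr_le x) xr.
Qed.

Let reflect_le m x : 0 <= m -> m <= dotp e x -> sqn (reflect e m x) <= sqn x.
Proof.
by move=> m0 mx; rewrite sqn_reflect// gerBl !mulr_ge0// subr_ge0.
Qed.

Let reflect_dist m m' x y : `|reflect e m x - reflect e m' y| <= 5 * `|x - y| + 2 * `|m - m'|.
Proof.
have e1 : `|e.1| <= 1.
  rewrite -(@ler_pXn2r _ 2) ?nnegrE// real_normK ?num_real// expr1n -eu lerDl; exact: sqr_ge0.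
have e2 : `|e.2| <= 1.
  rewrite -(@ler_pXn2r _ 2) ?nnegrE// real_normK ?num_real// expr1n -eu lerDr; exact: sqr_ge0.
have x1 : `|x.1 - y.1| <= `|x - y| by rewrite [leRHS]/Num.norm /= le_max lexx.
have x2 : `|x.2 - y.2| <= `|x - y| by rewrite [leRHS]/Num.norm /= le_max lexx orbT.
set D := `|x - y| in x1 x2 *.
have dd : `|(dotp e x - m) - (dotp e y - m')| <= 2 * D + `|m - m'|.
  rewrite (_ : _ - _ = e.1 * (x.1 - y.1) + e.2 * (x.2 - y.2) - (m - m')); last first.
    by rewrite /dotp; ring.
  apply: le_trans (ler_normB _ _) _; rewrite lerD2r.
  apply: le_trans (ler_normD _ _) _; rewrite !normrM.
  have := ler_pM (normr_ge0 _) (normr_ge0 _) e1 x1.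
  have := ler_pM (normr_ge0 _) (normr_ge0 _) e2 x2.
  by rewrite !mul1r; lra.
have coord (c u v : R) : `|c| <= 1 -> `|u - v| <= D ->
    `|(u - 2 * (dotp e x - m) * c) - (v - 2 * (dotp e y - m') * c)| <= 5 * D + 2 * `|m - m'|.
  move=> c1 uv; rewrite (_ : _ - (_ - _) = (u - v)
    - 2 * (((dotp e x - m) - (dotp e y - m')) * c)); last by ring.
  apply: le_trans (ler_normB _ _) _; rewrite normrM (@ger0_norm _ 2)//.
  have : `|(dotp e x - m - (dotp e y - m')) * c| <= 2 * D + `|m - m'|.
    by rewrite normrM -[leRHS]mulr1 ler_pM.
  by lra.
by rewrite [leLHS]/Num.norm /= ge_max; apply/andP; split; apply: coord.
Qed.

Let w_within m b : 0 <= m -> {within strip rho m b e, continuous (w m)}.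
Proof.
move=> m0; apply/within_continuous_epsP => x [[/= xr mx] _] eps eps0.
have e20 : 0 < eps / 2 by rewrite divr_gt0.
move/within_continuous_epsP : cpsi => cp.
have [d1 d10 h1] := cp x xr _ e20.
have rr : sqn (reflect e m x) <= rho by exact: le_trans (reflect_le m0 mx) xr.
have [d2 d20 h2] := cp _ rr _ e20.
exists (Num.min d1 (d2 / 5)); first by rewrite lt_min d10 divr_gt0.
move=> y [[/= yr my] _]; rewrite lt_min => /andP[y1 y2].
have H1 := h1 y yr y1.
have H2 : `|psi (reflect e m y) - psi (reflect e m x)| < eps / 2.
  apply: h2; first exact: le_trans (reflect_le m0 my) yr.
  by apply: le_lt_trans (reflect_dist _ _ _ _) _; rewrite subrr normr0; lra.
rewrite /w (_ : _ - _ - (_ - _) = (psi (reflect e m y) - psi (reflect e m x))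
  - (psi y - psi x)); last by ring.
by apply: le_lt_trans (ler_normB _ _) _; lra.
Qed.

Let lapl_w m x : 0 <= m -> sqn x < rho -> m <= dotp e x ->
  has_lapl e (w m) x (- f (psi (reflect e m x)) + (-1) * (- f (psi x))).
Proof.
move=> m0 xr mx.
have -> : w m = (fun y => psi (reflect e m y) + (-1) * psi y).
  by apply/funext => y; rewrite mulN1r.
apply: has_lapl_add; last by apply: has_lapl_scale; exact: psi_lapl.
apply: has_lapl_reflect => //; apply: psi_lapl => //.
exact: le_lt_trans (reflect_le m0 mx) xr.
Qed.

(** Where [w m] is negative, [f_lip] gives [Delta w <= - L w]. On the circle [psi] vanishes and on
    the line of reflection [w] does, so only the far side of the strip needs a hypothesis. *)
Let narrow m b : 0 <= m -> m < b -> (b - m) ^+ 2 * L < 1 ->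
  (forall x, sqn x <= rho -> dotp e x = b -> 0 <= w m x) ->
  forall x, strip rho m b e x -> 0 <= w m x.
Proof.
move=> m0 mb small hb; apply: (@strip_max_principle _ e rho m b L) => //.
- exact: w_within.
- move=> x xr /andP[mx xb] wneg; exists (- f (psi (reflect e m x)) + (-1) * (- f (psi x))).
    by apply: lapl_w => //; exact: ltW.
  have rr : sqn (reflect e m x) <= rho.
    by apply: le_trans (reflect_le m0 (ltW mx)) _; exact: ltW.
  have := f_lip (psi_ge0 rr) _ (psi_le (ltW xr)).
  by move: wneg; rewrite /w => h H; have := H (ltW _); rewrite -subr_lt0 => /(_ h); lra.
- move=> x [[/= xr mx] xb] [xrho|[xm|xb']]; last exact: hb.
    rewrite /w (psi_bd xrho) subr0 psi_ge0//.
    exact: le_trans (reflect_le m0 mx) xr.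
  by rewrite /w reflect_fix// subrr.
Qed.

Let good m := forall x, sqn x <= rho -> m <= dotp e x -> 0 <= w m x.

Let good_closed m : 0 <= m -> (forall n, m < n -> n <= r -> good n) -> good m.
Proof.
move=> m0 hn x xr; rewrite le_eqVlt => /orP[/eqP mx|mx].
  by rewrite /w reflect_fix// subrr.
apply/ler_addgt0Pr => eps eps0.
have rr : sqn (reflect e m x) <= rho by exact: le_trans (reflect_le m0 (ltW mx)) xr.
move/within_continuous_epsP : cpsi => cp.
have [d d0 hd] := cp _ rr _ eps0.
(* The minimum keeps [x] beyond the line at [n]; the quarter of [d] absorbs the factor 2 of
   [reflect_dist]. *)
pose n := Num.min (dotp e x) (m + d / 4).
have mn : m < n by rewrite lt_min mx ltrDl divr_gt0.
have nx : n <= dotp e x by rewrite ge_min lexx.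
have nd : n <= m + d / 4 by rewrite ge_min lexx orbT.
have gn := hn n mn (le_trans nx (dotp_le xr)) x xr nx.
have rn : sqn (reflect e n x) <= rho.
  by apply: le_trans (reflect_le _ nx) xr; rewrite ltW// (le_lt_trans m0).
have := hd _ rn; rewrite /w in gn *.
have : `|reflect e n x - reflect e m x| < d.
  apply: le_lt_trans (reflect_dist _ _ _ _) _; rewrite subrr normr0 gtr0_norm ?subr_gt0//.
  lra.
by move=> /[swap] /[apply]; rewrite ltr_norml => /andP[_]; lra.
Qed.

(* The linear barrier [eps (x.e - m - d)] replaces Hopf's lemma. *)
Let good_open m : 0 < m -> m <= r -> good m ->
  exists2 m', 0 <= m' < m & forall n, m' <= n -> n <= m -> good n.
Proof.
move=> m0 mr gm.
have Lp : 0 < 1 + L by rewrite ltr_pwDl.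
(* Both [D] and [D * L] are at most 1/2, so strips of width at most [D] are narrow in the sense of
   [strip_max_principle]. The quarter [d] leaves room for two steps past [m] and one before it. *)
pose D := (2 * (1 + L))^-1; have D0 : 0 < D by rewrite invr_gt0 mulr_gt0.
have DL : D ^+ 2 * L < 1.
  have h1 : D * L <= 2^-1.
    rewrite /D invfM -mulrA -[leRHS]mulr1 ler_pM2l ?invr_gt0// ler_pdivrMl// mulr1.
    by rewrite lerDr.
  have h2 : D <= 2^-1.
    rewrite /D invfM -[leRHS]mulr1 ler_pM2l ?invr_gt0// invf_le1// lerDl//.
  rewrite expr2 -mulrA; have : D * (D * L) <= 2^-1 * 2^-1.
    by rewrite ler_pM ?mulr_ge0// ltW.
  by lra.
pose d := D / 4; have d0 : 0 < d by rewrite divr_gt0.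
(* By [sqn_reflect], the reflection of a boundary point with [x.e >= m + d] lies in this smaller
   closed disk, where [psi] is bounded below by a positive constant. *)
have [c c0 hc] : exists2 c, 0 < c & forall x, sqn x <= rho - 4 * m * d -> c <= psi x.
  pose K := [set x | sqn x <= rho - 4 * m * d].
  have Kr x : K x -> sqn x < rho.
    move=> /le_lt_trans; apply; rewrite ltrBlDr ltrDl; by rewrite !mulr_gt0.
  have cK : compact K := compact_sqn (@closed_sqn_le _ _) (fun x h => h).
  have [[z Kz]|nK] := pselect (K !=set0); last first.
    by exists 1 => // x xK; exfalso; apply: nK; exists x.
  have cpK : {within K, continuous psi}.
    by apply: continuous_subspaceW cpsi => x /Kr /ltW.
  have [y] := compact_EVT_min (ex_intro _ z Kz) cK cpK.
  rewrite inE => Ky hy; exists (psi y); first by apply: psi_pos; exact: Kr.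
  by move=> x Kx; apply: hy; rewrite inE.
have r0 : 0 < r by exact: lt_le_trans m0 mr.
pose eps := c / r; have eps0 : 0 < eps by rewrite divr_gt0.
(* As [m] is good and [f] nondecreasing, [w m] is superharmonic, so [L = 0] is allowed and the strip
   may be wide. On the circle [w m >= c >= eps (x.e)] by the choice [eps = c / r]; on the line at
   [m + d] the barrier is 0; the side at [r + 1] misses the disk. *)
have barrier x : sqn x <= rho -> m + d <= dotp e x -> eps * (dotp e x - (m + d)) <= w m x.
  move=> xr xm.
  pose v x := w m x + ((-eps) * dotp e x + eps * (m + d)).
  suff : 0 <= v x by rewrite /v; lra.
  have mdr : m + d < r + 1 by apply: le_lt_trans xm _; have := dotp_le xr; lra.
  apply: (@strip_max_principle _ e rho (m + d) (r + 1) 0 v) => //.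
  - by rewrite mulr0.
  - move=> y; apply: cvgD.
      have sub : strip rho (m + d) (r + 1) e `<=` strip rho m (r + 1) e.
        by move=> u [[/= u1 u2] u3]; split => //; split => //=; lra.
      have cw : {within strip rho (m + d) (r + 1) e, continuous (w m)}.
        by apply: (continuous_subspaceW sub); apply: w_within; exact: ltW.
      exact: cw.
    have cl : continuous (fun y => (-eps) * dotp e y + eps * (m + d)).
      by move=> u; apply: cvgD; [apply: cvgM; [exact: cvg_cst|exact: continuous_dotp]|exact: cvg_cst].
    exact: (@continuous_subspaceT _ _ (strip rho (m + d) (r + 1) e) _ cl).
  - move=> y yr /andP[ym yb] _.
    have my : m <= dotp e y by lra.
    exists ((- f (psi (reflect e m y)) + (-1) * (- f (psi y))) + ((- eps) * 0 + 0)).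
      apply: has_lapl_add; first by apply: lapl_w => //; exact: ltW.
      by apply: has_lapl_add; [apply: has_lapl_scale; exact: has_lapl_dotp|exact: has_lapl_cst].
    have : psi y <= psi (reflect e m y) by rewrite -subr_ge0; apply: gm => //; exact: ltW.
    by move=> /(f_mono (psi_ge0 (ltW yr))); lra.
  - move=> y [[/= yr ym] yb] yy.
    have my : m <= dotp e y by lra.
    case: yy => [yrho|[ymd|yr1]].
    + have : c <= psi (reflect e m y).
        apply: hc; rewrite sqn_reflect// yrho lerB// ler_pM2l ?mulr_gt0//; lra.
      rewrite /v /w (psi_bd yrho) => cle.
      have : eps * dotp e y <= c.
        by rewrite /eps mulrAC ler_pdivrMr// ler_pM2l// dotp_le.
      have : 0 < eps * (m + d) by rewrite mulr_gt0// addr_gt0.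
      by lra.
    + by rewrite /v ymd mulNr addNr addr0; exact: gm.
    + by have := dotp_le yr; lra.
  - by split; [split|] => //=; have := dotp_le xr; lra.
have ball_compact : compact [set x : R * R | sqn x <= rho].
  exact: compact_sqn (@closed_sqn_le _ _) (fun x h => h).
have [eta eta0 heta] := compact_uniform_eps ball_compact cpsi (mulr_gt0 eps0 d0).
(* A quarter of [eta] makes the two reflections [eta]-close, since [reflect_dist] doubles [m - n]; a
   quarter of [D] keeps the strip from [n] to [m + 2 d] no wider than [D]. *)
pose m' := Num.max 0 (m - Num.min (eta / 4) (D / 4)).
have mm : 0 < Num.min (eta / 4) (D / 4) by rewrite lt_min !divr_gt0.
exists m'; first by rewrite le_max lexx /= gt_max m0 gtrBl.
move=> n m'n nm.
have n0 : 0 <= n by apply: le_trans m'n; rewrite le_max lexx.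
have mn : m - n <= Num.min (eta / 4) (D / 4).
  by rewrite lerBlDr -lerBlDl; apply: le_trans m'n; rewrite le_max lexx orbT.
have mn1 : m - n <= eta / 4 by apply: le_trans mn _; rewrite ge_min lexx.
have mn2 : m - n <= D / 4 by apply: le_trans mn _; rewrite ge_min lexx orbT.
(* Beyond [m + 2 d] the barrier gives [w m >= eps d], and passing from [m] to [n] loses less than
   [eps d] by uniform continuity. The remaining strip is narrow. *)
have far x : sqn x <= rho -> m + 2 * d <= dotp e x -> 0 <= w n x.
  move=> xr xm.
  have mx : m <= dotp e x by lra.
  have nx : n <= dotp e x by lra.
  have rm : sqn (reflect e m x) <= rho by exact: le_trans (reflect_le (ltW m0) mx) xr.
  have rn : sqn (reflect e n x) <= rho by exact: le_trans (reflect_le n0 nx) xr.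
  have dist : `|reflect e n x - reflect e m x| < eta.
    apply: le_lt_trans (reflect_dist _ _ _ _) _; rewrite subrr normr0 distrC ger0_norm ?subr_ge0//.
    lra.
  have := heta _ _ rn rm dist; rewrite ltr_norml => /andP[h _].
  have md : m + d <= dotp e x by lra.
  have h2 := barrier x xr md.
  have : eps * d <= eps * (dotp e x - (m + d)) by rewrite ler_pM2l//; lra.
  by rewrite /w in h2 *; lra.
move=> x xr nx; have [xm|mx] := leP (dotp e x) (m + 2 * d); last by apply: far => //; exact: ltW.
have nb : n < m + 2 * d by lra.
apply: (@narrow n (m + 2 * d)) => //.
- apply: le_lt_trans DL; rewrite ler_wpM2r// ler_pXn2r ?nnegrE//; rewrite /d; lra.
- by move=> y yr yb; apply: far => //; rewrite yb.
Qed.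

(** Positions are lowered from [r], where the cap reduces to points of the line, to the infimum [m]
    of those above which all positions are good. That infimum is good by [good_closed], and
    [good_open] would push below it if it were positive. *)
Lemma moving_planes x : sqn x <= rho -> 0 <= dotp e x -> psi x <= psi (reflect e 0 x).
Proof.
move=> xr ex; have r0 : 0 <= r := sqrtr_ge0 _.
pose A := [set m | 0 <= m <= r /\ forall n, m <= n -> n <= r -> good n].
have Ar : A r.
  split; first by rewrite r0 lexx.
  move=> n rn nr; have -> : n = r by apply/eqP; rewrite eq_le nr.
  move=> y yr ry; rewrite /w reflect_fix ?subrr//.
  by apply/eqP; rewrite eq_le ry dotp_le.
have A0 : lbound A 0 by move=> m [/andP[]].
have hA : has_inf A by split; [exists r|exists 0].
set m := inf A; have m0 : 0 <= m by apply: lb_le_inf => //; exists r.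
have mr : m <= r by apply: ge_inf => //; exists 0.
have above n : m < n -> n <= r -> good n.
  move=> mn nr; have [m1 [_ hm1] m1n] := inf_lt (ex_intro _ r Ar) mn.
  by apply: hm1 => //; exact: ltW.
have gm : good m := good_closed m0 above.
have Am n : m <= n -> n <= r -> good n.
  by rewrite le_eqVlt => /orP[/eqP<-//|]; exact: above.
have mE : m = 0.
  apply/eqP; rewrite eq_le m0 andbT leNgt; apply/negP => mpos.
  have [m' /andP[m'0 m'm] hm'] := good_open mpos mr gm.
  have : A m'.
    split; first by rewrite m'0 (le_trans (ltW m'm)).
    move=> n m'n nr; have [nm|mn] := leP n m; first exact: hm'.
    exact: above.
  by move=> /(ge_inf (ex_intro _ 0 A0)); rewrite -/m leNgt m'm.
by have := gm x xr; rewrite mE => /(_ ex); rewrite /w subr_ge0.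
Qed.

End Direction.

(** Two distinct points at the same distance from the centre are exchanged by the reflection in
    their bisector, which passes through the centre and is normal to [u - v]. Exchanging their roles
    gives both inequalities. *)
Lemma radial_symmetry x y : sqn x <= rho -> sqn x = sqn y -> psi x = psi y.
Proof.
have half (u v : R * R) : sqn u <= rho -> sqn u = sqn v -> psi u <= psi v.
  move=> ur uv; have [->//|neq] := eqVneq u v.
  pose n2 := sqn (u - v).
  have n20 : 0 < n2.
    rewrite lt_neqAle sqn_ge0 andbT; apply: contra_neq neq => h.
    have : (u.1 - v.1) ^+ 2 + (u.2 - v.2) ^+ 2 = 0 by rewrite h.
    move=> /eqP; rewrite paddr_eq0 ?sqr_ge0// !sqrf_eq0 !subr_eq0 => /andP[/eqP h1 /eqP h2].
    by rewrite (surjective_pairing u) (surjective_pairing v) h1 h2.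
  pose s := Num.sqrt n2; have s0 : 0 < s by rewrite sqrtr_gt0.
  have s2 : s ^+ 2 = n2 by rewrite sqr_sqrtr// ltW.
  pose e := ((u.1 - v.1) / s, (u.2 - v.2) / s).
  have eu : unitv e.
    rewrite /unitv /e /= !expr_div_n -mulrDl s2.
    by rewrite -[X in X / _]/n2 mulfV// gt_eqF.
  have de : dotp e u = n2 / (2 * s).
    have -> : n2 = n2 + (sqn u - sqn v) by rewrite uv subrr addr0.
    by rewrite /dotp /e /n2 /sqn /=; field; rewrite gt_eqF.
  have -> : v = reflect e 0 u.
    rewrite /reflect subr0 de /e /=.
    have k (a b : R) : a - 2 * (n2 / (2 * s)) * ((a - b) / s) = b.
      have : n2 / s ^+ 2 = 1 by rewrite s2 mulfV// gt_eqF.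
      move=> h; rewrite (_ : 2 * _ * _ = (n2 / s ^+ 2) * (a - b)); last first.
        by field; rewrite gt_eqF.
      by rewrite h; ring.
    by rewrite !k; exact: surjective_pairing.
  by apply: moving_planes => //; rewrite de divr_ge0 ?mulr_ge0// ltW.
move=> xr xy; apply/eqP; rewrite eq_le half//= half//; rewrite -xy//.
Qed.

End GidasNiNirenberg.

(** * The disk of unit area and interior regularity *)

Section Disk.
Context {R : realType}.
Implicit Types (f g : R * R -> R) (x : R * R).

Lemma diskE : @disk R = sqball (pi^-1).
Proof.
apply/seteqP; split => x; rewrite /disk /sqball /= /eucl -/(sqn x) => h.
  rewrite -(@sqrtrV _ pi) ?pi_ge0// in h; rewrite -(@ltr_sqrt _ (sqn x)) ?invr_gt0 ?pi_gt0//.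
by rewrite -(@sqrtrV _ pi) ?pi_ge0// ltr_sqrt ?invr_gt0 ?pi_gt0.
Qed.

Lemma closure_sqball (rho : R) : 0 < rho ->
  closure (sqball rho) = [set x | sqn x <= rho].
Proof.
move=> rho0; apply/seteqP; split.
  rewrite [X in _ `<=` X]((closure_id _).1 (@closed_sqn_le R rho)).
  by apply: closureS => x /ltW.
move=> x /= xr B /nbhs_normP[d /= d0 hd].
have n0 : 0 < `|x| + 1 by rewrite ltr_wpDl.
pose s := Num.min (2^-1) (d / 2 / (`|x| + 1)).
have s0 : 0 < s by rewrite lt_min invr_gt0 ltr0n !divr_gt0.
have s1 : s <= 2^-1 by rewrite ge_min lexx.
have sd : s * (`|x| + 1) <= d / 2 by rewrite -ler_pdivlMr// ge_min lexx orbT.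
exists ((1 - s) * x.1, (1 - s) * x.2); split.
  rewrite /sqball /= /sqn /= !exprMn -mulrDr -/(sqn x).
  apply: (@le_lt_trans _ _ ((1 - s) ^+ 2 * rho)); first by rewrite ler_wpM2l ?sqr_ge0.
  rewrite gtr_pMl// expr2; have : (1 - s) * (1 - s) < 1 * 1 by apply: ltr_pM; lra.
  by rewrite mulr1.
apply: hd => /=; rewrite (_ : x - _ = s *: x); last first.
  by rewrite [LHS]surjective_pairing [RHS]surjective_pairing /=; congr pair;
    rewrite /GRing.scale /=; ring.
rewrite normrZ gtr0_norm//; apply: (@le_lt_trans _ _ (s * (`|x| + 1))); last lra.
by rewrite ler_pM2l// lerDl.
Qed.

Lemma piV_gt0 : 0 < (pi : R)^-1.
Proof. by rewrite invr_gt0 pi_gt0. Qed.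

Lemma closure_diskE : closure (@disk R) = [set x | sqn x <= pi^-1].
Proof. by rewrite diskE closure_sqball// piV_gt0. Qed.

Lemma disk_bdE : @disk_bd R = [set x | sqn x = pi^-1].
Proof.
rewrite /disk_bd closure_diskE diskE; apply/seteqP; split => x /=.
  by move=> [h /negP]; rewrite -leNgt => h'; apply/eqP; rewrite eq_le h.
by move=> h; rewrite /sqball /= h lexx ltxx.
Qed.

Lemma extends_cont_continuous (rho : R) g x : sqn x < rho ->
  extends_cont (sqball rho) g -> {for x, continuous g}.
Proof.
move=> xr [G [cG eG]].
have cx : closure (sqball rho) x by apply: subset_closure.
have [d d0 hd] := continuous_lt_near (@continuous_sqn R x) xr.
apply/cvgrPdist_lt => eps eps0.
have [d2 d20 h2] := (within_continuous_epsP _ _).1 cG x cx eps eps0.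
suff : \forall y \near x, `|g x - g y| < eps by [].
apply/nbhs_normP; exists (Num.min d d2); first by rewrite /= lt_min d0.
move=> y /=; rewrite lt_min distrC => /andP[yx yx2].
have yr : sqball rho y.
  apply: hd; apply: le_lt_trans yx; rewrite [leRHS]/Num.norm /= le_max lexx ?orbT//.
by rewrite distrC -(eG y yr) -(eG x xr) h2//; exact: subset_closure.
Qed.

Lemma C2r_has_lapl (r : R) f e x : C2r r disk f -> unitv e -> disk x ->
  has_lapl e f x (laplacian f x).
Proof.
rewrite diskE => -[_ d1 _ d2 c2] eu xr.
have [d d0 hd] := continuous_lt_near (@continuous_sqn R x) xr.
apply: (@has_lapl_C2 _ e f x d) => //.
- by move=> i y [y1 y2]; apply: d1; exact: hd.
- by move=> i j y [y1 y2]; apply: d2; exact: hd.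
- by move=> i j; apply: (extends_cont_continuous xr); case: (c2 i j).
Qed.

End Disk.

(** * The ordinary differential equation of a radial solution *)

Section RadialODE.
Context {R : realType}.

Lemma isd_unique (f : R -> R) (x a b : R) :
  is_derive x 1 f a -> is_derive x 1 f b -> a = b.
Proof. by move=> [_ <-] [_ <-]. Qed.

(* In the energy [d ^+ 2 + d1 ^+ 2] of the difference of two solutions the singular
   term [u1 / s] has the good sign. *)
Lemma radial_ode_unique (S c : R) (u u1 u2 v v1 v2 F : R -> R) :
  (forall s, 0 < s < S -> is_derive s 1 u (u1 s)) ->
  (forall s, 0 < s < S -> is_derive s 1 u1 (u2 s)) ->
  (forall s, 0 < s < S -> is_derive s 1 v (v1 s)) ->
  (forall s, 0 < s < S -> is_derive s 1 v1 (v2 s)) ->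
  (forall s, 0 <= s < S -> [/\ {for s, continuous u}, {for s, continuous u1},
     {for s, continuous v} & {for s, continuous v1}]) ->
  (forall s, 0 < s < S -> u2 s = - (u1 s / s) - F (u s)) ->
  (forall s, 0 < s < S -> v2 s = - (v1 s / s) - F (v s)) ->
  (forall s, 0 < s < S -> `|F (u s) - F (v s)| <= c * `|u s - v s|) ->
  u 0 = v 0 -> u1 0 = v1 0 -> forall s, 0 <= s < S -> u s = v s.
Proof.
move=> du du1 dv dv1 cuv eu ev lip e0 e1 s /andP[s0 sS].
pose d t := u t - v t; pose d1 t := u1 t - v1 t.
(* The 1 absorbs [2 d d1] and [|c|] absorbs the difference of the nonlinear terms, both through
   [2 x y <= x^2 + y^2]; the weighted energy [G] is then nonincreasing. *)
pose b : R := 1 + `|c|.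
pose G t := (d t ^+ 2 + d1 t ^+ 2) * expR (- b * t).
pose dG t := (2 * d t * d1 t + 2 * d1 t * (u2 t - v2 t)
   - b * (d t ^+ 2 + d1 t ^+ 2)) * expR (- b * t).
have hG : - G 0 <= - G s.
  apply: (@deriv_ge0_le _ (fun t => - G t) (fun t => - dG t)) => //.
  - move=> t /andP[t0 ts]; have tS : 0 < t < S by rewrite t0 (lt_trans ts).
    have := du t tS; have := du1 t tS; have := dv t tS; have := dv1 t tS => h1 h2 h3 h4.
    by rewrite /G /d /d1; derive_tac; rewrite /dG /d /d1; ring.
  - apply: continuous_in_subspaceT => t; rewrite inE /= in_itv /= => /andP[t0 ts].
    have tS : 0 <= t < S by rewrite t0 (le_lt_trans ts).
    have [cu cu1 cv cv1] := cuv t tS.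
    apply: cvgN; apply: cvgM; last first.
      have [k hk] : exists k, is_derive t 1 (fun t => expR (- b * t)) k.
        by eexists; derive_rec.
      exact: isd_continuous hk.
    by apply: cvgD; apply: cvgM; apply: cvgB.
  - move=> t /andP[t0 ts]; have tS : 0 < t < S by rewrite t0 (lt_trans ts).
    rewrite oppr_ge0 /dG pmulr_lle0 ?expR_gt0// eu// ev//.
    have h := lip t tS; set D := F _ - F _ in h.
    have -> : 2 * d1 t * (- (u1 t / t) - F (u t) - (- (v1 t / t) - F (v t)))
        = - 2 * (d1 t ^+ 2 / t) - 2 * d1 t * D.
      by rewrite /d1 /D; field; rewrite gt_eqF.
    have h1 : 0 <= d1 t ^+ 2 / t by rewrite divr_ge0 ?sqr_ge0// ltW.
    have h2 : 2 * d t * d1 t <= d t ^+ 2 + d1 t ^+ 2 by have := sqr_ge0 (d t - d1 t); lra.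
    have h3 : - (2 * d1 t * D) <= `|c| * (d t ^+ 2 + d1 t ^+ 2).
      apply: le_trans (ler_norm _) _; rewrite normrN normrM normrM (@ger0_norm _ 2)//.
      apply: (@le_trans _ _ (2 * `|d1 t| * (`|c| * `|d t|))).
        rewrite ler_wpM2l ?mulr_ge0//; apply: le_trans h _.
        by rewrite ler_wpM2r// ler_norm.
      have -> : 2 * `|d1 t| * (`|c| * `|d t|) = `|c| * (2 * (`|d1 t| * `|d t|)) by ring.
      rewrite ler_wpM2l//; have := normM_le_sqr (d1 t) (d t); lra.
    rewrite /b; lra.
have G0 : G 0 = 0 by rewrite /G /d /d1 e0 e1 !subrr expr0n /= addr0 mul0r.
have : (d s ^+ 2 + d1 s ^+ 2) * expR (- b * s) <= 0 by move: hG; rewrite G0; rewrite /G; lra.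
rewrite pmulr_lle0 ?expR_gt0// => h.
have /eqP : d s ^+ 2 = 0.
  by apply/eqP; rewrite eq_le sqr_ge0 andbT; have := sqr_ge0 (d1 s); lra.
by rewrite sqrf_eq0 subr_eq0 => /eqP.
Qed.

(** Radiality gives [psi (s, y) = phi (N y)] with [N y] the distance to the centre, whence the
    vertical derivative is [y phi' (N y) / N y]; its derivative at [y = 0] is the first-order term
    of the radial Laplacian. *)
Lemma radial_transverse (rho s : R) (psi : R * R -> R) :
  0 < s -> s ^+ 2 < rho ->
  (forall x y : R * R, sqn x < rho -> sqn x = sqn y -> psi x = psi y) ->
  (forall i x, sqn x < rho -> derivable psi x (dir i)) ->
  (forall i j x, sqn x < rho -> derivable (pd j psi) x (dir i)) ->
  pd (lift ord0 ord0) (pd (lift ord0 ord0) psi) (s, 0) = pd ord0 psi (s, 0) / s.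
Proof.
move=> s0 sr rad d1 d2.
pose N y := Num.sqrt (s ^+ 2 + y ^+ 2).
have N2 (y : R) : N y ^+ 2 = s ^+ 2 + y ^+ 2 by rewrite sqr_sqrtr// addr_ge0 ?sqr_ge0.
have Ngt (y : R) : 0 < N y by rewrite sqrtr_gt0 ltr_wpDr ?sqr_ge0// exprn_gt0.
have dN (y : R) : is_derive y 1 N (y / N y).
  have h : 0 < s ^+ 2 + y ^+ 2 by rewrite ltr_wpDr ?sqr_ge0// exprn_gt0.
  notypeclasses refine (isd_eq (@isd_comp _ (fun y => s ^+ 2 + y ^+ 2) Num.sqrt y _ _ _ (is_derive1_sqrt h)) _).
    by derive_rec.
  by rewrite /= -/(N y); field; rewrite gt_eqF.
pose phi1 t := pd ord0 psi (t, 0).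
have sq0 (t : R) : sqn (t, 0) = t ^+ 2 by rewrite /sqn /= expr0n /= addr0.
have dphi (t : R) : t ^+ 2 < rho -> is_derive t 1 (fun t => psi (t, 0)) (phi1 t).
  by move=> tr; apply/is_derive_dir0/derivableP; apply: d1; rewrite sq0.
have near_in (y : R) : s ^+ 2 + y ^+ 2 < rho -> \forall z \near y, s ^+ 2 + z ^+ 2 < rho.
  move=> yr; have c : {for y, continuous (fun y : R => s ^+ 2 + y ^+ 2)}.
    have [k hk] : exists k, is_derive y 1 (fun y => s ^+ 2 + y ^+ 2) k.
      by eexists; derive_rec.
    exact: isd_continuous hk.
  move/continuous_at_epsP : c => /(_ (rho - (s ^+ 2 + y ^+ 2))).
  rewrite subr_gt0 => /(_ yr)[d d0 hd].
  apply/nbhs_normP; exists d => // z /=; rewrite distrC => /hd.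
  by rewrite ltr_norml => /andP[_]; lra.
have hpd (y : R) : s ^+ 2 + y ^+ 2 < rho ->
    pd (lift ord0 ord0) psi (s, y) = y * (phi1 (N y) / N y).
  move=> yr; have xr : sqn (s, y) < rho by [].
  have h1 : is_derive y 1 (fun y => psi (s, y)) (pd (lift ord0 ord0) psi (s, y)).
    by apply/is_derive_dir1/derivableP; exact: d1.
  have h2 : is_derive y 1 (fun y => psi (N y, 0)) (phi1 (N y) * (y / N y)).
    have k : N y ^+ 2 < rho by rewrite N2.
    exact: (isd_comp (dN y) (dphi _ k)).
  have h3 : is_derive y 1 (fun y => psi (s, y)) (phi1 (N y) * (y / N y)).
    apply: near_eq_is_derive h2; near=> z.
    apply: esym; apply: rad.
    - by rewrite /sqn /=; near: z; exact: near_in.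
    - by rewrite sq0 N2.
  by rewrite (isd_unique h1 h3) mulrCA.
have N0 : N 0 = s by rewrite /N expr0n /= addr0 sqrtr_sqr gtr0_norm.
have r0 : s ^+ 2 + 0 ^+ 2 < rho by rewrite expr0n /= addr0.
have h1 : is_derive (0 : R) 1 (fun y => pd (lift ord0 ord0) psi (s, y))
    (pd (lift ord0 ord0) (pd (lift ord0 ord0) psi) (s, 0)).
  by apply/is_derive_dir1/derivableP; apply: d2.
have [k hphi1] : exists k, is_derive (N 0) 1 phi1 k.
  exists (pd ord0 (pd ord0 psi) (s, 0)); rewrite N0.
  have h : derivable (pd ord0 psi) (s, 0) (dir ord0) by apply: d2; rewrite sq0.
  exact: (is_derive_dir0 (pd ord0 psi) s 0 _).1 (derivableP h).
have h2 : is_derive (0 : R) 1 (fun y => y * (phi1 (N y) / N y)) (phi1 s / s).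
  have h3 := isd_comp (dN 0) hphi1; have h4 := dN 0.
  derive_tac; first by rewrite gt_eqF.
  by rewrite N0 mul0r add0r mulr1.
have h3 : is_derive (0 : R) 1 (fun y => pd (lift ord0 ord0) psi (s, y)) (phi1 s / s).
  apply: near_eq_is_derive h2; near=> z; apply: esym; apply: hpd.
  by near: z; exact: near_in.
exact: isd_unique h1 h3.
Unshelve. all: by end_near. Qed.

Lemma radial_axis (rho : R) (psi : R * R -> R) (f : R * R -> R) :
  (forall x y : R * R, sqn x < rho -> sqn x = sqn y -> psi x = psi y) ->
  (forall i x, sqn x < rho -> derivable psi x (dir i)) ->
  (forall i j x, sqn x < rho -> derivable (pd j psi) x (dir i)) ->
  (forall x, sqn x < rho -> - laplacian psi x = f x) ->
  [/\ forall s, s ^+ 2 < rho -> is_derive s 1 (fun s => psi (s, 0)) (pd ord0 psi (s, 0)),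
      forall s, s ^+ 2 < rho ->
        is_derive s 1 (fun s => pd ord0 psi (s, 0)) (pd ord0 (pd ord0 psi) (s, 0)),
      forall s, 0 < s -> s ^+ 2 < rho ->
        pd ord0 (pd ord0 psi) (s, 0) = - (pd ord0 psi (s, 0) / s) - f (s, 0)
    & 0 < rho -> pd ord0 psi (0, 0) = 0].
Proof.
move=> rad d1 d2 lap.
have sq0 (t : R) : sqn (t, 0) = t ^+ 2 by rewrite /sqn /= expr0n /= addr0.
have dpsi (s : R) : s ^+ 2 < rho ->
    is_derive s 1 (fun s => psi (s, 0)) (pd ord0 psi (s, 0)).
  by move=> sr; apply/is_derive_dir0/derivableP; apply: d1; rewrite sq0.
split; first exact: dpsi.
- by move=> s sr; apply/is_derive_dir0/derivableP; apply: d2; rewrite sq0.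
- move=> s s0 sr; have := lap (s, 0); rewrite sq0 => /(_ sr) <-.
  rewrite laplacianE (radial_transverse s0 sr rad d1 d2).
  have arith (a b : R) : a = - b - - (a + b) by ring.
  exact: arith.
- move=> rho0; have h0 : is_derive (0 : R) 1 (fun s => psi (s, 0)) (pd ord0 psi (0, 0)).
    by apply: dpsi; rewrite expr0n.
  have h1 : is_derive (0 : R) 1 (fun s => psi (- s, 0)) (pd ord0 psi (0, 0) * (-1)).
    have h : is_derive (- (0 : R)) 1 (fun s => psi (s, 0)) (pd ord0 psi (0, 0)) by rewrite oppr0.
    exact: (isd_comp (isd_opp_id 0 1) h).
  have h2 : is_derive (0 : R) 1 (fun s => psi (s, 0)) (pd ord0 psi (0, 0) * (-1)).
    apply: near_eq_is_derive h1; near=> s; apply: rad; rewrite !sq0 ?sqrrN//.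
    near: s; have c : {for 0, continuous (fun s : R => s ^+ 2)}.
      have [k hk] : exists k, is_derive (0 : R) 1 (fun s => s ^+ 2) k.
        by eexists; derive_rec.
      exact: isd_continuous hk.
    move/continuous_at_epsP : c => /(_ rho rho0)[d d0 hd].
    apply/nbhs_normP; exists d => // z /=; rewrite distrC => /hd.
    by rewrite expr0n /= subr0 ltr_norml => /andP[].
  have arith (a : R) : a = a * -1 -> a = 0 by move=> ?; lra.
  exact: arith (isd_unique h0 h2).
Unshelve. all: by end_near. Qed.

End RadialODE.

(** * Identification of the solutions *)

Section Identification.
Context {R : realType}.
Variables (p : R) (q qd : R -> R).
Hypotheses (p1 : 1 <= p) (hq : profile p q qd).

Let Q (t : R) := ppow p (q t).
Let k (t : R) := - (Q t / 4) - qd t.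
Let p0 : 0 < p. Proof. exact: lt_le_trans ltr01 p1. Qed.

(** This is the quotient [N / t], in a form that makes sense at 0. *)
Definition slope (t : R) : R := - 4 * qd t.

Definition lamT (t : R) : R := pi * t * slope t `^ (1 - p^-1).

Definition alphaT (t : R) : R := q t * slope t `^ (- p^-1).

(* The first branch is the limit of the second one as [t] tends to 0. *)
Definition psiT (t : R) (x : R * R) : R :=
  if t == 0 then (pi^-1 - sqn x) / 4
  else (q (t * pi * sqn x) - q t) / (pi * (t * slope t)).

Lemma slope_gt0 (t : R) : 0 <= t -> 0 < slope t.
Proof.
by move=> t0; have := profile_slope_lt0 p1 hq t0; rewrite /slope; lra.
Qed.

Lemma ppow_scale (M u : R) : 0 <= M -> ppow p (M * u) = M `^ p * ppow p u.
Proof.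
move=> M0; have [u0|/ltW u0] := leP 0 u.
  by rewrite !ppow_pos ?mulr_ge0// powRM.
rewrite (ppow_neg p1 u0) (ppow_neg p1) ?mulr0//.
by rewrite mulr_ge0_le0.
Qed.

Let sq0 (t : R) : sqn (t, 0) = t ^+ 2.
Proof. by rewrite /sqn /= expr0n /= addr0. Qed.

Lemma sqn_sqrt_point (x : R * R) : sqn (Num.sqrt (sqn x), 0) = sqn x.
Proof. by rewrite sq0 sqr_sqrtr// sqn_ge0. Qed.

Let comp_sqr_derive (g : R -> R) (kap s dg : R) : is_derive (kap * s ^+ 2) 1 g dg ->
  is_derive s 1 (fun s => g (kap * s ^+ 2)) (2 * kap * s * dg).
Proof.
move=> h; have hs : is_derive s 1 (fun s => kap * s ^+ 2) (2 * kap * s).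
  by derive_tac; ring.
by apply: isd_eq (isd_comp hs h) _; ring.
Qed.

(** The choice [kap = lam M^(p - 1)] balances the powers of [M]: the scaled profile satisfies
    [- Delta v = kap M q^p = lam (M q)^p]. *)
Lemma profile_radial_eq (lam M : R) : 0 < lam -> 0 < M ->
  let kap := lam * M `^ (p - 1) in
  let v s := M * q (kap * s ^+ 2) in
  let v1 s := 2 * kap * M * (s * qd (kap * s ^+ 2)) in
  let v2 s := 2 * kap * M * (qd (kap * s ^+ 2) + 2 * k (kap * s ^+ 2)) in
  [/\ forall s : R, is_derive s 1 v (v1 s),
      forall s : R, 0 < s -> is_derive s 1 v1 (v2 s),
      continuous v1
    & forall s : R, 0 < s -> v2 s = - (v1 s / s) - lam * ppow p (v s)].
Proof.
move=> lam0 M0 kap v v1 v2.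
have kap0 : 0 < kap by rewrite mulr_gt0// powR_gt0.
have ks (s : R) : 0 <= kap * s ^+ 2 by rewrite mulr_ge0 ?sqr_ge0// ltW.
have ks0 (s : R) : 0 < s -> 0 < kap * s ^+ 2 by move=> s0; rewrite mulr_gt0// exprn_gt0.
split.
- move=> s; have h := comp_sqr_derive (profile_derive hq (ks s)).
  by rewrite /v; derive_tac; rewrite /v1; ring.
- move=> s s0; have h := comp_sqr_derive (profile_slope_derive hq (ks0 s s0)).
  rewrite /v1; derive_tac; rewrite /v2 -/(Q _) -/(k _); field.
  by rewrite !gt_eqF.
- have [_ _ _ cqd] := hq.
  move=> s; apply: cvgM; first exact: cvg_cst.
  apply: cvgM; first exact: cvg_id.
  apply: (@continuous_comp _ _ _ (fun s : R => kap * s ^+ 2) qd); last exact: cqd.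
  have [d hd] : exists d, is_derive s 1 (fun s => kap * s ^+ 2) d by eexists; derive_rec.
  exact: isd_continuous hd.
- move=> s s0; rewrite /v ppow_scale ?ltW// -(mulr_powRB1 (ltW M0) p0).
  by rewrite /v2 /v1 /k /Q /kap; field; rewrite gt_eqF.
Qed.

Section Solution.
Variables (r lam alpha : R) (psi : R * R -> R).
Hypotheses (sol : solution p r lam alpha psi) (lam_ge0 : 0 <= lam).

Let rho : R := pi^-1.
Let rho0 : 0 < rho. Proof. exact: piV_gt0. Qed.

Let cpsi : {within [set x | sqn x <= rho], continuous psi}.
Proof. by case: sol => -[[h _ _ _ _] _ _] _ _ _; rewrite -closure_diskE. Qed.

Let psi_bd x : sqn x = rho -> psi x = 0.
Proof. by case: sol => -[_ h _] _ _ _ xr; apply: h; rewrite disk_bdE. Qed.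

Let psi_pos x : sqn x < rho -> 0 < psi x.
Proof. by case: sol => -[_ _ h] _ _ _ xr; apply: h; rewrite diskE. Qed.

Let alpha_ge0 : 0 <= alpha. Proof. by case: sol. Qed.

Let psi_ge0 x : sqn x <= rho -> 0 <= psi x.
Proof. by rewrite le_eqVlt => /orP[/eqP/psi_bd->//|/psi_pos/ltW]. Qed.

Let base_ge0 x : sqn x <= rho -> 0 <= alpha + lam * psi x.
Proof. by move=> xr; rewrite addr_ge0// mulr_ge0// psi_ge0. Qed.

Let eqn x : sqn x < rho -> - laplacian psi x = ppow p (alpha + lam * psi x).
Proof.
by case: sol => _ h _ _ xr; rewrite ppow_pos ?base_ge0 ?(ltW xr)//; apply: h; rewrite diskE.
Qed.

Let psi_lapl e x : unitv e -> sqn x < rho ->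
  has_lapl e psi x (- ppow p (alpha + lam * psi x)).
Proof.
move=> eu xr; rewrite -eqn// opprK; case: sol => -[C _ _] _ _ _.
by apply: C2r_has_lapl eu _; [exact: C|rewrite diskE].
Qed.

Let bounded : exists B, forall x, sqn x <= rho -> psi x <= B.
Proof.
have K : compact [set x : R * R | sqn x <= rho].
  exact: compact_sqn (@closed_sqn_le _ _) (fun x h => h).
have ne : [set x : R * R | sqn x <= rho] !=set0.
  by exists (0, 0); rewrite /= sq0 expr0n /= ltW.
have [z _ hz] := compact_EVT_max ne K cpsi.
by exists (psi z) => x xr; apply: hz; rewrite inE.
Qed.

Let radial : forall x y : R * R, sqn x <= rho -> sqn x = sqn y -> psi x = psi y.
Proof.
have [B hB] := bounded.
have B0 : 0 <= B.
  apply: le_trans (hB (0, 0) _); first by apply: psi_ge0; rewrite sq0 expr0n /= ltW.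
  by rewrite sq0 expr0n /= ltW.
have bB0 : 0 <= alpha + lam * B by rewrite addr_ge0// mulr_ge0.
apply: (@radial_symmetry _ rho B (p * (alpha + lam * B) `^ (p - 1) * lam) psi
  (fun s => ppow p (alpha + lam * s))) => //.
- by rewrite !mulr_ge0 ?powR_ge0// ltW.
- by move=> s t s0 st; rewrite ppow_le// lerD2l ler_wpM2l.
- move=> s t s0 st tB; apply: (le_trans (ler_norm _)).
  apply: le_trans (ppow_lipschitz p1 bB0 _ _) _.
  + by rewrite lerD2l ler_wpM2l.
  + by rewrite lerD2l ler_wpM2l// (le_trans st).
  have -> : alpha + lam * t - (alpha + lam * s) = lam * (t - s) by ring.
  by rewrite normrM (ger0_norm lam_ge0) ger0_norm ?subr_ge0// mulrA.
Qed.

Let axis := @radial_axis _ rho psi (fun x => ppow p (alpha + lam * psi x)).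

(** Along the axis, [alpha + lam psi] and the scaled profile with the same central value solve the
    same singular equation with zero slope at 0, so they coincide; radial symmetry carries this to
    the disk. *)
Lemma solution_axis : 0 < lam -> exists2 M, 0 < M &
  forall x, sqn x <= rho -> alpha + lam * psi x = M * q (lam * M `^ (p - 1) * sqn x).
Proof.
move=> lam0; have [B hB] := bounded.
have r0 : sqn (0 : R, 0 : R) < rho by rewrite sq0 expr0n.
pose M := alpha + lam * psi (0, 0).
have M0 : 0 < M by rewrite ltr_wpDl// mulr_gt0// psi_pos.
have [dv dv1 cv1 ev] := profile_radial_eq lam0 M0.
set kap := lam * _ in dv dv1 cv1 ev *.
pose v (s : R) := M * q (kap * s ^+ 2).
pose v1 (s : R) := 2 * kap * M * (s * qd (kap * s ^+ 2)).
have radial' (x y : R * R) : sqn x < rho -> sqn x = sqn y -> psi x = psi y.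
  by move=> /ltW; exact: radial.
have d1 i x : sqn x < rho -> derivable psi x (dir i).
  by case: sol => -[[_ h _ _ _] _ _] _ _ _ xr; apply: h; rewrite diskE.
have d2 i j x : sqn x < rho -> derivable (pd j psi) x (dir i).
  by case: sol => -[[_ _ _ h _] _ _] _ _ _ xr; apply: h; rewrite diskE.
have [a1 a2 a3 a4] := axis radial' d1 d2 eqn.
pose u (s : R) := alpha + lam * psi (s, 0).
pose phi1 (s : R) := pd ord0 psi (s, 0).
pose u1 (s : R) := lam * phi1 s.
have du (s : R) : s ^+ 2 < rho -> is_derive s 1 u (u1 s).
  move=> sr; have h : is_derive s 1 (fun s => psi (s, 0)) (phi1 s) by exact: a1.
  by rewrite /u; derive_tac; rewrite /u1; ring.
pose phi2 (s : R) := pd ord0 (pd ord0 psi) (s, 0).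
have du1 (s : R) : s ^+ 2 < rho -> is_derive s 1 u1 (lam * phi2 s).
  move=> sr; have h : is_derive s 1 phi1 (phi2 s) by exact: a2.
  by rewrite /u1; derive_tac; ring.
pose S := Num.sqrt rho.
have S2 (s : R) : 0 <= s < S -> s ^+ 2 < rho.
  by move=> /andP[s0 sS]; rewrite sqr_lt_sqrt ger0_norm.
have S2' (s : R) : 0 < s < S -> s ^+ 2 < rho.
  by move=> /andP[s0 sS]; apply: S2; rewrite ltW.
have Mq (s : R) : v s <= M.
  rewrite /v -[leRHS]mulr1 ler_pM2l// (profile_le1 hq)//.
  by rewrite mulr_ge0 ?sqr_ge0// mulr_ge0 ?powR_ge0.
have uB (x : R * R) : sqn x <= rho -> alpha + lam * psi x <= alpha + lam * B.
  by move=> /hB h; rewrite lerD2l ler_wpM2l.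
have MB : M <= alpha + lam * B by apply: uB; exact: ltW.
pose u2 (s : R) := lam * phi2 s.
pose v2 (s : R) := 2 * kap * M * (qd (kap * s ^+ 2) + 2 * k (kap * s ^+ 2)).
pose F (t : R) := lam * ppow p t.
have hA (s : R) : 0 < s < S -> is_derive s 1 u (u1 s) by move=> /S2' /du.
have hB' (s : R) : 0 < s < S -> is_derive s 1 u1 (u2 s) by move=> /S2' /du1.
have hC (s : R) : 0 < s < S -> is_derive s 1 v (v1 s) by move=> _; exact: dv.
have hD (s : R) : 0 < s < S -> is_derive s 1 v1 (v2 s).
  by move=> /andP[s0 _]; exact: dv1.
have hE (s : R) : 0 <= s < S -> [/\ {for s, continuous u}, {for s, continuous u1},
    {for s, continuous v} & {for s, continuous v1}].
  move=> sS; split.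
  - exact: isd_continuous (du s (S2 s sS)).
  - exact: isd_continuous (du1 s (S2 s sS)).
  - exact: isd_continuous (dv s).
  - exact: cv1.
have hF (s : R) : 0 < s < S -> u2 s = - (u1 s / s) - F (u s).
  move=> sS; have s0 : 0 < s by case/andP: sS.
  have := a3 s s0 (S2' s sS); rewrite -/(phi2 s) -/(phi1 s) => h.
  rewrite /u2 h /u1 /F -/(u s); move: (phi1 s) (ppow p (u s)) => a b.
  by ring.
have hG (s : R) : 0 < s < S -> v2 s = - (v1 s / s) - F (v s).
  by move=> /andP[s0 _]; exact: ev.
have hH (s : R) : 0 < s < S ->
    `|F (u s) - F (v s)| <= lam * (p * (alpha + lam * B) `^ (p - 1)) * `|u s - v s|.
  move=> sS; rewrite /F -mulrBr normrM (gtr0_norm lam0) -mulrA ler_pM2l//.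
  apply: ppow_lipschitz => //.
  - exact: le_trans (ltW M0) MB.
  - by apply: uB; rewrite sq0 ltW// S2'.
  - exact: le_trans (Mq s) MB.
have hI : u 0 = v 0 by rewrite /u /v expr0n /= mulr0 (profile0 hq) mulr1.
have hJ : u1 0 = v1 0 by rewrite /u1 /phi1 a4// /v1 mul0r !mulr0.
have uv := radial_ode_unique hA hB' hC hD hE hF hG hH hI hJ.
have S0 : 0 < S by rewrite sqrtr_gt0.
have cont (s : R) : 0 <= s <= S -> sqn (s, 0) <= rho.
  move=> /andP[s0 sS]; rewrite sq0 -(sqr_sqrtr (ltW rho0)).
  by rewrite ler_pXn2r ?nnegrE ?sqrtr_ge0.
(* Uniqueness holds for [s < S] only. The difference is continuous up to the boundary with zero
   derivative inside, which adds the endpoint. *)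
have uvS : u 0 - v 0 = u S - v S.
  apply: (@deriv0_cst _ (fun s => u s - v s)); first exact: ltW.
  - move=> s sS; have sr := S2' s sS.
    have h1 := du s sr; have h2 := dv s.
    have e1 : is_derive s 1 (fun s => u s - v s) (u1 s - v1 s) by derive_tac.
    have e2 : is_derive s 1 (fun s => u s - v s) 0.
      apply: near_eq_is_derive (isd_cst 0 s 1); near=> t.
      suff tS : 0 <= t < S by rewrite /= (uv t tS) subrr.
      near: t; case/andP: sS => s0 sS; exists (Num.min s (S - s)) => /=.
        by rewrite lt_min s0 subr_gt0.
      move=> t /=; rewrite lt_min !ltr_norml => /andP[/andP[? ?] /andP[? ?]].
      by apply/andP; split; lra.
    exact: e2.
  - apply/within_continuous_epsP => s /=; rewrite in_itv /= => sS eps eps0.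
    have e20 : 0 < eps / 2 / lam by rewrite !divr_gt0.
    have e2 : 0 < eps / 2 by rewrite divr_gt0.
    have [b1 b10 h1] := (within_continuous_epsP _ _).1 cpsi _ (cont s sS) _ e20.
    have /continuous_at_epsP/(_ _ e2)[b2 b20 h2] := isd_continuous (dv s).
    exists (Num.min b1 b2); first by rewrite lt_min b10.
    move=> t; rewrite in_itv /= lt_min => tS /andP[t1 t2].
    have H1 : `|psi (t, 0) - psi (s, 0)| < eps / 2 / lam.
      apply: h1; first exact: cont.
      have -> : ((t, 0) - (s, 0) : R * R) = (t - s, 0) by rewrite [LHS]surjective_pairing /= subrr.
      by rewrite [X in X < _]/Num.norm /= gt_max t1 normr0 b10.
    have H2 := h2 t t2.
    have H3 : `|lam * (psi (t, 0) - psi (s, 0))| < eps / 2.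
      by rewrite normrM gtr0_norm// mulrC -ltr_pdivlMr.
    rewrite (_ : u t - v t - (u s - v s) = lam * (psi (t, 0) - psi (s, 0)) - (v t - v s)).
      by apply: le_lt_trans (ler_normB _ _) _; move: H2 H3; rewrite /v; lra.
    by rewrite /u; ring.
exists M => // x xr.
have -> : psi x = psi (Num.sqrt (sqn x), 0) by apply: radial => //; rewrite sqn_sqrt_point.
have -> : sqn x = (Num.sqrt (sqn x)) ^+ 2 by rewrite sqr_sqrtr ?sqn_ge0.
have s0 : 0 <= Num.sqrt (sqn x) := sqrtr_ge0 _.
rewrite (sqrtr_sqr (Num.sqrt (sqn x))) (ger0_norm s0).
move: xr; rewrite le_eqVlt => /orP[/eqP xr|xr]; last first.
  by apply: uv; rewrite s0 /S ltr_sqrt.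
rewrite xr; apply/eqP; rewrite -subr_eq0 -/S -/(u S) -/(v S) -uvS subr_eq0; apply/eqP.
by apply: uv; rewrite lexx.
Unshelve. all: by end_near. Qed.

End Solution.

End Identification.

(** * The mass constraint and uniqueness *)

Section Mass.
Context {R : realType}.
Variables (p : R) (q qd : R -> R).
Hypotheses (p1 : 1 <= p) (hq : profile p q qd).

Let p0 : 0 < p. Proof. exact: lt_le_trans ltr01 p1. Qed.
Let rho : R := pi^-1.
Let rho0 : 0 < rho. Proof. exact: piV_gt0. Qed.

Lemma slope0 : slope qd 0 = 1.
Proof. by rewrite /slope (profile_slope0 p1 hq); field. Qed.

Lemma slope_continuous (t : R) : {for t, continuous (slope qd)}.
Proof. by case: hq => _ _ _ c; apply: cvgM; [exact: cvg_cst|exact: c]. Qed.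

Lemma profile_scaled_continuous (kap : R) : 0 <= kap ->
  continuous (fun t : R => q (kap * Num.max t 0)).
Proof.
move=> k0 t; have m0 : 0 <= Num.max t 0 by rewrite le_max lexx orbT.
apply: (@continuous_comp _ _ _ (fun t : R => kap * Num.max t 0) q).
  apply: cvgM; first exact: cvg_cst.
  by apply: (@continuous_max _ _ (fun t : R => t) (fun=> 0)); [exact: cvg_id|exact: cvg_cst].
by apply: isd_continuous; apply: (profile_derive hq); exact: mulr_ge0.
Qed.

Lemma sqball_cst_integral (c : R) : \int[lebesgue2]_(x in sqball rho) c = c.
Proof.
rewrite Rintegral_cst; last exact: measurable_sqball.
rewrite [X in fine X](_ : _ = (pi * rho)%:E); last exact: sqball_area (ltW rho0).
by rewrite /= mulfV ?mulr1// gt_eqF// pi_gt0.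
Qed.

(* The substitution [t = kap |x|^2] in an integral over the disk. *)
Lemma scaled_radial_integral (kap : R) (h P : R -> R) (g : R * R -> R) : 0 < kap ->
  continuous (fun t : R => h (q (kap * Num.max t 0))) ->
  (forall t : R, 0 < t < kap * rho -> is_derive t 1 P (h (q t))) ->
  {within `[0, kap * rho], continuous P} ->
  (forall x, sqn x < rho -> g x = h (q (kap * sqn x))) ->
  \int[lebesgue2]_(x in sqball rho) g x = (P (kap * rho) - P 0) / (kap * rho).
Proof.
move=> k0 ch dP cP gE.
have kn : kap != 0 by rewrite gt_eqF.
rewrite (@eq_Rintegral _ _ _ lebesgue2 _ (fun x => h (q (kap * Num.max (sqn x) 0)))); last first.
  by move=> x; rewrite inE => xr; rewrite gE// max_l// sqn_ge0.
have dP' (t : R) : 0 < t < rho -> is_derive t 1 (fun t => P (kap * t) / kap) (h (q (kap * Num.max t 0))).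
  move=> /andP[t0 tr]; rewrite max_l ?(ltW t0)//.
  have h1 : is_derive (kap * t) 1 P (h (q (kap * t))).
    by apply: dP; rewrite mulr_gt0//= ltr_pM2l.
  have h2 := isd_comp (isd_mull kap t 1) h1.
  by derive_tac; field.
have cP' : {within `[0, rho], continuous (fun t => P (kap * t) / kap)}.
  apply/within_continuous_epsP => x /=; rewrite in_itv /= => /andP[x0 xr] e e0.
  have kx (y : R) : 0 <= y -> y <= rho -> `[0, kap * rho]%classic (kap * y).
    by move=> y0 yr; rewrite /= in_itv /= mulr_ge0 ?(ltW k0)//= ler_pM2l.
  have [d d0 hd] := (within_continuous_epsP _ _).1 cP _ (kx x x0 xr) (e * kap) (mulr_gt0 e0 k0).
  exists (d / kap); first by rewrite divr_gt0.
  move=> y; rewrite in_itv /= => /andP[y0 yr]; rewrite ltr_pdivlMr// => yx.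
  rewrite -mulrBl normrM normfV (gtr0_norm k0) ltr_pdivrMr//.
  apply: hd; first exact: kx.
  by rewrite -mulrBr normrM (gtr0_norm k0) mulrC.
rewrite (radial_integral rho0 ch dP' cP') mulr0 /rho.
have := @pi_gt0 R; move: (pi : R) (P _) (P _) => c a b c0.
by field; rewrite kn gt_eqF.
Qed.

Lemma profile_mass_integral (kap c : R) (g : R * R -> R) : 0 <= kap ->
  (forall x, sqn x < rho -> g x = c * ppow p (q (kap * sqn x))) ->
  \int[lebesgue2]_(x in sqball rho) g x = c * slope qd (kap * rho).
Proof.
rewrite le_eqVlt => /orP[/eqP<- gE|k0 gE].
  rewrite mul0r slope0 -[RHS]sqball_cst_integral.
  apply: eq_Rintegral => x; rewrite inE => xr; rewrite gE// mul0r (profile0 hq).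
  by rewrite ppow_pos ?powR1.
have cpow : continuous (fun u : R => c * ppow p (q (kap * Num.max u 0))).
  move=> u; apply: cvgM; first exact: cvg_cst.
  apply: continuous_comp; last exact: ppow_continuous.
  by apply: profile_scaled_continuous; exact: ltW.
have dP (t : R) : 0 <= t ->
    is_derive t 1 (fun t => c * (- 4 * (t * qd t))) (c * ppow p (q t)).
  move=> t0; have h := profile_mass_derive hq t0.
  notypeclasses refine (isd_eq (isd_mul (isd_cst _ _ _) h) _).
  by rewrite mulr0 addr0.
have dP' (t : R) : 0 < t < kap * rho ->
    is_derive t 1 (fun t => c * (- 4 * (t * qd t))) (c * ppow p (q t)).
  by move=> /andP[/ltW t0 _]; exact: dP.
have cP : {within `[0, kap * rho], continuous (fun t => c * (- 4 * (t * qd t)))}.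
  have d (t : R) : `[0, kap * rho]%classic t ->
      is_derive t 1 (fun t => c * (- 4 * (t * qd t))) (c * ppow p (q t)).
    by rewrite /= in_itv /= => /andP[t0 _]; exact: dP.
  exact: isd_within d.
rewrite (@scaled_radial_integral kap (fun u => c * ppow p u) _ g k0 cpow dP' cP gE).
rewrite mul0r !mulr0 subr0 /slope.
by field; rewrite !gt_eqF// mulr_gt0.
Qed.

Section Uniqueness.
Variables (T r lam alpha : R) (psi : R * R -> R).
Hypotheses (T0 : 0 < T) (qT : q T = 0) (sol : solution p r lam alpha psi) (lam_ge0 : 0 <= lam).

Let sol_cont : {within [set x | sqn x <= rho], continuous psi}.
Proof. by case: sol => -[[h _ _ _ _] _ _] _ _ _; rewrite -closure_diskE. Qed.

Let sol_bd x : sqn x = rho -> psi x = 0.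
Proof. by case: sol => -[_ h _] _ _ _ xr; apply: h; rewrite disk_bdE. Qed.

(** Here the scale [kap] degenerates to 0, so the problem is solved directly: the mass forces
    [alpha = 1], and [psi] and [(rho - |x|^2) / 4] have the same Laplacian -1 and the same boundary
    values. *)
Let solution_profile0 : lam = 0 -> alpha = 1 /\ forall x, sqn x <= rho -> psi x = psiT q qd 0 x.
Proof.
move=> l0.
have [[C _ _] hL hI a0] := sol.
have a1 : alpha = 1.
  have : alpha `^ p = 1.
    rewrite -hI diskE -[LHS]sqball_cst_integral; apply: eq_Rintegral => x _.
    by rewrite l0 mul0r addr0.
  move=> h; apply: (powR_injective p0); rewrite ?nnegrE//.
  by rewrite h powR1.
split=> // x xr; rewrite /psiT eqxx -/rho.
pose P (x : R * R) := 4^-1 * rho + (- 4^-1) * sqn x.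
have PE : (rho - sqn x) / 4 = P x by rewrite /P; ring.
have e0 : unitv (1 : R, 0 : R) by rewrite /unitv /= expr0n expr1n addr0.
have lap_sqn (y : R * R) : has_lapl (1, 0) (@sqn R) y 4.
  have -> : @sqn R = (fun y => (dotp (1, 0) y - 0) ^+ 2 + (dotp (0, 1) y - 0) ^+ 2).
    by apply/funext => z; rewrite /sqn /dotp /=; ring.
  rewrite (_ : 4 = 2 + 2 :> R); last by ring.
  apply: has_lapl_add; first exact: has_lapl_dotp_sqr.
  move=> eps eps0; exists 1 => // h _.
  rewrite (_ : fivepoint _ _ _ _ - _ = 0); first by rewrite normr0 mulr_ge0 ?sqr_ge0 ?(ltW eps0).
  by rewrite /fivepoint /dotp /=; ring.
have lapP (y : R * R) : has_lapl (1, 0) P y (-1).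
  rewrite (_ : -1 = 0 + (- 4^-1) * 4 :> R); last by field.
  by apply: has_lapl_add; [exact: has_lapl_cst|exact: has_lapl_scale].
have lap_psi (y : R * R) : sqn y < rho -> has_lapl (1, 0) psi y (-1).
  move=> yr; have yd : disk y by rewrite diskE.
  have := C2r_has_lapl C e0 yd; have := hL y yd.
  rewrite l0 mul0r addr0 a1 powR1 => h; rewrite (_ : laplacian psi y = -1)//.
  by rewrite -[LHS]opprK h.
have cP : continuous P.
  by move=> y; apply: cvgD; [exact: cvg_cst|apply: cvgM; [exact: cvg_cst|exact: continuous_sqn]].
pose s := Num.sqrt rho.
have in_strip (y : R * R) : sqn y <= rho -> strip rho (- s - 1) (s + 1) (1, 0) y.
  move=> yr; have h : `|dotp (1, 0) y| <= s.
    rewrite /dotp /= mul1r mul0r addr0 -(@sqrtr_sqr _ y.1) ler_wsqrtr// (le_trans _ yr)//.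
    by rewrite lerDl sqr_ge0.
  by move: h; rewrite ler_norml => /andP[? ?]; split; [split|] => //=; lra.
(* Both signs of the difference are nonnegative by the maximum principle with [L = 0], in a strip
   wide enough to contain the whole disk. *)
have main (c : R) : (c = 1 \/ c = -1) -> 0 <= c * psi x + (- c) * P x.
  move=> hc.
  apply: (@strip_max_principle _ (1, 0) rho (- s - 1) (s + 1) 0
    (fun x => c * psi x + (- c) * P x)) => //.
  - have := sqrtr_ge0 rho; rewrite -/s; lra.
  - by rewrite mulr0.
  - have cpsi : {within strip rho (- s - 1) (s + 1) (1, 0), continuous psi}.
      by apply: continuous_subspaceW sol_cont => y [[]].
    have cPs : {within strip rho (- s - 1) (s + 1) (1, 0), continuous P}.
      exact: continuous_subspaceT.
    move=> y; apply: cvgD; apply: cvgM; try exact: cvg_cst; [exact: cpsi|exact: cPs].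
  - move=> y yr _ _; exists (c * (-1) + (- c) * (-1)); last by rewrite oppr0 mul0r mulrN1 mulrN1 opprK addNr.
    by apply: has_lapl_add; apply: has_lapl_scale; [exact: lap_psi|exact: lapP].
  - move=> y [[/= yr y1] y2].
    have : `|dotp (1, 0) y| <= s.
      rewrite /dotp /= mul1r mul0r addr0 -(@sqrtr_sqr _ y.1) ler_wsqrtr// (le_trans _ yr)//.
      by rewrite lerDl sqr_ge0.
    rewrite ler_norml => /andP[h1 h2] [yrho|[yy|yy]]; [|exfalso; lra|exfalso; lra].
    by rewrite (sol_bd yrho) /P yrho mulr0 add0r (_ : - c * _ = 0)//; ring.
  - exact: in_strip.
rewrite PE; have := main 1 (or_introl erefl); have := main (-1) (or_intror erefl); lra.
Qed.

(** The mass constraint reads [M^p * slope t = 1], so [t = kap / pi] determines the central value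
    [M] and with it [lam], [alpha] and [psi]. *)
Lemma solution_profile : exists t, [/\ 0 <= t <= T, lam = lamT p qd t,
  alpha = alphaT p q qd t & forall x, closure disk x -> psi x = psiT q qd t x].
Proof.
rewrite closure_diskE; move: lam_ge0; rewrite le_eqVlt => /orP[/eqP l0|lam0].
  have [a1 hpsi] := solution_profile0 (esym l0).
  exists 0; split; rewrite ?lexx ?(ltW T0)//.
    by rewrite /lamT mulr0 mul0r l0.
  by rewrite /alphaT slope0 powR1 mulr1 (profile0 hq).
have [M M0 hM] := solution_axis p1 hq sol lam_ge0 lam0.
pose kap := lam * M `^ (p - 1); pose t := kap * rho.
rewrite -/kap in hM.
have kap0 : 0 < kap by rewrite mulr_gt0// powR_gt0.
have t0 : 0 < t by rewrite mulr_gt0.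
have piV : pi * rho = 1 :> R by rewrite mulfV// gt_eqF// pi_gt0.
have kapE : kap = t * pi by rewrite /t -mulrA (mulrC rho) piV mulr1.
have at0 : 0 < slope qd t by apply: (slope_gt0 p1 hq); exact: ltW.
have [_ _ hI a0] := sol.
have mass : M `^ p * slope qd t = 1.
  have Mp0 : M `^ p != 0 by rewrite gt_eqF// powR_gt0.
  have e : \int[lebesgue2]_(x in sqball rho) (M `^ p * ppow p (q (kap * sqn x))) = 1.
    rewrite -hI diskE; apply: eq_Rintegral => x; rewrite inE => /ltW xr.
    rewrite hM// -ppow_scale ?(ltW M0)// ppow_pos// -hM//.
    rewrite addr_ge0// mulr_ge0//; case: sol => -[_ bd pos] _ _ _.
    by move: xr; rewrite le_eqVlt => /orP[/eqP/sol_bd->//|xr]; apply/ltW/pos; rewrite diskE.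
  by rewrite -[RHS]e (@profile_mass_integral kap (M `^ p))//; exact: ltW.
have slE : slope qd t = M `^ (- p).
  rewrite powRN -[LHS]mul1r -(mulVf (_ : M `^ p != 0)) -?mulrA ?mass ?mulr1//.
  by rewrite gt_eqF// powR_gt0.
have pn : p != 0 by rewrite gt_eqF.
have Msl : slope qd t `^ (- p^-1) = M.
  by rewrite slE -powRrM mulrNN mulfV// powRr1// ltW.
have lamE : lam = lamT p qd t.
  rewrite /lamT slE -powRrM (mulrC pi) -kapE /kap -mulrA.
  rewrite -powRD; last by rewrite (gt_eqF M0) implybT.
  rewrite (_ : p - 1 + - p * (1 - p^-1) = 0) ?powRr0 ?mulr1//.
  by field.
have alphaE : alpha = M * q t.
  have x0 : sqn (Num.sqrt rho, 0 : R) = rho.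
    by rewrite /sqn /= expr0n /= addr0 sqr_sqrtr// ltW.
  by have := hM (Num.sqrt rho, 0); rewrite x0 lexx => /(_ isT) <-; rewrite sol_bd// mulr0 addr0.
exists t; split.
(* Past [T] the profile is negative, and so would be [alpha = M q t]. *)
- rewrite ltW//= leNgt; apply/negP => Tt.
  have : q t < 0 by rewrite -qT; apply: (profile_decr p1 hq) => //; exact: ltW.
  by move: a0; rewrite alphaE pmulr_rge0// leNgt => /negP.
- exact: lamE.
- by rewrite /alphaT Msl mulrC.
- move=> x /= xr; rewrite /psiT gt_eqF//.
  have ln : lam != 0 by rewrite gt_eqF.
  have := hM x xr; rewrite alphaE kapE => h.
  have -> : psi x = (M * q (t * pi * sqn x) - M * q t) / lam.
    by rewrite -h addrAC subrr add0r mulrAC mulfV// mul1r.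
  have lamE2 : lam = M * (pi * (t * slope qd t)).
    rewrite {1}lamE /lamT powRD ?powRr1 ?(ltW at0)//; last first.
      by rewrite (gt_eqF at0) implybT.
    by rewrite Msl; ring.
  rewrite lamE2; have : pi * (t * slope qd t) != 0 by rewrite gt_eqF// mulr_gt0 ?pi_gt0// mulr_gt0.
  move: (pi * (t * slope qd t)) => D D0; field.
  by rewrite D0 gt_eqF.
Qed.

End Uniqueness.

End Mass.

(** * Radial functions in Hoelder spaces *)

Section RadialJet.
Context {R : realType}.
Variables (P P1 k : R -> R) (L : R).

(** Here [P1 = P'] and [k = t P'']. In the Hessian of [P (|x|^2)] the second derivative comes with
    [x_i x_j], of size at most [|x|^2], so control of [t P''] is enough for a Lipschitz Hessian. *)
Definition radial_jet := [/\ forall t : R, 0 <= t -> is_derive t 1 P (P1 t),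
  forall t : R, 0 < t -> is_derive t 1 P1 (k t / t),
  forall s t : R, 0 <= s -> 0 <= t -> `|P1 t - P1 s| <= L * `|t - s|,
  forall s t : R, 0 <= s -> 0 <= t -> `|k t - k s| <= L * `|t - s|
  & k 0 = 0].

Hypothesis jet : radial_jet.

Let f (x : R * R) := P (sqn x).

Definition coord (i : 'I_2) (x : R * R) : R := if i == ord0 then x.1 else x.2.

Definition radial_grad (i : 'I_2) (x : R * R) : R := 2 * coord i x * P1 (sqn x).

(* The junk value [k 0 / 0 = 0] is harmless: it is multiplied by 0 at the origin. *)
Definition radial_hess (i j : 'I_2) (x : R * R) : R :=
  2 * (i == j)%:R * P1 (sqn x) + 4 * coord i x * coord j x * (k (sqn x) / sqn x).

Let L0 : 0 <= L.
Proof.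
case: jet => _ _ h _ _; have := h 0 1 (lexx _) ler01.
by rewrite subr0 normr1 mulr1; exact: le_trans.
Qed.

(** Used at the origin, where [P1] is known to be continuous but a derivative is given for [t > 0]
    only. *)
Lemma isd_mul_at0 (g : R -> R) : {for 0, continuous g} -> is_derive (0 : R) 1 (fun s => s * g s) (g 0).
Proof.
move=> cg; suff h : (fun h => h^-1 *: (((fun s => s * g s) \o shift 0) (h *: 1) - 0 * g 0)) @ 0^' --> g 0.
  by split; [apply/cvg_ex; exists (g 0)|apply/cvg_lim].
apply/cvgrPdist_lt => e e0.
have /continuous_at_epsP/(_ e e0)[d d0 hd] := cg.
near=> h; have h0 : h != 0 by near: h; exact: nbhs_dnbhs_neq.
have hd' : `|h| < d by near: h; exact: dnbhs0_lt.
rewrite /= addr0 mul0r subr0 /GRing.scale /= mulr1 mulrA mulVf// mul1r distrC.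
by apply: hd; rewrite subr0.
Unshelve. all: by end_near. Qed.

Let P1_comp_cont (y s : R) : {for s, continuous (fun s : R => P1 (s ^+ 2 + y ^+ 2))}.
Proof.
have [_ _ lip _ _] := jet.
apply/continuous_at_epsP => e e0.
have c : {for s, continuous (fun s : R => L * (s ^+ 2 + y ^+ 2))}.
  have [d hd] : exists d, is_derive s 1 (fun s => L * (s ^+ 2 + y ^+ 2)) d by eexists; derive_rec.
  exact: isd_continuous hd.
move/continuous_at_epsP : c => /(_ e e0)[d d0 hd]; exists d => // t /hd.
apply: le_lt_trans; rewrite -mulrBr normrM (ger0_norm L0).
by apply: lip; rewrite addr_ge0 ?sqr_ge0.
Qed.

Let line_diag (y s : R) : is_derive s 1 (fun s => 2 * s * P1 (s ^+ 2 + y ^+ 2))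
  (2 * P1 (s ^+ 2 + y ^+ 2) + 4 * s * s * (k (s ^+ 2 + y ^+ 2) / (s ^+ 2 + y ^+ 2))).
Proof.
have [_ d1 _ _ _] := jet.
have t0 : 0 <= s ^+ 2 + y ^+ 2 by rewrite addr_ge0 ?sqr_ge0.
move: (t0); rewrite le_eqVlt => /orP[/eqP e|tp]; last first.
  have hs : is_derive s 1 (fun s => s ^+ 2 + y ^+ 2) (2 * s) by derive_tac; ring.
  have h := isd_comp hs (d1 _ tp).
  by derive_tac; ring.
have s0 : s = 0.
  by move/esym/eqP : e; rewrite paddr_eq0 ?sqr_ge0// !sqrf_eq0 => /andP[/eqP].
rewrite s0; have h := isd_mul_at0 (@P1_comp_cont y 0).
rewrite (_ : (fun s => 2 * s * P1 (s ^+ 2 + y ^+ 2)) = (fun s => 2 * (s * P1 (s ^+ 2 + y ^+ 2)))).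
  by derive_tac; ring.
by apply/funext => z; ring.
Qed.

Let line_off (y s : R) : is_derive s 1 (fun s => 2 * y * P1 (s ^+ 2 + y ^+ 2))
  (4 * y * s * (k (s ^+ 2 + y ^+ 2) / (s ^+ 2 + y ^+ 2))).
Proof.
have [_ d1 _ _ _] := jet.
have t0 : 0 <= s ^+ 2 + y ^+ 2 by rewrite addr_ge0 ?sqr_ge0.
move: (t0); rewrite le_eqVlt => /orP[/eqP e|tp]; last first.
  have hs : is_derive s 1 (fun s => s ^+ 2 + y ^+ 2) (2 * s) by derive_tac; ring.
  have h := isd_comp hs (d1 _ tp).
  by derive_tac; ring.
have y0 : y = 0.
  by move/esym/eqP : e; rewrite paddr_eq0 ?sqr_ge0// !sqrf_eq0 => /andP[_ /eqP].
rewrite y0 (_ : (fun s => _) = (fun=> 0)); last by apply/funext => z; rewrite mulr0 mul0r.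
by rewrite mulr0 !mul0r; exact: isd_cst.
Qed.

Let i1 : 'I_2 := lift ord0 ord0.

Lemma ord2P (i : 'I_2) : i = ord0 \/ i = i1.
Proof. by case: i => -[|[|//]] ?; [left|right]; apply/val_inj. Qed.

Lemma radial_derive i x : is_derive x (dir i) f (radial_grad i x).
Proof.
have [d0 _ _ _ _] := jet; case: x => a y.
case: (ord2P i) => ->; [apply/is_derive_dir0|apply/is_derive_dir1];
  rewrite /radial_grad /coord /f /sqn /=.
- have hs : is_derive a 1 (fun s => s ^+ 2 + y ^+ 2) (2 * a) by derive_tac; ring.
  have t0 : 0 <= a ^+ 2 + y ^+ 2 by rewrite addr_ge0 ?sqr_ge0.
  by apply: isd_eq (isd_comp hs (d0 _ t0)) _; ring.
- have hs : is_derive y 1 (fun s => a ^+ 2 + s ^+ 2) (2 * y) by derive_tac; ring.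
  have t0 : 0 <= a ^+ 2 + y ^+ 2 by rewrite addr_ge0 ?sqr_ge0.
  by apply: isd_eq (isd_comp hs (d0 _ t0)) _; ring.
Qed.

Lemma radial_grad_derive i j x : is_derive x (dir i) (radial_grad j) (radial_hess i j x).
Proof.
case: x => a y.
case: (ord2P i) => ->; case: (ord2P j) => ->; [apply/is_derive_dir0|apply/is_derive_dir0|
  apply/is_derive_dir1|apply/is_derive_dir1];
  rewrite /radial_grad /radial_hess /coord /sqn /=.
- by apply: isd_eq (line_diag y a) _; ring.
- by apply: isd_eq (line_off y a) _; ring.
- rewrite (_ : (fun s => _) = (fun s => 2 * a * P1 (s ^+ 2 + a ^+ 2))).
    by apply: isd_eq (line_off a y) _; rewrite (addrC (y ^+ 2)); ring.
  by apply/funext => s; rewrite addrC.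
- rewrite (_ : (fun s => _) = (fun s => 2 * s * P1 (s ^+ 2 + a ^+ 2))).
    by apply: isd_eq (line_diag a y) _; rewrite (addrC (y ^+ 2)); ring.
  by apply/funext => s; rewrite addrC.
Qed.

Lemma radial_pd i : pd i f = radial_grad i.
Proof. by apply/funext => x; case: (radial_derive i x). Qed.

Lemma radial_pd2 i j : pd i (pd j f) = radial_hess i j.
Proof. by rewrite radial_pd; apply/funext => x; case: (radial_grad_derive i j x). Qed.

Lemma radial_laplacian x : laplacian f x = 4 * P1 (sqn x) + 4 * k (sqn x).
Proof.
have [_ _ _ _ k0] := jet.
rewrite laplacianE !radial_pd2 /radial_hess /coord /=.
have [e|n0] := eqVneq (sqn x) 0; first by rewrite e k0; ring.
have xn : sqn x = x.1 ^+ 2 + x.2 ^+ 2 by [].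
transitivity (4 * P1 (sqn x) + 4 * (k (sqn x) * ((x.1 ^+ 2 + x.2 ^+ 2) / sqn x))); first by ring.
by rewrite -xn mulfV// mulr1.
Qed.

End RadialJet.

Section JetNorm.
Context {R : realType}.
Implicit Types x y : R * R.

Let rho : R := pi^-1.

Lemma rho_le1 : rho <= 1.
Proof. by rewrite invf_le1 ?pi_gt0// (le_trans _ (pi_ge2 R))// ler1n. Qed.

Lemma eucl_ge0 x : 0 <= eucl x. Proof. exact: sqrtr_ge0. Qed.

Lemma eucl_gt0 x : x != 0 -> 0 < eucl x.
Proof.
move=> x0; rewrite sqrtr_gt0 lt_neqAle addr_ge0 ?sqr_ge0// andbT.
apply: contra_neq x0 => /esym/eqP; rewrite paddr_eq0 ?sqr_ge0// !sqrf_eq0.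
by move=> /andP[/eqP h1 /eqP h2]; rewrite (surjective_pairing x) h1 h2.
Qed.

Lemma coord_dist i x y : `|coord i x - coord i y| <= eucl (x - y).
Proof.
rewrite /coord /eucl; case: ifP => _; rewrite -sqrtr_sqr ler_wsqrtr//.
  by rewrite lerDl sqr_ge0.
by rewrite lerDr sqr_ge0.
Qed.

Lemma coord_sqr_le i x : coord i x ^+ 2 <= sqn x.
Proof. by rewrite /coord /sqn; case: ifP => _; [rewrite lerDl|rewrite lerDr]; exact: sqr_ge0. Qed.

Lemma coord_le1 i x : sqn x <= rho -> `|coord i x| <= 1.
Proof.
move=> xr; rewrite -(@ler_pXn2r _ 2) ?nnegrE// real_normK ?num_real// expr1n.
exact: le_trans (coord_sqr_le i x) (le_trans xr rho_le1).
Qed.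

Lemma coordM_le i j x : `|coord i x * coord j x| <= sqn x.
Proof.
rewrite normrM; apply: le_trans (normM_le_sqr _ _) _.
have := coord_sqr_le i x; have := coord_sqr_le j x; lra.
Qed.

Lemma sqn_dist x y : sqn x <= rho -> sqn y <= rho -> `|sqn x - sqn y| <= 4 * eucl (x - y).
Proof.
move=> xr yr.
have one i : `|coord i x ^+ 2 - coord i y ^+ 2| <= 2 * eucl (x - y).
  rewrite subr_sqr normrM mulrC ler_pM//; last exact: coord_dist.
  apply: le_trans (ler_normD _ _) _; have := coord_le1 i xr; have := coord_le1 i yr; lra.
have := one ord0; have := one (lift ord0 ord0); rewrite /coord /=.
have -> : sqn x - sqn y = (x.1 ^+ 2 - y.1 ^+ 2) + (x.2 ^+ 2 - y.2 ^+ 2).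
  by rewrite /sqn; ring.
by move=> h1 h2; apply: le_trans (ler_normD _ _) _; lra.
Qed.

(** Splits [|A|] as [|A|^r |A|^(1 - r)]. With a fixed Lipschitz constant the Hoelder quotient thus
    tends to 0 with the sup norm, and this is where [r < 1] counts. *)
Lemma holder_interpolation (A C m e r : R) : 0 <= C -> 0 < e -> 0 < r < 1 ->
  `|A| <= C * e -> `|A| <= m -> `|A| / e `^ r <= C `^ r * m `^ (1 - r).
Proof.
move=> C0 e0 /andP[r0 r1] h1 h2.
have m0 : 0 <= m by exact: le_trans h2.
have er : 0 < e `^ r by rewrite powR_gt0.
rewrite ler_pdivrMr//.
have -> : `|A| = `|A| `^ r * `|A| `^ (1 - r).
  have [->|A0] := eqVneq A 0.
    by rewrite normr0 powR0 ?mul0r// gt_eqF.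
  rewrite -powRD ?(addrC r) ?subrK ?powRr1//.
  by rewrite normr_eq0 A0 implybT.
rewrite mulrAC -powRM ?(ltW e0)// ler_pM ?powR_ge0//.
  by apply: ge0_ler_powR; rewrite ?nnegrE ?mulr_ge0// ltW.
by apply: ge0_ler_powR; rewrite ?nnegrE ?subr_ge0 ?(ltW r1).
Qed.

Section Bounds.
Variables (P P1 k : R -> R) (L E : R).
Hypotheses (jet : radial_jet P P1 k L)
  (hP : forall t, 0 <= t <= rho -> `|P t| <= E)
  (hP1 : forall t, 0 <= t <= rho -> `|P1 t| <= E)
  (hk : forall t, 0 <= t <= rho -> `|k t| <= E).

Let rho0 : 0 < rho. Proof. exact: piV_gt0. Qed.

Let L0 : 0 <= L.
Proof.
case: jet => _ _ h _ _; have := h 0 1 (lexx _) ler01.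
by rewrite subr0 normr1 mulr1; exact: le_trans.
Qed.

Let E0 : 0 <= E.
Proof. by apply: le_trans (hP (t := 0) _); rewrite // lexx ltW. Qed.

Let sq_in x : sqn x <= rho -> 0 <= sqn x <= rho.
Proof. by move=> ->; rewrite sqn_ge0. Qed.

Lemma radial_grad_bound i x : sqn x <= rho -> `|radial_grad P1 i x| <= 2 * E.
Proof.
move=> xr; rewrite /radial_grad -mulrA normrM (@ger0_norm _ 2)// ler_pM2l//.
by rewrite normrM -[leRHS]mul1r ler_pM// ?coord_le1// hP1// sq_in.
Qed.

Lemma radial_hess_bound i j x : sqn x <= rho -> `|radial_hess P1 k i j x| <= 6 * E.
Proof.
move=> xr; have [_ _ _ _ k0] := jet.
have h1 : `|2 * (i == j)%:R * P1 (sqn x)| <= 2 * E.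
  rewrite normrM; apply: ler_pM => //; last by rewrite hP1// sq_in.
  by case: (i == j); rewrite ?mulr1 ?mulr0 ?normr0// ger0_norm.
have h2 : `|4 * coord i x * coord j x * (k (sqn x) / sqn x)| <= 4 * E.
  rewrite -!mulrA normrM (@ger0_norm _ 4)// ler_pM2l// !mulrA.
  have [e|n0] := eqVneq (sqn x) 0; first by rewrite e k0 mulr0 mul0r normr0.
  have s0 : 0 < sqn x by rewrite lt_neqAle eq_sym n0 sqn_ge0.
  rewrite normrM normfV (gtr0_norm s0) ler_pdivrMr// normrM mulrC ler_pM//.
    by rewrite hk// sq_in.
  exact: coordM_le.
by apply: le_trans (ler_normD _ _) _; lra.
Qed.

(** The quotient [K = k / t] is only bounded, but [t K = k] is Lipschitz:
    [|y|^2 (K (|x|^2) - K (|y|^2))] equals [(|y|^2 - |x|^2) K (|x|^2) + k (|x|^2) - k (|y|^2)]. The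
    three parts contribute [8 + 4 * 2 + 4 * 8 = 48]. *)
Lemma radial_hess_lipschitz i j x y : sqn x <= rho -> sqn y <= rho ->
  `|radial_hess P1 k i j x - radial_hess P1 k i j y| <= 48 * L * eucl (x - y).
Proof.
move=> xr yr; have [_ _ lip1 lipk k0] := jet.
have e0 := eucl_ge0 (x - y); set e := eucl _ in e0 *.
have sd : `|sqn x - sqn y| <= 4 * e := sqn_dist xr yr.
have h1 : `|P1 (sqn x) - P1 (sqn y)| <= L * (4 * e).
  by apply: le_trans (lip1 _ _ (sqn_ge0 y) (sqn_ge0 x)) _; rewrite ler_wpM2l.
pose K (t : R) := k t / t.
have tK (t : R) : t * K t = k t.
  have [->|t0] := eqVneq t 0; first by rewrite mul0r k0.
  by rewrite /K mulrC divfK.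
have KL (t : R) : 0 <= t -> `|K t| <= L.
  rewrite le_eqVlt => /orP[/eqP<-|t0]; first by rewrite /K k0 mul0r normr0.
  rewrite /K normrM normfV (gtr0_norm t0) ler_pdivrMr//.
  by have := lipk 0 t (lexx _) (ltW t0); rewrite k0 !subr0 (gtr0_norm t0).
have h2 : `|coord i y * coord j y * (K (sqn x) - K (sqn y))| <= 2 * L * (4 * e).
  apply: (@le_trans _ _ `|sqn y * (K (sqn x) - K (sqn y))|).
    rewrite !normrM ler_wpM2r// -normrM (ger0_norm (sqn_ge0 y)); exact: coordM_le.
  have -> : sqn y * (K (sqn x) - K (sqn y)) =
      (sqn y - sqn x) * K (sqn x) + (k (sqn x) - k (sqn y)).
    by rewrite -(tK (sqn x)) -(tK (sqn y)); ring.
  apply: le_trans (ler_normD _ _) _.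
  have a1 : `|(sqn y - sqn x) * K (sqn x)| <= L * (4 * e).
    by rewrite normrM distrC mulrC ler_pM// KL// sqn_ge0.
  have a2 : `|k (sqn x) - k (sqn y)| <= L * (4 * e).
    by apply: le_trans (lipk _ _ (sqn_ge0 y) (sqn_ge0 x)) _; rewrite ler_wpM2l.
  by lra.
have h3 : `|(coord i x * coord j x - coord i y * coord j y) * K (sqn x)| <= 2 * e * L.
  rewrite normrM ler_pM//; last by rewrite KL// sqn_ge0.
  have -> : coord i x * coord j x - coord i y * coord j y =
     coord i x * (coord j x - coord j y) + (coord i x - coord i y) * coord j y by ring.
  apply: le_trans (ler_normD _ _) _; rewrite !normrM.
  have b1 := ler_pM (normr_ge0 _) (normr_ge0 _) (coord_le1 i xr) (coord_dist j x y).
  have b2 := ler_pM (normr_ge0 _) (normr_ge0 _) (coord_dist i x y) (coord_le1 j yr).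
  by move: b1 b2; rewrite mul1r mulr1 -/e; lra.
have h4 : `|2 * (i == j)%:R * (P1 (sqn x) - P1 (sqn y))| <= 2 * (L * (4 * e)).
  rewrite normrM; apply: ler_pM => //.
  by case: (i == j); rewrite ?mulr1 ?mulr0 ?normr0// ger0_norm.
have -> : radial_hess P1 k i j x - radial_hess P1 k i j y =
    2 * (i == j)%:R * (P1 (sqn x) - P1 (sqn y))
    + (4 * ((coord i x * coord j x - coord i y * coord j y) * K (sqn x))
      + 4 * (coord i y * coord j y * (K (sqn x) - K (sqn y)))).
  by rewrite /radial_hess -/(K _) -/(K _); ring.
apply: le_trans (ler_normD _ _) _; apply: le_trans (lerD h4 (ler_normD _ _)) _.
rewrite !(normrM 4) (@ger0_norm _ 4)//.
move: h2 h3; move: (`|_|) (`|_|) => a b; lra.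
Qed.

Let f x := P (sqn x).

Lemma radial_sup_norm0 : (sup_norm disk f <= E%:E)%E.
Proof.
apply: ge_ereal_sup => _ [x xd <-]; rewrite diskE in xd.
by rewrite lee_fin hP// sq_in// ltW.
Qed.

Lemma radial_sup_norm1 i : (sup_norm disk (pd i f) <= (2 * E)%:E)%E.
Proof.
apply: ge_ereal_sup => _ [x xd <-]; rewrite diskE in xd.
by rewrite lee_fin (radial_pd jet) radial_grad_bound// ltW.
Qed.

Lemma radial_sup_norm2 i j : (sup_norm disk (pd i (pd j f)) <= (6 * E)%:E)%E.
Proof.
apply: ge_ereal_sup => _ [x xd <-]; rewrite diskE in xd.
by rewrite lee_fin (radial_pd2 jet) radial_hess_bound// ltW.
Qed.

Lemma radial_holder (r : R) i j : 0 < r < 1 ->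
  (holder_seminorm r disk (pd i (pd j f)) <= ((48 * L) `^ r * (12 * E) `^ (1 - r))%:E)%E.
Proof.
move=> r01; apply: ge_ereal_sup => _ [[x y] [xd yd xy] <-] /=; rewrite /= diskE in xd yd *.
rewrite lee_fin (radial_pd2 jet); apply: holder_interpolation => //.
- by rewrite mulr_ge0.
- by apply: eucl_gt0; rewrite subr_eq0.
- by apply: radial_hess_lipschitz; exact: ltW.
- apply: le_trans (ler_normB _ _) _.
  have := radial_hess_bound i j (ltW xd); have := radial_hess_bound i j (ltW yd); lra.
Qed.

(** The 29 is [1 + 2 * 2 + 4 * 6], from the derivatives of order 0, 1 and 2. For bounded [L] the
    whole bound tends to 0 with [E]. *)
Lemma radial_C2r_norm (r : R) : 0 < r < 1 ->
  (C2r_norm r disk f <= (29 * E + 4 * ((48 * L) `^ r * (12 * E) `^ (1 - r)))%:E)%E.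
Proof.
move=> r01; set h := (48 * L) `^ r * _.
have -> : (29 * E + 4 * h)%:E = (E%:E + \sum_(i < 2) (2 * E)%:E
    + \sum_(i < 2) \sum_(j < 2) ((6 * E)%:E + h%:E))%E.
  rewrite !big_ord_recl !big_ord0 !adde0 -!EFinD; congr EFin; ring.
rewrite /C2r_norm; apply: leeD; first apply: leeD.
- exact: radial_sup_norm0.
- by apply: lee_sum => i _; exact: radial_sup_norm1.
- apply: lee_sum => i _; apply: lee_sum => j _; apply: leeD.
    exact: radial_sup_norm2.
  exact: radial_holder.
Qed.

Lemma lipschitz_within (g : R * R -> R) (C : R) :
  (forall x y, sqn x <= rho -> sqn y <= rho -> `|g x - g y| <= C * eucl (x - y)) ->
  {within closure disk, continuous g}.
Proof.
move=> hg; rewrite closure_diskE; apply/within_continuous_epsP => x xr e e0.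
have C0 : 0 < 2 * (`|C| + 1) by rewrite mulr_gt0// ltr_wpDl.
exists (e / (2 * (`|C| + 1))); first by rewrite divr_gt0.
move=> y yr; rewrite ltr_pdivlMr// => yx.
apply: le_lt_trans (hg _ _ yr xr) _; apply: le_lt_trans yx.
have eu : eucl (y - x) <= 2 * `|y - x|.
  have n0 : 0 <= 2 * `|y - x| by rewrite mulr_ge0.
  rewrite -(ger0_norm n0) -sqrtr_sqr; apply: ler_wsqrtr.
  have a1 : (y - x).1 ^+ 2 <= `|y - x| ^+ 2.
    rewrite -(real_normK (num_real _)) ler_pXn2r ?nnegrE//.
    by rewrite [leRHS]/Num.norm /= le_max lexx.
  have a2 : (y - x).2 ^+ 2 <= `|y - x| ^+ 2.
    rewrite -(real_normK (num_real _)) ler_pXn2r ?nnegrE//.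
    by rewrite [leRHS]/Num.norm /= le_max lexx orbT.
  rewrite exprMn; have := sqr_ge0 `|y - x|; lra.
apply: (@le_trans _ _ (`|C| * eucl (y - x))).
  by rewrite ler_wpM2r ?eucl_ge0// ler_norm.
apply: (@le_trans _ _ (`|C| * (2 * `|y - x|))); first by rewrite ler_wpM2l.
rewrite (_ : `|y - x| * _ = `|C| * (2 * `|y - x|) + 2 * `|y - x|); last by ring.
by rewrite lerDl mulr_ge0.
Qed.

Lemma radial_C2r (r : R) : 0 < r < 1 -> C2r r disk f.
Proof.
move=> r01; have [d0 _ lip1 _ _] := jet.
have ext (g : R * R -> R) : {within closure disk, continuous g} -> extends_cont disk g.
  by move=> cg; exists g.
split.
- apply: (@lipschitz_within _ (4 * E)) => x y xr yr.
  have seg (s t : R) : 0 <= s -> s <= t -> t <= rho -> `|P t - P s| <= E * (t - s).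
    move=> s0 st tr.
    have dP (u : R) : s < u < t -> is_derive u 1 P (P1 u) by move=> /andP[su _]; apply: d0; lra.
    have cP : {within `[s, t], continuous P}.
      have h (u : R) : `[s, t]%classic u -> is_derive u 1 P (P1 u).
        by rewrite /= in_itv /= => /andP[su _]; apply: d0; lra.
      exact: isd_within h.
    by apply: (increment_bound st dP cP) => u /andP[su ut]; apply: hP1; apply/andP; split; lra.
  have sd := sqn_dist xr yr.
  have [le|/ltW le] := leP (sqn y) (sqn x).
    apply: le_trans (seg _ _ (sqn_ge0 y) le xr) _; rewrite (mulrC 4) -mulrA ler_wpM2l//.
    by apply: le_trans sd; rewrite ler_norm.
  rewrite distrC; apply: le_trans (seg _ _ (sqn_ge0 x) le yr) _; rewrite (mulrC 4) -mulrA ler_wpM2l//.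
  by apply: le_trans sd; rewrite distrC ler_norm.
- by move=> i x _; case: (radial_derive jet i x).
- move=> i; apply: ext; rewrite (radial_pd jet).
  apply: (@lipschitz_within _ (2 * E + 8 * L)) => x y xr yr.
  have -> : radial_grad P1 i x - radial_grad P1 i y =
     2 * ((coord i x - coord i y) * P1 (sqn x)) + 2 * (coord i y * (P1 (sqn x) - P1 (sqn y))).
    by rewrite /radial_grad; ring.
  apply: le_trans (ler_normD _ _) _; rewrite !(normrM 2) (@ger0_norm _ 2)// !normrM.
  have b1 := ler_pM (normr_ge0 _) (normr_ge0 _) (coord_dist i x y) (hP1 (sq_in xr)).
  have b3 : `|P1 (sqn x) - P1 (sqn y)| <= L * (4 * eucl (x - y)).
    by apply: le_trans (lip1 _ _ (sqn_ge0 y) (sqn_ge0 x)) _; rewrite ler_wpM2l// sqn_dist.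
  have b2 := ler_pM (normr_ge0 _) (normr_ge0 _) (coord_le1 i yr) b3.
  by move: b1 b2; lra.
- by move=> i j x _; rewrite (radial_pd jet); case: (radial_grad_derive jet i j x).
- move=> i j; split.
    apply: ext; rewrite (radial_pd2 jet).
    by apply: (@lipschitz_within _ (48 * L)) => x y; exact: radial_hess_lipschitz.
  exact: le_lt_trans (radial_holder i j r01) (ltry _).
Qed.

End Bounds.

End JetNorm.

(** * The solution curve *)

Lemma radial_jet_sub {R : realType} (P P1 k P' P1' k' : R -> R) (L L' : R) :
  radial_jet P P1 k L -> radial_jet P' P1' k' L' ->
  radial_jet (fun t => P t - P' t) (fun t => P1 t - P1' t) (fun t => k t - k' t) (L + L').
Proof.
have arith (a b c d L1 L2 e : R) : `|a - b| <= L1 * e -> `|c - d| <= L2 * e ->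
    `|a - c - (b - d)| <= (L1 + L2) * e.
  move=> h1 h2; rewrite (_ : a - c - (b - d) = (a - b) - (c - d)); last by ring.
  by apply: le_trans (ler_normB _ _) _; rewrite mulrDl lerD.
move=> [d1 d2 l1 l2 z] [d1' d2' l1' l2' z']; split.
- by move=> t t0; have h := d1 t t0; have h' := d1' t t0; derive_tac.
- by move=> t t0; have h := d2 t t0; have h' := d2' t t0; derive_tac; rewrite mulrBl.
- by move=> s t s0 t0; apply: arith; [exact: l1|exact: l1'].
- by move=> s t s0 t0; apply: arith; [exact: l2|exact: l2'].
- by rewrite z z' subrr.
Qed.

Lemma quotient_dist {R : realType} (a b m n A B C c d : R) : 0 < c -> c <= m -> c <= n ->
  `|a - b| <= A * d -> `|b| <= B -> `|m - n| <= C * d ->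
  `|a / m - b / n| <= (A / c + B * C / c ^+ 2) * d.
Proof.
move=> c0 cm cn hA hB hC.
have m0 : 0 < m by exact: lt_le_trans cm.
have n0 : 0 < n by exact: lt_le_trans cn.
have -> : a / m - b / n = (a - b) / m - b * (m - n) / (m * n) by field; rewrite !gt_eqF.
apply: le_trans (ler_normB _ _) _; rewrite [leRHS]mulrDl; apply: lerD.
  rewrite normrM normfV (gtr0_norm m0) mulrAC ler_pM ?invr_ge0 ?(ltW m0)//.
  by rewrite lef_pV2 ?posrE.
rewrite normrM normfV (gtr0_norm (mulr_gt0 m0 n0)) [leRHS]mulrAC.
rewrite ler_pM ?invr_ge0 ?(ltW (mulr_gt0 m0 n0))//.
  by rewrite normrM -mulrA ler_pM.
by rewrite lef_pV2 ?posrE ?mulr_gt0 ?exprn_gt0// expr2 ler_pM// ltW.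
Qed.

Section Family.
Context {R : realType}.
Variables (p T : R) (q qd : R -> R).
Hypotheses (p1 : 1 <= p) (hq : profile p q qd) (T0 : 0 < T) (qT : q T = 0).

Let Q (t : R) := ppow p (q t).
Let k (t : R) := - (Q t / 4) - qd t.
Let p0 : 0 < p. Proof. exact: lt_le_trans ltr01 p1. Qed.
Let rho : R := pi^-1.
Let rho0 : 0 < rho. Proof. exact: piV_gt0. Qed.
Let pi0 : 0 < pi :> R. Proof. exact: pi_gt0. Qed.

Definition psi_radial (t s : R) : R :=
  if t == 0 then (rho - s) / 4 else (q (t * pi * s) - q t) / (pi * (t * slope qd t)).

Definition psi_radial1 (t s : R) : R := qd (t * pi * s) / slope qd t.

Definition psi_radial2 (t s : R) : R := k (t * pi * s) / slope qd t.

Lemma psi_radialE t : psiT q qd t = fun x => psi_radial t (sqn x).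
Proof. by []. Qed.

Lemma slope_lower_bound : exists2 c, 0 < c & forall t, 0 <= t <= T -> c <= slope qd t.
Proof.
have cs : {within `[0, T], continuous (slope qd)}.
  by apply: continuous_subspaceT; exact: (slope_continuous hq).
have [t] := EVT_min (ltW T0) cs; rewrite in_itv /= => /andP[t0 _] h.
exists (slope qd t); first exact: (slope_gt0 p1 hq).
by move=> s sT; apply: h; rewrite in_itv.
Qed.

Lemma psi_radial_jet (c t : R) : 0 < c -> c <= slope qd t -> 0 <= t <= T ->
  radial_jet (psi_radial t) (psi_radial1 t) (psi_radial2 t) (p / 8 * (T * pi) / c).
Proof.
move=> c0 ct /andP[t0 tT].
have s0 : 0 < slope qd t by exact: lt_le_trans ct.
have tp0 : 0 <= t * pi by rewrite mulr_ge0// ltW.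
have p8 : 0 <= p / 8 by rewrite divr_ge0// ltW.
have lip (g : R -> R) : (forall x y, 0 <= x -> 0 <= y -> `|g y - g x| <= p / 8 * `|y - x|) ->
    forall x y, 0 <= x -> 0 <= y ->
    `|g (t * pi * y) / slope qd t - g (t * pi * x) / slope qd t| <= p / 8 * (T * pi) / c * `|y - x|.
  move=> h x y x0 y0; rewrite -mulrBl normrM normfV (gtr0_norm s0) [leRHS]mulrAC.
  rewrite ler_pM ?invr_ge0 ?(ltW s0)//; last by rewrite lef_pV2 ?posrE.
  apply: le_trans (h _ _ (mulr_ge0 tp0 x0) (mulr_ge0 tp0 y0)) _.
  rewrite -mulrBr normrM (ger0_norm tp0) -(mulrA (p / 8)) ler_wpM2l//.
  by rewrite ler_wpM2r// ler_wpM2r// ltW.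
have ds (s : R) : is_derive s 1 (fun s => t * pi * s) (t * pi).
  by derive_tac; ring.
split.
- move=> s s_ge0; rewrite /psi_radial /psi_radial1; have [->|tn] := eqVneq t 0.
    by rewrite !mul0r (slope0 p1 hq) (profile_slope0 p1 hq); derive_tac; field.
  have h1 : is_derive (t * pi * s) 1 q (qd (t * pi * s)).
    exact: (profile_derive hq (mulr_ge0 tp0 s_ge0)).
  have h2 := isd_comp (ds s) h1.
  derive_tac; have := pi0; have := s0; move: (slope _ _) (pi : R) (qd _) => a b d a0 b0.
  by field; rewrite tn !gt_eqF.
- move=> s s_gt0; rewrite /psi_radial1 /psi_radial2; have [->|tn] := eqVneq t 0.
    rewrite !mul0r /k /Q (profile_second_at0 p1 hq) !mul0r.
    under eq_fun do rewrite mul0r.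
    exact: isd_cst.
  have tsp : 0 < t * pi * s by rewrite !mulr_gt0// lt_neqAle eq_sym tn.
  have h1 : is_derive (t * pi * s) 1 qd (k (t * pi * s) / (t * pi * s)).
    exact: (profile_slope_derive hq tsp).
  have h2 := isd_comp (ds s) h1.
  derive_tac; have := pi0; have := s0; move: (slope _ _) (pi : R) (k _) => a b d a0 b0.
  by field; rewrite tn !gt_eqF.
- apply: lip => x y x0 y0; apply: le_trans (profile_slope_lipschitz p1 hq x0 y0) _.
  by rewrite ler_wpM2r//; have := p0; lra.
- by apply: (lip k) => x y; exact: (profile_second_lipschitz p1 hq).
- by rewrite /psi_radial2 mulr0 /k /Q (profile_second_at0 p1 hq) mul0r.
Qed.

Lemma psi_radial_bd t : psi_radial t rho = 0.
Proof.
rewrite /psi_radial subrr mul0r; case: ifP => // _.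
by rewrite -mulrA mulfV ?mulr1 ?subrr ?mul0r// gt_eqF.
Qed.

(** The quotient defining [psi_radial] degenerates as its parameter tends to 0. Its values are
    therefore estimated through the derivative, integrated from the boundary over a length at most
    1. *)
Lemma jet_value_bound (P P1 k0 : R -> R) (L E : R) : radial_jet P P1 k0 L -> P rho = 0 ->
  (forall t, 0 <= t <= rho -> `|P1 t| <= E) -> forall t, 0 <= t <= rho -> `|P t| <= E.
Proof.
move=> [d _ _ _ _] Pr hE t /andP[t0 tr].
have E0 : 0 <= E by apply: le_trans (hE 0 _); rewrite // lexx ltW.
have dP (u : R) : t < u < rho -> is_derive u 1 P (P1 u) by move=> /andP[tu _]; apply: d; lra.
have cP : {within `[t, rho], continuous P}.
  have h (u : R) : `[t, rho]%classic u -> is_derive u 1 P (P1 u).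
    by rewrite /= in_itv /= => /andP[tu _]; apply: d; lra.
  exact: isd_within h.
have hb (u : R) : t < u < rho -> `|P1 u| <= E.
  by move=> /andP[? ?]; apply: hE; apply/andP; split; lra.
have := increment_bound tr dP cP hb; rewrite Pr sub0r normrN => /le_trans; apply.
by rewrite ler_piMr//; have := @rho_le1 R; rewrite -/rho; lra.
Qed.

Lemma psi_radial_dist : exists K L : R, forall t t' : R, 0 <= t <= T -> 0 <= t' <= T ->
  [/\ radial_jet (fun s => psi_radial t s - psi_radial t' s)
        (fun s => psi_radial1 t s - psi_radial1 t' s)
        (fun s => psi_radial2 t s - psi_radial2 t' s) L,
      forall s, 0 <= s <= rho -> `|psi_radial t s - psi_radial t' s| <= K * `|t - t'|,
      forall s, 0 <= s <= rho -> `|psi_radial1 t s - psi_radial1 t' s| <= K * `|t - t'|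
    & forall s, 0 <= s <= rho -> `|psi_radial2 t s - psi_radial2 t' s| <= K * `|t - t'|].
Proof.
have [c c0 hc] := slope_lower_bound.
pose K1 := p / 8 / c + 4^-1 * (p / 4) / c ^+ 2.
pose K2 := p / 8 / c + p / 8 * T * (p / 4) / c ^+ 2.
have p8 : 0 <= p / 8 by rewrite divr_ge0// ltW.
have p4 : 0 <= p / 4 by rewrite divr_ge0// ltW.
have K10 : 0 <= K1.
  by rewrite /K1 addr_ge0// divr_ge0 ?mulr_ge0 ?invr_ge0 ?exprn_ge0// ltW.
have K20 : 0 <= K2.
  by rewrite /K2 addr_ge0// divr_ge0 ?mulr_ge0 ?exprn_ge0// ltW.
exists (K1 + K2), (p / 8 * (T * pi) / c + p / 8 * (T * pi) / c) => t t' tT tT'.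
have jet : radial_jet (fun s => psi_radial t s - psi_radial t' s)
    (fun s => psi_radial1 t s - psi_radial1 t' s)
    (fun s => psi_radial2 t s - psi_radial2 t' s) (p / 8 * (T * pi) / c + p / 8 * (T * pi) / c).
  by apply: radial_jet_sub; apply: psi_radial_jet => //; exact: hc.
have arg (u s : R) : 0 <= u <= T -> 0 <= s <= rho -> 0 <= u * pi * s <= u.
  move=> /andP[u0 _] /andP[s0 sr]; rewrite !mulr_ge0 ?(ltW pi0)//= -mulrA ler_piMr//.
  by rewrite mulrC -ler_pdivlMr// mul1r.
have argd (s : R) : 0 <= s <= rho -> `|t * pi * s - t' * pi * s| <= `|t - t'|.
  move=> /andP[s0 sr]; rewrite -!mulrA -mulrBl normrM ler_piMr//.
  rewrite ger0_norm ?mulr_ge0 ?(ltW pi0)//.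
  by rewrite mulrC -ler_pdivlMr// mul1r.
have sl : `|slope qd t - slope qd t'| <= p / 4 * `|t - t'|.
  case/andP: tT => t0 _; case/andP: tT' => t0' _.
  rewrite /slope -mulrBr normrM normrN (@ger0_norm _ 4)//.
  have := profile_slope_lipschitz p1 hq t0' t0; lra.
have qb (u : R) : 0 <= u -> `|qd u| <= 4^-1.
  move=> u0; have := profile_slope_ge p1 hq u0; have := profile_slope_lt0 p1 hq u0.
  by rewrite ler_norml => a b; apply/andP; split => //; lra.
have kb (u : R) : 0 <= u <= T -> `|k u| <= p / 8 * T.
  move=> /andP[u0 uT]; have := profile_second_lipschitz p1 hq (lexx 0) u0.
  rewrite (profile_second_at0 p1 hq) !subr0 (ger0_norm u0) => /le_trans; apply.
  by rewrite ler_wpM2l.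
have b1 s : 0 <= s <= rho -> `|psi_radial1 t s - psi_radial1 t' s| <= K1 * `|t - t'|.
  move=> sr; have /andP[a0 _] := arg _ _ tT sr; have /andP[a0' _] := arg _ _ tT' sr.
  apply: quotient_dist => //; [exact: hc|exact: hc| |exact: qb].
  apply: le_trans (profile_slope_lipschitz p1 hq a0' a0) _; apply: ler_pM => //.
  - by rewrite divr_ge0// ltW.
  - by have := p0; lra.
  - exact: argd.
have b2 s : 0 <= s <= rho -> `|psi_radial2 t s - psi_radial2 t' s| <= K2 * `|t - t'|.
  move=> sr; have /andP[a0 _] := arg _ _ tT sr; have /andP[a0' at'] := arg _ _ tT' sr.
  apply: quotient_dist => //; [exact: hc|exact: hc| |].
    apply: le_trans (profile_second_lipschitz p1 hq a0' a0) _; apply: ler_pM => //.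
    exact: argd.
  by apply: kb; rewrite a0'/= (le_trans at')//; case/andP: tT'.
split=> //.
- apply: jet_value_bound jet _ _; first by rewrite !psi_radial_bd subrr.
  by move=> s /b1 /le_trans; apply; rewrite ler_wpM2r// lerDl.
- by move=> s /b1 /le_trans; apply; rewrite ler_wpM2r// lerDl.
- by move=> s /b2 /le_trans; apply; rewrite ler_wpM2r// lerDr.
Qed.

Lemma psiT_C2r (r t : R) : 0 < r < 1 -> 0 <= t <= T -> C2r r disk (psiT q qd t).
Proof.
move=> r01 tT; have [c c0 hc] := slope_lower_bound.
have jet := psi_radial_jet c0 (hc t tT) tT.
have [_ _ lip1 lip2 k0] := jet; set L := p / 8 * _ / c in jet lip1 lip2.
have L0 : 0 <= L.
  by have := lip2 0 1 (lexx _) ler01; rewrite !subr0 normr1 mulr1; exact: le_trans.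
pose E := L + `|psi_radial1 t 0|.
have sr (s : R) : 0 <= s <= rho -> L * s <= L.
  by move=> /andP[_ sr]; rewrite ler_piMr// (le_trans sr)// rho_le1.
have h1 s : 0 <= s <= rho -> `|psi_radial1 t s| <= E.
  move=> srho; have s0 : 0 <= s by case/andP: srho.
  have := lip1 0 s (lexx _) s0; rewrite subr0 (ger0_norm s0) => h.
  rewrite -[psi_radial1 t s](subrK (psi_radial1 t 0)); apply: le_trans (ler_normD _ _) _.
  by rewrite lerD2r (le_trans h)// sr.
apply: (@radial_C2r _ _ _ _ L E jet) => //.
- by apply: jet_value_bound jet _ h1; exact: psi_radial_bd.
- move=> s srho; have s0 : 0 <= s by case/andP: srho.
  have := lip2 0 s (lexx _) s0; rewrite k0 !subr0 (ger0_norm s0) => /le_trans; apply.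
  by apply: le_trans (sr s srho) _; rewrite lerDl.
Qed.

(** [lamT] cancels the denominator of [psiT] up to [slope^(- 1 / p)], the value at the centre. *)
Lemma psiT_base (t : R) x : 0 <= t ->
  alphaT p q qd t + lamT p qd t * psiT q qd t x = slope qd t `^ (- p^-1) * q (t * pi * sqn x).
Proof.
move=> t0; have s0 := slope_gt0 p1 hq t0.
rewrite /lamT /psiT /alphaT powRD; last by rewrite (gt_eqF s0) implybT.
rewrite powRr1 ?(ltW s0)//; case: ifPn => [/eqP ->|tn].
  by rewrite !(mul0r, mulr0) addr0 mulrC.
have := pi0; move: s0 (slope _ _ `^ _) (q (t * pi * sqn x)) (q t) (pi : R) => s0 a c d e e0.
move: (slope _ _) s0 => b b0; by field; rewrite tn !gt_eqF.
Qed.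

Lemma psiT_power (t : R) x : 0 <= t <= T -> sqn x <= rho ->
  (alphaT p q qd t + lamT p qd t * psiT q qd t x) `^ p = (slope qd t)^-1 * Q (t * pi * sqn x).
Proof.
move=> /andP[t0 tT] xr; have s0 := slope_gt0 p1 hq t0.
rewrite psiT_base// -ppow_pos.
  rewrite (ppow_scale p1) ?powR_ge0// -powRrM mulNr mulVf ?gt_eqF// powR_inv1//.
  exact: ltW.
rewrite mulr_ge0 ?powR_ge0//.
have : t * pi * sqn x <= T.
  rewrite (le_trans _ tT)// -mulrA ler_piMr//.
  by rewrite mulrC -ler_pdivlMr// mul1r.
rewrite le_eqVlt => /orP[/eqP->|h]; first by rewrite qT.
by apply/ltW/(profile_gt0 p1 hq qT); rewrite h !mulr_ge0 ?sqn_ge0// ltW.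
Qed.

Lemma psiT_solution (r t : R) : 0 < r < 1 -> 0 <= t <= T ->
  solution p r (lamT p qd t) (alphaT p q qd t) (psiT q qd t).
Proof.
move=> r01 tT; have /andP[t0 tT'] := tT; have s0 := slope_gt0 p1 hq t0.
have [c c0 hc] := slope_lower_bound.
have jet := psi_radial_jet c0 (hc t tT) tT.
split.
- split; first exact: psiT_C2r.
    by rewrite disk_bdE => x xr; rewrite psi_radialE xr psi_radial_bd.
  rewrite diskE => x; rewrite /sqball /= -/rho => xr.
  rewrite psi_radialE /psi_radial; case: ifPn => [_|tn].
    by rewrite divr_gt0// subr_gt0.
  have tp : 0 < t by rewrite lt_neqAle eq_sym tn.
  apply: divr_gt0; last exact: mulr_gt0 pi0 (mulr_gt0 tp s0).
  rewrite subr_gt0; apply: (profile_decr p1 hq).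
    by rewrite !mulr_ge0 ?sqn_ge0// ltW.
  by rewrite -mulrA gtr_pMr// mulrC -ltr_pdivlMr// mul1r.
- rewrite diskE => x /ltW xr; rewrite psiT_power//.
  rewrite psi_radialE (radial_laplacian jet) /psi_radial1 /psi_radial2 /k.
  by move: (qd _) (Q _) (slope qd t) s0 => a b d d0; field; rewrite gt_eqF.
- rewrite diskE (@profile_mass_integral _ _ _ _ p1 hq (t * pi) (slope qd t)^-1).
  + by rewrite mulfK ?gt_eqF// mulVf// gt_eqF.
  + by rewrite mulr_ge0// ltW.
  + by move=> x /ltW xr; exact: psiT_power.
- rewrite /alphaT mulr_ge0 ?powR_ge0//; move: tT'; rewrite le_eqVlt => /orP[/eqP->|tT'].
    by rewrite qT.
  by apply/ltW/(profile_gt0 p1 hq qT); rewrite t0.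
Qed.

End Family.

(** * Monotonicity and energy along the family *)

Section FamilyMonotonicity.
Context {R : realType}.
Variables (p T : R) (q qd : R -> R).
Hypotheses (p1 : 1 <= p) (hq : profile p q qd) (T0 : 0 < T) (qT : q T = 0).

Let Q (t : R) := ppow p (q t).
Let N (t : R) := - 4 * (t * qd t).
Let p0 : 0 < p. Proof. exact: lt_le_trans ltr01 p1. Qed.
Let rho : R := pi^-1.
Let pi0 : 0 < pi :> R. Proof. exact: pi_gt0. Qed.

Let mass_slope t : N t = t * slope qd t. Proof. by rewrite /N /slope; ring. Qed.

Lemma powR_continuous (a x : R) : 0 < x -> {for x, continuous (fun x => x `^ a)}.
Proof. by move=> x0; apply: isd_continuous (is_derive1_powR a x0). Qed.

Let slope_powR_continuous (a t : R) : 0 <= t -> {for t, continuous (fun t => slope qd t `^ a)}.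
Proof.
move=> t0; apply: (@continuous_comp _ _ _ (slope qd) (fun x => x `^ a)).
  exact: (slope_continuous hq).
exact: powR_continuous (slope_gt0 p1 hq t0).
Qed.

Lemma lamT_continuous t : 0 <= t -> {for t, continuous (lamT p qd)}.
Proof.
move=> t0; apply: cvgM; last exact: slope_powR_continuous.
by apply: cvgM; [exact: cvg_cst|exact: cvg_id].
Qed.

Lemma alphaT_continuous t : 0 <= t -> {for t, continuous (alphaT p q qd)}.
Proof.
move=> t0; apply: cvgM; last exact: slope_powR_continuous.
exact: isd_continuous (profile_derive hq t0).
Qed.

Lemma lamT0 : lamT p qd 0 = 0.
Proof. by rewrite /lamT mulr0 mul0r. Qed.

Lemma lamT_gt0 t : 0 < t -> 0 < lamT p qd t.
Proof.
move=> t0; apply: mulr_gt0; first exact: mulr_gt0.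
exact: powR_gt0 (slope_gt0 p1 hq (ltW t0)).
Qed.

(** For positive [t], [lamT t = pi t^(1 / p) N^(1 - 1 / p)]: the first power increases strictly, and
    the second is nondecreasing, being constant when [p = 1]. *)
Lemma lamT_lt s t : 0 <= s -> s < t -> lamT p qd s < lamT p qd t.
Proof.
rewrite le_eqVlt => /orP[/eqP<- t0|s0 st]; first by rewrite lamT0; exact: lamT_gt0.
have t0 := lt_trans s0 st.
have lamE u : 0 < u -> lamT p qd u = pi * (u `^ p^-1 * N u `^ (1 - p^-1)).
  move=> u0; rewrite mass_slope powRM ?(ltW u0)//; last exact: ltW (slope_gt0 p1 hq (ltW u0)).
  rewrite [X in pi * X]mulrA -powRD; last by rewrite (gt_eqF u0) implybT.
  by rewrite addrC subrK powRr1 ?ltW// /lamT mulrA.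
have e0 : 0 <= 1 - p^-1 by rewrite subr_ge0 invf_le1.
rewrite !lamE// ltr_pM2l//; apply: (@lt_le_trans _ _ (t `^ p^-1 * N s `^ (1 - p^-1))).
  rewrite ltr_pM2r; last exact: powR_gt0 (profile_mass_gt0 p1 hq s0).
  by apply: gt0_ltr_powR; rewrite ?invr_gt0// nnegrE ltW.
rewrite ler_pM2l ?powR_gt0//; apply: ge0_ler_powR => //; rewrite ?nnegrE.
- exact: ltW (profile_mass_gt0 p1 hq s0).
- exact: ltW (profile_mass_gt0 p1 hq t0).
- exact: (profile_mass_le hq (ltW s0) (ltW st)).
Qed.

(** Taking the power [1 / p] of [u Q / N] gives back [alphaT], so [profile_ratio_decr] applies. *)
Lemma alphaT_lt s t : 0 < s -> s < t -> t < T -> alphaT p q qd t < alphaT p q qd s.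
Proof.
move=> s0 st tT; have t0 := lt_trans s0 st; have sT := lt_trans st tT.
have alphaE u : 0 < u -> u < T ->
    0 < u * Q u / N u /\ alphaT p q qd u = (u * Q u / N u) `^ p^-1.
  move=> u0 uT; have sl := slope_gt0 p1 hq (ltW u0).
  have q0 : 0 < q u by apply: (profile_gt0 p1 hq qT); rewrite (ltW u0).
  have Q0 : 0 < Q u := ppow_gt0 _ q0.
  have -> : u * Q u / N u = Q u / slope qd u.
    by rewrite mass_slope -mulf_div mulfV ?mul1r// gt_eqF.
  split; first exact: divr_gt0.
  rewrite powRM ?invr_ge0 ?(ltW Q0) ?(ltW sl)// /Q ppow_pos ?(ltW q0)//.
  rewrite -powRrM mulfV ?gt_eqF// powRr1 ?(ltW q0)// /alphaT.
  by rewrite -(powR_inv1 (ltW sl)) -powRrM mulN1r.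
have [ht ->] := alphaE t t0 tT; have [hs ->] := alphaE s s0 sT.
apply: gt0_ltr_powR; rewrite ?invr_gt0 ?nnegrE ?(ltW ht) ?(ltW hs)//.
exact: (profile_ratio_decr p1 hq qT).
Qed.

(* The integrand [Q (q - q t)] has the primitive
   [u q Q + (p + 1) / 8 N^2 - q t N], because [N = - 4 u q'] and [N' = Q]. *)
Lemma psiT_energy t : 0 < t -> t <= T ->
  energy p (lamT p qd t) (alphaT p q qd t) (psiT q qd t) =
  (p + 1) / (16 * pi) - q t * (N t - t * Q t) / N t ^+ 2 / (2 * pi).
Proof.
move=> t0 tT; have sl := slope_gt0 p1 hq (ltW t0).
have k0 : 0 < t * pi by rewrite mulr_gt0.
pose C := (pi * t * slope qd t ^+ 2)^-1.
pose h (u : R) := C * (ppow p u * (u - q t)).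
pose P (u : R) := C * (u * q u * Q u + (p + 1) / 8 * N u ^+ 2 - q t * N u).
have ch : continuous (fun u : R => h (q (t * pi * Num.max u 0))).
  move=> u; have cq := profile_scaled_continuous hq (ltW k0) (x := u).
  apply: cvgM; first exact: cvg_cst.
  apply: cvgM; last by apply: cvgB; [exact: cq|exact: cvg_cst].
  by apply: continuous_comp; [exact: cq|exact: ppow_continuous].
have tpi : t * pi / pi = t by rewrite mulfK// gt_eqF.
have dP (u : R) : 0 < u < t * pi / pi -> is_derive u 1 P (h (q u)).
  rewrite tpi => /andP[u0 ut]; have uT : 0 <= u < T by rewrite (ltW u0) (lt_le_trans ut).
  have d1 := profile_derive hq (ltW u0).
  have d2 := profile_mass_derive hq (ltW u0); have d3 := profile_power_derive p1 hq qT uT.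
  have qu : q u != 0 by rewrite gt_eqF// (profile_gt0 p1 hq qT).
  have d4 : is_derive u 1 N (Q u) by [].
  have d5 : is_derive u 1 Q (p * Q u / q u * qd u) by [].
  rewrite /P; derive_tac; rewrite /h -/(Q u) /N.
  by move: (q t) (q u) qu (qd u) (Q u) => a b b0 c d; field.
have cP : {within `[0, t * pi / pi], continuous P}.
  rewrite tpi; have cq := profile_within hq (b := t) (lexx 0).
  have cN : {within `[0, t], continuous N} by exact: (profile_mass_within hq (lexx 0)).
  have cQ : {within `[0, t], continuous Q}.
    move=> u; apply: (@continuous_comp _ _ _ (q : subspace `[0, t] -> R) (ppow p)).
      exact: cq.
    exact: ppow_continuous.
  have ci : {within `[0, t], continuous (fun u : R => u)}.
    by apply: continuous_subspaceT => u; exact: cvg_id.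
  move=> u; apply: cvgM; first exact: cvg_cst.
  apply: cvgB; last by apply: cvgM; [exact: cvg_cst|exact: cN].
  apply: cvgD; last by apply: cvgM; [exact: cvg_cst|apply: cvgM; exact: cN].
  by apply: cvgM; [apply: cvgM; [exact: ci|exact: cq]|exact: cQ].
have gE x : sqn x < rho ->
    (alphaT p q qd t + lamT p qd t * psiT q qd t x) `^ p * psiT q qd t x =
    h (q (t * pi * sqn x)).
  move=> /ltW xr; rewrite (psiT_power p1 hq qT)//; last by rewrite ltW.
  rewrite /psiT gt_eqF// /h /C -/(Q _).
  have := pi0; move: sl; move: (slope qd t) (Q (t * pi * sqn x)) (q (t * pi * sqn x)) (q t) (pi : R) => a b c d e a0 e0.
  by field; rewrite !gt_eqF.
rewrite /energy diskE (scaled_radial_integral k0 ch dP cP gE) tpi.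
have -> : P 0 = 0 by rewrite /P /N !(mul0r, mulr0, expr0n, addr0, subr0).
rewrite subr0 /P mass_slope /C.
have := pi0; move: sl; move: (slope qd t) (Q t) (q t) (pi : R) => a b c e a0 e0.
by field; rewrite !gt_eqF.
Qed.

Lemma psiT_energy_lt s t : 0 < s -> s < t -> t < T ->
  energy p (lamT p qd s) (alphaT p q qd s) (psiT q qd s) <
  energy p (lamT p qd t) (alphaT p q qd t) (psiT q qd t).
Proof.
move=> s0 st tT; have t0 := lt_trans s0 st.
rewrite (psiT_energy t0 (ltW tT)) (psiT_energy s0 (ltW (lt_trans st tT))).
rewrite ltrD2l ltrN2 ltr_pM2r ?invr_gt0; first exact: (profile_energy_decr p1 hq qT).
by rewrite mulr_gt0.
Qed.

End FamilyMonotonicity.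

(** * Invariance under changes outside the closed disk *)

Section SolutionCongruence.
Context {R : realType}.

Lemma disk_near_eq (f g : R * R -> R) x : (forall y, disk y -> f y = g y) -> disk x ->
  {near x, f =1 g}.
Proof.
move=> fg; rewrite diskE => xr.
have := (@continuous_sqn R x); move/cvgrPdist_lt => /(_ (pi^-1 - sqn x)); rewrite subr_gt0 => /(_ xr).
apply: filterS => y; rewrite /= ltr_norml => /andP[h _]; apply: fg; rewrite diskE /sqball /=; lra.
Qed.

Lemma disk_pd_eq (f g : R * R -> R) i x : (forall y, disk y -> f y = g y) -> disk x ->
  pd i f x = pd i g x.
Proof. by move=> fg xd; apply: near_eq_derive; exact: disk_near_eq. Qed.

Lemma holder_seminorm_congr (r : R) (A : set (R * R)) (f g : R * R -> R) :
  (forall x, A x -> f x = g x) -> holder_seminorm r A f = holder_seminorm r A g.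
Proof.
move=> fg; congr (ereal_sup _); apply: eq_imagel => -[x y] /= [xd yd _].
by rewrite (fg x xd) (fg y yd).
Qed.

Lemma C2r_congr (r : R) (f g : R * R -> R) : (forall x, closure disk x -> f x = g x) ->
  C2r r disk f -> C2r r disk g.
Proof.
move=> fg [c d1 e1 d2 e2].
have fgd x : disk x -> f x = g x by move=> xd; apply: fg; exact: subset_closure.
have fg1 i x : disk x -> pd i f x = pd i g x by exact: disk_pd_eq.
have fg2 i j x : disk x -> pd i (pd j f) x = pd i (pd j g) x.
  by apply: disk_pd_eq => y; exact: fg1.
split.
- apply/within_continuous_epsP => x xd e e0.
  have [d d0 hd] := (within_continuous_epsP _ _).1 c x xd e e0.
  by exists d => // y yd yx; rewrite -!fg//; exact: hd.
- by move=> i x xd; apply: near_eq_derivable (d1 i x xd); exact: disk_near_eq.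
- by move=> i; have [h [ch eh]] := e1 i; exists h; split; [exact: ch|move=> x xd; rewrite (eh x xd); exact: fg1].
- by move=> i j x xd; apply: near_eq_derivable (d2 i j x xd); apply: disk_near_eq => // y; exact: fg1.
- move=> i j; have [[h [ch eh]] hh] := e2 i j; split.
    by exists h; split; [exact: ch|move=> x xd; rewrite (eh x xd); exact: fg2].
  by rewrite -(holder_seminorm_congr r (fg2 i j)).
Qed.

(** [Gstar] contains every total function representing a solution. Partial derivatives at points of
    the open disk are local, so each clause depends on the values on the closed disk only. *)
Lemma solution_congr (p r lam alpha : R) (f g : R * R -> R) :
  (forall x, closure disk x -> f x = g x) ->
  solution p r lam alpha f -> solution p r lam alpha g.
Proof.
move=> fg [[c bd pos] eqn mass a0].
have fgd x : disk x -> f x = g x by move=> xd; apply: fg; exact: subset_closure.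
split; last exact: a0.
- split; first exact: C2r_congr fg c.
    by move=> x xb; rewrite -(fg x) ?bd//; case: xb.
  by move=> x xd; rewrite -(fgd x xd) pos.
- move=> x xd; rewrite -(fgd x xd) -(eqn x xd); congr (- _).
  rewrite /laplacian; apply: eq_bigr => i _; apply: disk_pd_eq xd => y yd.
  by apply: disk_pd_eq yd => z zd; rewrite fgd.
- by rewrite -mass; apply: eq_Rintegral => x; rewrite inE => xd; rewrite (fgd x xd).
Qed.

(** The supremum of the empty set is [-oo], so the sign rests on exhibiting a point of the disk for
    the sup norms and two distinct points for the Hoelder seminorm. *)
Lemma C2r_norm_ge0 (r : R) (f : R * R -> R) : (0 <= C2r_norm r disk f)%E.
Proof.
have rho0 := @piV_gt0 R; set rho := pi^-1 in rho0.
pose a := Num.sqrt (rho / 2).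
have a0 : 0 < a by rewrite sqrtr_gt0 divr_gt0.
have a2 : a ^+ 2 < rho.
  by rewrite sqr_sqrtr; [rewrite ltr_pdivrMr//; lra|rewrite ltW// divr_gt0].
have d0 : disk (0 : R, 0 : R) by rewrite diskE /sqball /sqn /= expr0n /= addr0.
have da : disk (a, 0 : R) by rewrite diskE /sqball /sqn /= expr0n /= addr0.
have sup0 (g : R * R -> R) : (0 <= sup_norm disk g)%E.
  apply: le_trans (ereal_sup_ubound _); last by exists (0, 0); [exact: d0|reflexivity].
  by rewrite lee_fin.
have hold0 (g : R * R -> R) : (0 <= holder_seminorm r disk g)%E.
  apply: le_trans (ereal_sup_ubound _); last first.
    exists ((a, 0), (0, 0)); last reflexivity.
    by split=> //; apply/eqP => -[] ha; move: a0; rewrite ha ltxx.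
  by rewrite lee_fin divr_ge0// powR_ge0.
rewrite /C2r_norm adde_ge0//; first by rewrite adde_ge0// sume_ge0.
by rewrite sume_ge0// => i _; rewrite sume_ge0// => j _; rewrite adde_ge0.
Qed.

End SolutionCongruence.

Lemma modulus_cvg0 {R : realType} (a b c s e : R) : 0 <= a -> 0 <= b -> 0 <= c -> 0 < s -> 0 < e ->
  exists2 d, 0 < d & forall x, 0 <= x < d -> a * x + b * (c * x) `^ s < e.
Proof.
move=> a0 b0 c0 s0 e0; have e2 : 0 < e / 2 by rewrite divr_gt0.
have a1 : 0 < a + 1 by rewrite ltr_wpDl.
have b1 : 0 < b + 1 by rewrite ltr_wpDl.
have c1 : 0 < c + 1 by rewrite ltr_wpDl.
pose z := e / 2 / (b + 1); have z0 : 0 < z by rewrite divr_gt0.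
exists (Num.min (e / 2 / (a + 1)) (z `^ s^-1 / (c + 1))).
  by rewrite lt_min !divr_gt0// powR_gt0.
move=> x; rewrite lt_min => /andP[x0 /andP[x1 x2]].
have h1 : a * x < e / 2.
  by move: x1; rewrite ltr_pdivlMr// mulrDr mulr1 mulrC; lra.
have h2 : (c * x) `^ s < z.
  have cx : c * x < z `^ s^-1.
    by move: x2; rewrite ltr_pdivlMr// mulrDr mulr1 mulrC; lra.
  have := gt0_ltr_powR s0 _ _ cx; rewrite -powRrM mulVf ?gt_eqF// powRr1 ?(ltW z0)//.
  by apply; rewrite nnegrE ?powR_ge0// mulr_ge0.
have h3 : b * (c * x) `^ s <= e / 2.
  apply: (@le_trans _ _ ((b + 1) * z)); last by rewrite /z mulrC divfK// gt_eqF.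
  by rewrite ler_pM ?powR_ge0 ?lerDl// ltW.
by move: h1 h3; move: (a * x) (b * _) => u v; lra.
Qed.

(** The norm is an extended real; it is squeezed between 0 and a finite modulus of
    [|theta l - theta l0|], the sum of a linear term and of the power [1 - r] coming from
    interpolation. *)
Lemma psiT_cvg {R : realType} (p T r : R) (q qd : R -> R) (A : set R) (theta : R -> R) (l0 : R) :
  1 <= p -> profile p q qd -> 0 < T -> 0 < r < 1 ->
  (forall l, A l -> 0 <= theta l <= T) -> {within A, continuous theta} -> A l0 ->
  C2r_norm r disk (fun x => psiT q qd (theta l) x - psiT q qd (theta l0) x)
    @[l --> within A (nbhs l0)] --> 0%E.
Proof.
move=> p1 hq T0 r01 hT cT Al0; have [K [L hKL]] := psi_radial_dist p1 hq T0.
pose D l := `|theta l - theta l0|.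
pose G l := 29 * (K * D l) + 4 * ((48 * L) `^ r * (12 * (K * D l)) `^ (1 - r)).
have K0 : 0 <= K.
  have TT : 0 <= T <= T by rewrite lexx andbT ltW.
  have Z : (0 : R) <= 0 <= T by rewrite lexx ltW.
  have z : (0 : R) <= 0 <= (pi : R)^-1 by rewrite lexx (ltW (@piV_gt0 R)).
  have [_ h _ _] := hKL T 0 TT Z; have := h 0 z; rewrite subr0 (gtr0_norm T0) => h'.
  by rewrite -(pmulr_lge0 _ T0); apply: le_trans h'.
have bound l : A l -> (0 <= C2r_norm r disk
    (fun x => psiT q qd (theta l) x - psiT q qd (theta l0) x)%R <= (G l)%:E)%E.
  move=> Al; rewrite C2r_norm_ge0 andTb.
  have [jet h0 h1 h2] := hKL _ _ (hT _ Al) (hT _ Al0).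
  exact: (radial_C2r_norm jet h0 h1 h2 r01).
apply: (@squeeze_cvge _ _ _ _ (fun=> 0%E) _ (fun l => (G l)%:E)).
- by near=> l; apply: bound; near: l; exact: withinT.
- exact: cvg_cst.
- apply: cvg_EFin; first exact: nearW.
  apply/cvgrPdist_lt => e e0.
  have s0 : 0 < 1 - r by rewrite subr_gt0; case/andP: r01.
  have a0 : 0 <= 29 * K by rewrite mulr_ge0.
  have b0 : 0 <= 4 * (48 * L) `^ r by rewrite mulr_ge0// powR_ge0.
  have c0 : 0 <= 12 * K by rewrite mulr_ge0.
  have [d d0 hd] := modulus_cvg0 a0 b0 c0 s0 e0.
  have [d' d'0 hd'] := (within_continuous_epsP _ _).1 cT l0 Al0 d d0.
  rewrite near_withinE; apply/nbhs_normP; exists d' => // l /=; rewrite distrC => ll Al.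
  have Dl : 0 <= D l < d by rewrite normr_ge0 /=; exact: hd'.
  rewrite sub0r normrN ger0_norm /G.
    by have := hd _ Dl; rewrite !mulrA.
  by rewrite addr_ge0// mulr_ge0 ?mulr_ge0 ?powR_ge0// normr_ge0.
Unshelve. all: by end_near. Qed.

Theorem theorem1p4 (R : realType) (p r : R) (hp : 1 <= p) (hr : 0 < r < 1) :
  exists (ls : R) (alpha : R -> R) (psi : R -> R * R -> R),
    [/\ lambda_star p r = ls%:E,
        Gstar p r = curve_graph `[0, ls] alpha psi,
        continuous_curve r `[0, ls] alpha psi,
        {in `]0, ls[ &, {homo alpha : x y /~ x < y}} /\
        {in `]0, ls[ &,
          {homo (fun l => energy p l (alpha l) (psi l)) : x y / x < y}}
      & alpha ls = 0 /\
        energy p ls (alpha ls) (psi ls) = (p + 1) / (16 * pi)].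
Proof.
have [q [qd hq]] := @profile_exists R p hp.
have [T T0 qT] := profile_zero hp hq.
pose lam := lamT p qd.
have lam_lt (s t : R) : 0 <= s -> s < t -> lam s < lam t := @lamT_lt _ _ _ _ hp hq s t.
have lam0 : lam 0 = 0 := lamT0 _ _.
have lam_le (s t : R) : 0 <= s -> s <= t -> lam s <= lam t.
  by move=> s0; rewrite le_eqVlt => /orP[/eqP->//|st]; exact/ltW/lam_lt.
have lam_inj (s t : R) : 0 <= s -> 0 <= t -> lam s = lam t -> s = t.
  move=> s0 t0 st; case: (ltgtP s t) => // h.
    by have := lam_lt _ _ s0 h; rewrite st ltxx.
  by have := lam_lt _ _ t0 h; rewrite st ltxx.
have clam : {within `[0, T], continuous lam}.
  apply: continuous_in_subspaceT => t; rewrite inE /= in_itv /= => /andP[t0 _].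
  exact: (lamT_continuous hp hq).
pose ls := lam T; have ls0 : 0 < ls by rewrite /ls -lam0 lam_lt.
(* [theta] is the inverse of [lam] on [[0, ls]]; its value 0 elsewhere is never looked at. *)
have /choice[theta htheta] (l : R) : exists t, 0 <= l <= ls -> 0 <= t <= T /\ lam t = l.
  have [lI|lI] := boolP (0 <= l <= ls); last by exists 0 => h; exfalso; move/negP: lI; apply.
  have lam0T : lam 0 <= lam T by rewrite lam0 ltW.
  have lI' : `[lam 0, lam T]%classic l by rewrite /= in_itv /= lam0.
  have [t] := segment_continuous_le_surjective (ltW T0) lam0T clam lI'.
  by rewrite /= in_itv /= => tT tl; exists t.
have thetaK t : 0 <= t <= T -> theta (lam t) = t.
  move=> /andP[t0 tT].
  have [/andP[u0 _]] : 0 <= theta (lam t) <= T /\ lam (theta (lam t)) = lam t.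
    by apply: htheta; rewrite -lam0 !lam_le.
  exact: lam_inj.
have ctheta : {within `[0, ls], continuous theta}.
  rewrite -lam0; apply: (segment_can_le_continuous (ltW T0) clam) => t.
  by rewrite in_itv /=; exact: thetaK.
have theta_itv l : `[0, ls]%classic l -> 0 <= theta l <= T.
  by rewrite /= in_itv /= => /htheta[].
have theta_lt (x y : R) : 0 <= x -> x < y -> y <= ls -> theta x < theta y.
  move=> x0 xy yl.
  have [/andP[tx0 _] ex] : 0 <= theta x <= T /\ lam (theta x) = x.
    by apply: htheta; rewrite x0 ltW// (lt_le_trans xy).
  have [/andP[ty0 _] ey] : 0 <= theta y <= T /\ lam (theta y) = y.
    by apply: htheta; rewrite yl andbT (le_trans x0)// ltW.
  by rewrite ltNge; apply/negP => h; have := lam_le _ _ ty0 h; rewrite ex ey leNgt xy.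
have theta_ls : theta ls = T by rewrite thetaK// (ltW T0) lexx.
have theta0 : theta 0 = 0 by rewrite -lam0 thetaK// lexx ltW.
have inner (x y : R) : x \in `]0, ls[ -> y \in `]0, ls[ -> x < y ->
    [/\ 0 < theta x, theta x < theta y & theta y < T].
  rewrite !in_itv /= => /andP[x0 _] /andP[_ yl] xy; split.
  - by rewrite -theta0 theta_lt// ltW// (lt_trans xy).
  - by rewrite theta_lt// ltW.
  - by rewrite -theta_ls theta_lt// ltW// (lt_trans x0).
have lamK (x : R) : x \in `]0, ls[ -> lam (theta x) = x.
  by rewrite in_itv /= => /andP[x0 xl]; have [] := htheta x; rewrite ?(ltW x0) ?(ltW xl).
pose alpha l := alphaT p q qd (theta l); pose psi l := psiT q qd (theta l).
have alpha_ls : alpha ls = 0 by rewrite /alpha theta_ls /alphaT qT mul0r.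
have sol l : 0 <= l <= ls -> solution p r l (alpha l) (psi l).
  by move=> /htheta[hT {1}<-]; exact: (psiT_solution hp hq T0 qT hr hT).
(* Besides uniqueness this yields [l <= ls]: there is no solution beyond [ls], which makes the
   domain of the curve exactly [[0, ls]]. *)
have uniq l a f : 0 <= l -> solution p r l a f ->
    [/\ 0 <= l <= ls, a = alpha l & forall x, closure disk x -> f x = psi l x].
  move=> l0 sf; have [t [tT lE aE fE]] := solution_profile hp hq T0 qT sf l0.
  have tE : theta l = t by rewrite lE thetaK.
  rewrite /alpha /psi tE; split=> //; rewrite l0 lE.
  by case/andP: tT => t0 tT; exact: lam_le.
exists ls, alpha, psi; split.
(* A number above [ls] is excluded by the solution at [ls], whose [alpha] is 0. The condition on
   [lambda] concerns [mu < lambda] only, so [ls] itself belongs to the set. *)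
- apply/eqP; rewrite eq_le; apply/andP; split.
    apply: ge_ereal_sup => _ [l [l0 hl] <-]; rewrite lee_fin leNgt; apply/negP => lsl.
    have lsI : 0 <= ls <= ls by rewrite lexx ltW.
    have muI : 0 <= ls < l by rewrite (ltW ls0).
    by have := hl ls _ _ muI (sol ls lsI); rewrite alpha_ls ltxx.
  apply: ereal_sup_ubound; exists ls => //; split=> // mu a f /andP[mu0 mul] sf.
  have [_ -> _] := uniq _ _ _ mu0 sf.
  have tT : theta mu < T by rewrite -theta_ls theta_lt.
  have /andP[t0 _] : 0 <= theta mu <= T by apply: theta_itv; rewrite /= in_itv /= mu0 ltW.
  apply: mulr_gt0; first by apply: (profile_gt0 hp hq qT); rewrite t0.
  exact: powR_gt0 (slope_gt0 hp hq t0).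
- apply/seteqP; split => -[[l a] f] /=.
    move=> [/= l0 sf]; have [lI aE fE] := uniq _ _ _ l0 sf.
    by split=> //=; rewrite in_itv.
  move=> [/=]; rewrite in_itv /= => lI -> fE; split; first by case/andP: lI.
  by apply: solution_congr (sol l lI) => x xd; exact/esym/fE.
- split.
    apply/subspace_continuousP => l lI.
    apply: (@cvg_comp _ _ _ theta (alphaT p q qd) _ (nbhs (theta l))).
      exact: ((subspace_continuousP _ _).1 ctheta l lI).
    by apply: (alphaT_continuous hp hq); case/andP: (theta_itv l lI).
  by move=> l lI; exact: (psiT_cvg hp hq T0 hr theta_itv ctheta lI).
- split=> x y xI yI xy.
    have [h1 h2 h3] := inner _ _ yI xI xy.
    exact: (alphaT_lt hp hq qT h1 h2 h3).
  have [h1 h2 h3] := inner _ _ xI yI xy.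
  have := psiT_energy_lt hp hq qT h1 h2 h3.
  by rewrite -!/(lam _) (lamK x xI) (lamK y yI).
- split=> //; rewrite /alpha /psi theta_ls (psiT_energy hp hq qT T0 (lexx T)).
  by rewrite qT !mul0r subr0.
Qed.
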